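(* Let $p\in \mathcal{P}^{\mathrm{log}}(\mathbb{R}^{n})$ with $1<p^{-}\leq p^{+}<\infty$, let $h\in \mathbb{R}^{n}$ and $k\in \mathbb{N}$. Then for all $v\in\mathbb{N}_0$ and all $f\in L^{p(\cdot )}(\mathbb{R}^{n})$ with $\mathrm{supp}\,\mathcal{F}f\subset \{\xi \in \mathbb{R}^{n}:|\xi|\leq 2^{v+1}\}$, we have $$\|\tau_{h}f\|_{p(\cdot)}\leq c\,\exp\Big(\big(2+2^{vnk}|h|^{k}\big)\,c_{\log}(1/p)\Big)\,\|f\|_{p(\cdot)},$$ where $c>0$ is independent of $h$, $v$ and $k$.
   Context: $\mathbb{N}=\{1,2,\dots\}$, $\mathbb{N}_0=\mathbb{N}\cup\{0\}$. The translation operator is $(\tau_h f)(x):=f(x+h)$ for $h\in\mathbb{R}^n$. $\mathcal{P}(\mathbb{R}^n)$ is the set of measurable functions $p:\mathbb{R}^n\to[1,\infty)$ (variable exponents); $p^-:=\operatorname{ess\,inf}_{x\in\mathbb{R}^n}p(x)$ and $p^+:=\operatorname{ess\,sup}_{x\in\mathbb{R}^n}p(x)$. The space $L^{p(\cdot)}(\mathbb{R}^n)$ consists of all measurable (complex-valued) functions $f$ on $\mathbb{R}^n$ such that $\varrho_{p(\cdot)}(f):=\int_{\mathbb{R}^n}|f(x)|^{p(x)}\,dx<\infty$, with norm $\|f\|_{p(\cdot)}:=\inf\{\mu>0:\varrho_{p(\cdot)}(f/\mu)\le 1\}$. A function $g:\mathbb{R}^n\to\mathbb{R}$ is locally $\log$-Hölder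 continuous if there is a constant $c_{\log}>0$ with $|g(x)-g(y)|\le \frac{c_{\log}}{\ln(e+1/|x-y|)}$ for all $x,y\in\mathbb{R}^n$; it satisfies the $\log$-Hölder decay condition if there are $g_\infty\in\mathbb{R}$ and $c_{\log}>0$ with $|g(x)-g_\infty|\le\frac{c_{\log}}{\ln(e+|x|)}$ for all $x\in\mathbb{R}^n$. $\mathcal{P}^{\mathrm{log}}(\mathbb{R}^n)$ is the set of $p\in\mathcal{P}(\mathbb{R}^n)$ satisfying both the local $\log$-Hölder continuity condition and the $\log$-Hölder decay condition, with $p_\infty:=\lim_{|x|\to\infty}p(x)$. For bounded $p\in\mathcal{P}^{\mathrm{log}}(\mathbb{R}^n)$ the function $1/p$ also satisfies both conditions, and $c_{\log}(1/p)$ denotes its $\log$-Hölder constant, i.e. the maximum of the smallest constants for which $1/p$ satisfies the local $\log$-Hölder condition and the $\log$-Hölder decay condition (with limit value $1/p_\infty$). $\mathcal{F}$ is the Fourier transform, $\mathcal{F}(f)(\xi)=(2\pi)^{-n/2}\int_{\mathbb{R}^n}e^{-ix\cdot\xi}f(x)\,dx$ for Schwartz functions $f$, extended to tempered distributions in the usual way; $L^{p(\cdot)}(\mathbb{R}^n)\subset\mathcal{S}'(\mathbb{R}^n)$, and $\mathrm{supp}\,\mathcal{F}f$ is understood in the sense of distributions. *)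

(* Defs.v *)
From HB Require Import structures.
From mathcomp Require Import all_boot all_order all_algebra.
From mathcomp Require Import all_classical all_reals all_analysis.
From mathcomp Require Import ess_sup_inf complex.

Set Implicit Arguments.
Unset Strict Implicit.
Unset Printing Implicit Defensive.

Import Order.TTheory GRing.Theory Num.Theory.
Import numFieldNormedType.Exports.

Local Open Scope classical_set_scope.
Local Open Scope ring_scope.

(* The norm that the library puts on 'rV[R]_n is the sup norm: it is used for
   topology and differentiability only. *)
Definition dotrV (R : realType) n (x y : 'rV[R]_n) : R :=
  \sum_(i < n) x 0 i * y 0 i.

Definition enorm (R : realType) n (x : 'rV[R]_n) : R := Num.sqrt (dotrV x x).

(* Lebesgue measure on 'rV[R]_n: the completion of the n-fold product of the
   one-dimensional Lebesgue measure on the product sigma-algebra. *)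
Section product_sigma_algebra.
Variables (R : realType) (n : nat).

Let coord : 'I_n -> 'rV[R]_n -> R := fun i v => v 0 i.

Let rV_set0 : g_sigma_preimage coord set0.
Proof. exact: sigma_algebra0. Qed.

Let rV_setC A : g_sigma_preimage coord A -> g_sigma_preimage coord (~` A).
Proof. exact: sigma_algebraC. Qed.

Let rV_bigcup (F : _^nat) : (forall i, g_sigma_preimage coord (F i)) ->
  g_sigma_preimage coord (\bigcup_i (F i)).
Proof. exact: sigma_algebra_bigcup. Qed.

HB.instance Definition _ := @isMeasurable.Build default_measure_display
  'rV[R]_n (g_sigma_preimage coord) rV_set0 rV_setC rV_bigcup.

Lemma measurable_coord (i : 'I_n) :
  measurable_fun [set: 'rV[R]_n] (fun v : 'rV[R]_n => v 0 i).
Proof.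
move=> _ Y mY; rewrite setTI; apply: sub_sigma_algebra => /=.
rewrite -bigcup_seq/=; exists i => /=; first by rewrite mem_index_enum.
by exists Y => //; rewrite setTI.
Qed.

Lemma measurable_fun_rVP d (T : measurableType d) (f : T -> 'rV[R]_n) :
  (forall i, measurable_fun [set: T] (fun x => f x 0 i)) ->
  measurable_fun [set: T] f.
Proof.
move=> mf _ A mA; rewrite setTI.
apply: (mA [set B | measurable (f @^-1` B)]); split => /=.
  split => /=.
  - by rewrite preimage_set0; exact: measurable0.
  - by move=> C mC; rewrite setTD preimage_setC; exact: measurableC.
  - by move=> F mF; rewrite preimage_bigcup; exact: bigcupT_measurable.
rewrite -bigcup_seq => C [i _ [D mD <-]]; rewrite setTI.
by have := mf i measurableT D mD; rewrite setTI.
Qed.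

End product_sigma_algebra.

Section borel_lebesgue_measure.
Variable R : realType.

Definition rVcons n (z : measurableTypeR R * 'rV[R]_n) : 'rV[R]_n.+1 :=
  row_mx (const_mx z.1 : 'rV[R]_1) z.2.

Definition rVuncons n (v : 'rV[R]_n.+1) :
    measurableTypeR R * 'rV[R]_n :=
  (v 0 0, rsubmx (v : 'rV[R]_(1 + n))).

Lemma rVconsK n : cancel (@rVcons n) (@rVuncons n).
Proof.
case=> x v; congr pair; last by rewrite /rVcons row_mxKr.
transitivity (row_mx (const_mx x : 'rV[R]_1) v 0 (lshift n 0)).
  by apply: (congr1 (row_mx (const_mx x : 'rV[R]_1) v 0)); exact: val_inj.
by rewrite row_mxEl mxE.
Qed.

Lemma measurable_rVcons n : measurable_fun setT (@rVcons n).
Proof.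
apply: measurable_fun_rVP => i.
case: (@splitP 1 n i) => j ij.
- rewrite (_ : (fun _ => _) = fst) //; apply/funext => -[x v] /=.
  rewrite /rVcons (_ : i = lshift n j); last exact/val_inj.
  by rewrite (@row_mxEl R 1 1 n) mxE.
- rewrite (_ : (fun _ => _) = (fun v : 'rV[R]_n => v 0 j) \o snd).
    by apply: measurableT_comp => //; exact: measurable_coord.
  apply/funext => -[x v] /=.
  rewrite /rVcons (_ : i = rshift 1 j); last exact/val_inj.
  by rewrite (@row_mxEr R 1 1 n).
Qed.

Lemma measurable_rVuncons n : measurable_fun setT (@rVuncons n).
Proof.
apply/measurable_fun_pairP; split; first exact: measurable_coord.
apply: measurable_fun_rVP => i.
rewrite (_ : (fun _ => _) = fun v : 'rV[R]_n.+1 => v 0 (rshift 1 i)).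
  exact: measurable_coord.
by apply/funext => v /=; rewrite mxE.
Qed.

Section step.
Variables (n : nat) (mu : {sigma_finite_measure set 'rV[R]_n -> \bar R}).

Definition rVcons_measure : set 'rV[R]_n.+1 -> \bar R :=
  pushforward (@lebesgue_measure R \x mu)%E (@rVcons n).

HB.instance Definition _ := Measure.copy rVcons_measure
  (measure_function_pushforward__canonical__measure_function_Measure
    (@lebesgue_measure R \x mu)%E (@measurable_rVcons n)).

Let sigma_finite_rVcons : sigma_finite setT rVcons_measure.
Proof.
have /sigma_finiteP[F [TF ndF Foo]] := sigma_finiteT (@lebesgue_measure R).
have /sigma_finiteP[G [TG ndG Goo]] := sigma_finiteT mu.
exists (fun k => @rVuncons n @^-1` (F k `*` G k)).
  rewrite -preimage_bigcup; apply/esym; rewrite -subTset => v _.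
  have [i _ Fi] : (\bigcup_i F i) (rVuncons v).1 by rewrite -TF.
  have [j _ Gj] : (\bigcup_i G i) (rVuncons v).2 by rewrite -TG.
  exists (maxn i j) => //; split.
    by move: Fi; apply/subsetPset/ndF/leq_maxl.
  by move: Gj; apply/subsetPset/ndG/leq_maxr.
move=> k; have [mF Fk] := Foo k; have [mG Gk] := Goo k; split.
  rewrite -[X in measurable X]setTI.
  by apply: measurable_rVuncons => //; exact: measurableX.
rewrite /rVcons_measure /pushforward -comp_preimage.
rewrite (_ : _ \o _ = id); last by apply/funext => z /=; rewrite rVconsK.
by rewrite [ltLHS]product_measure1E// lte_mul_pinfty// ge0_fin_numE.
Qed.

HB.instance Definition _ :=
  Measure_isSigmaFinite.Build _ _ _ rVcons_measure sigma_finite_rVcons.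

End step.

Fixpoint borel_lebesgue_rV n : {sigma_finite_measure set 'rV[R]_n -> \bar R} :=
  match n with
  | 0 => \d_(0 : 'rV[R]_0)
  | m.+1 => rVcons_measure (borel_lebesgue_rV m)
  end.

End borel_lebesgue_measure.

Definition lebesgueT (R : realType) (n : nat) :=
  caratheodory_type (mu_ext (borel_lebesgue_rV R n)).

Definition lebesgue_rV (R : realType) (n : nat) :
    {measure set (lebesgueT R n) -> \bar R} :=
  @completed_measure_extension _ _ R (borel_lebesgue_rV R n).

Section variable_exponent.
Variables (R : realType) (n : nat).
Implicit Types (p g : 'rV[R]_n -> R) (f : 'rV[R]_n -> R[i]) (h : 'rV[R]_n).

Definition translate h f : 'rV[R]_n -> R[i] := fun x => f (x + h).

Definition is_exponent p : Prop :=
  measurable_fun [set: lebesgueT R n] p /\ forall x, 1 <= p x.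

Definition pminus p : \bar R := ess_inf (lebesgue_rV R n) (EFin \o p).

Definition pplus p : \bar R := ess_sup (lebesgue_rV R n) (EFin \o p).

Definition cmeasurable f : Prop :=
  measurable_fun [set: lebesgueT R n] (fun x => complex.Re (f x)) /\
  measurable_fun [set: lebesgueT R n] (fun x => complex.Im (f x)).

Definition modular p f : \bar R :=
  (\int[lebesgue_rV R n]_x (Normc.normc (f x) `^ p x)%:E)%E.

Definition Lp p f : Prop := cmeasurable f /\ (modular p f < +oo)%E.

(* Extended-real valued: it is +oo when no rescaling of f has modular at most
   1, whereas the real infimum of the empty set would be 0. *)
Definition pnorm p f : \bar R :=
  ereal_inf [set mu%:E | mu in
    [set mu : R | 0 < mu /\ (modular p (fun x => (mu^-1)%:C%C * f x)%R <= 1)%E]].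

(* For x = y the right-hand side is c, since 0^-1 = 0, and the left-hand side
   is 0. *)
Definition local_log_Holder_with g (c : R) : Prop :=
  forall x y, `|g x - g y| <= c / ln (expR 1 + (enorm (x - y))^-1).

Definition log_Holder_decay_with g (ginf c : R) : Prop :=
  forall x, `|g x - ginf| <= c / ln (expR 1 + enorm x).

Definition local_log_Holder g : Prop :=
  exists2 c : R, 0 < c & local_log_Holder_with g c.

Definition log_Holder_decay g : Prop :=
  exists ginf c : R, 0 < c /\ log_Holder_decay_with g ginf c.

Definition Plog p : Prop :=
  [/\ is_exponent p, local_log_Holder p & log_Holder_decay p].

(* The filter of neighbourhoods of infinity, {x : r <= |x|} for r large. *)
Definition at_infinity : set_system 'rV[R]_n :=
  [set A | \forall r \near +oo, forall x, r <= enorm x -> A x].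

Definition lim_infinity p : R := lim (p @ at_infinity).

(* The infima are the smallest constants; they may be 0, for constant p. *)
Definition clog_inv p : R :=
  Num.max
    (inf [set c : R | 0 < c /\ local_log_Holder_with (fun x => (p x)^-1) c])
    (inf [set c : R | 0 < c /\ log_Holder_decay_with (fun x => (p x)^-1)
                                 (lim_infinity p)^-1 c]).

End variable_exponent.

Section fourier.
Variables (R : realType) (n : nat).
Implicit Types (f phi : 'rV[R]_n -> R[i]).

Definition cintegral f : R[i] :=
  ((\int[lebesgue_rV R n]_x complex.Re (f x))
    +i* (\int[lebesgue_rV R n]_x complex.Im (f x)))%C.

Definition expi (t : R) : R[i] := (cos t +i* sin t)%C.

Definition fourier phi : 'rV[R]_n -> R[i] := fun xi =>
  ((2 * pi) `^ (- (n%:R / 2)))%:C%C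
    * cintegral (fun x => expi (- dotrV x xi) * phi x).

(* \partial_{s_1} ... \partial_{s_m} g *)
Definition iter_partial (s : seq 'I_n) (g : 'rV[R]_n -> R) : 'rV[R]_n -> R :=
  foldr (fun i (u : 'rV[R]_n -> R) x => 'D_(delta_mx 0 i) u x) g s.

Definition smooth (g : 'rV[R]_n -> R) : Prop :=
  forall (s : seq 'I_n) (x : 'rV[R]_n), differentiable (iter_partial s g) x.

Definition csmooth phi : Prop :=
  smooth (fun x => complex.Re (phi x)) /\ smooth (fun x => complex.Im (phi x)).

Definition fsupp phi : set 'rV[R]_n := closure [set x | phi x != 0].

Definition test_function (U : set 'rV[R]_n) phi : Prop :=
  [/\ csmooth phi, compact (fsupp phi) & fsupp phi `<=` U].

(* The support of a distribution T: the complement of the union of the open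
   sets U such that T vanishes on C_c^\infty(U). *)
Definition dsupp (T : ('rV[R]_n -> R[i]) -> R[i]) : set 'rV[R]_n :=
  [set xi | forall U, open U -> U xi ->
    exists phi, test_function U phi /\ T phi != 0].

(* The Fourier transform of f as a tempered distribution, given by duality. *)
Definition fourier_dist f : ('rV[R]_n -> R[i]) -> R[i] :=
  fun phi => cintegral (fun x => f x * fourier phi x).

End fourier.

(* Main.v *)
(* The idea is to compare |f(x+h)/mu|^p(x) with |f(x+h)/mu|^p(x+h), where mu is
   such that f/mu has modular at most 1; put t = |f(x+h)|/mu.

   By Nikolskii's inequality t <= B 2^(vn) almost everywhere. Where t >= 1,
   t^p(x) <= (B 2^(vn))^|p(x)-p(x+h)| t^p(x+h), and the local log-Hoelder
   condition bounds the first factor by a constant power of 1 + 2^v |h|. Where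
   t < 1, the decay condition gives t^p(x) <= C t^p(x+h) unless t is smaller
   than an integrable function. So the modular of the translate of f/mu is at
   most a polynomial in 2^v |h|, which exp(gamma (2 + 2^(vnk) |h|^k)) dominates
   as soon as gamma = c_log(1/p) is positive. If gamma = 0, p is constant and
   the norm is translation invariant.

   Nikolskii's inequality follows from a reproducing formula that needs no
   Fourier inversion. Let k_e be the transform of the cut-off chi(e .). For small
   e, f * k_e does not depend on e: the difference of two cut-offs is a test
   function that vanishes near the spectrum of f. On the other hand f * k_e
   tends weakly, as e -> 0, to f times the integral of k_1, and all that
   matters about this integral is that it is positive. *)

Require Import Defs.
From HB Require Import structures.
From mathcomp Require Import all_boot all_order all_algebra.
From mathcomp Require Import all_classical all_reals all_analysis.
From mathcomp Require Import measurable_realfun complex.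
From mathcomp Require Import ring lra.

Import Order.TTheory GRing.Theory Num.Theory.
Import numFieldNormedType.Exports.

Local Open Scope classical_set_scope.
Local Open Scope ring_scope.

Set Implicit Arguments.
Unset Strict Implicit.
Unset Printing Implicit Defensive.

(** * Lebesgue measure under affine maps *)

Section lebesgue_rV_basics.
Variables (R : realType) (n : nat).
Local Notation rV := 'rV[R]_n.
Local Notation lam := (lebesgue_rV R n).

(** Translations, hence convolutions, need not be bounded on a variable exponent space. What
    replaces Young's inequality is [t <= 1 + t^p], valid for [1 <= p]: it dominates [|f|] by a
    bounded plus an integrable function, and convolution with the kernel is controlled on both by
    the same multiple of [2^(vn)]. So the constant of Nikolskii's inequality does not depend on [p].
    The condition [1 <= p] also turns a modular bound [L >= 1] into the norm bound [L].

    All decay is measured by one product weight of integral [pi^n]. The kernel decays like its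
    square: one factor pays for a translation, the other is integrated.

    The kernel has positive integral because the weak limit is tested on a narrow bump [phi]: the
    pairings are integrals of [chi(e xi)] against the squared modulus of the transform of [phi], and
    stay away from 0 as [e] tends to 0.

    The final domination is [X^N <= N! exp X] with [X = gamma (2 + 2^(vnk) |h|^k)]. It costs a
    factor [N! / gamma^N], so [c] depends on [p] also through [gamma]. It does not depend on [k],
    since [1 + 2^v |h| <= 2 + 2^(vnk) |h|^k] whenever [n, k >= 1]. *)

Let lebesgue_rV_sigma_finite : sigma_finite [set: lebesgueT R n] lam.
Proof. exact/completed_measure_extension_sigma_finite/sigma_finiteT. Qed.

HB.instance Definition _ := Measure_isSigmaFinite.Build _ _ _
  (@completed_measure_extension _ _ R (borel_lebesgue_rV R n))
  lebesgue_rV_sigma_finite.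

(** The measure [lebesgue_rV] typed as sigma-finite, which is the form that product measures and
    Fubini require. *)
Definition lebS : {sigma_finite_measure set (lebesgueT R n) -> \bar R} :=
  @completed_measure_extension _ _ R (borel_lebesgue_rV R n).

Lemma measurable_lebesgueT (A : set rV) :
  measurable A -> measurable (A : set (lebesgueT R n)).
Proof. exact: caratheodory_measurable_mu_ext. Qed.

Lemma lebesgue_rV_borelE (A : set rV) :
  measurable A -> lam A = borel_lebesgue_rV R n A.
Proof. by move=> mA; exact: measurable_mu_extE. Qed.

Lemma measurable_fun_lebesgueT d (T : measurableType d) (f : rV -> T) :
  measurable_fun [set: rV] f -> measurable_fun [set: lebesgueT R n] f.
Proof.
move=> mf _ Y mY; apply: measurable_lebesgueT.
exact: mf measurableT Y mY.
Qed.

(** The identity, from the completed to the product sigma-algebra, pushes one measure to the other.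
    Integrals of Borel functions can then be computed by recursion on the dimension. *)
Lemma integral_lebesgue_rV_borel (f : rV -> \bar R) :
  measurable_fun [set: rV] f -> (forall x, 0 <= f x)%E ->
  (\int[lam]_x f x = \int[borel_lebesgue_rV R n]_x f x)%E.
Proof.
move=> mf f0.
have mid : measurable_fun [set: lebesgueT R n] (id : lebesgueT R n -> rV).
  by apply: measurable_fun_lebesgueT; exact: measurable_id.
transitivity (\int[pushforward lam (id : lebesgueT R n -> rV)]_x f x)%E.
  by rewrite ge0_integral_pushforward.
by apply: eq_measure_integral => A mA _; exact: lebesgue_rV_borelE.
Qed.

End lebesgue_rV_basics.

Section affine_maps.
Variable R : realType.
Implicit Type a : R.

Definition affine n a (b x : 'rV[R]_n) : 'rV[R]_n := a *: x + b.

Lemma measurable_affine n a (b : 'rV[R]_n) :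
  measurable_fun [set: 'rV[R]_n] (affine a b).
Proof.
apply: measurable_fun_rVP => i.
rewrite (_ : (fun _ => _) = (fun x : 'rV[R]_n => a * x 0 i + b 0 i)).
  apply: measurable_funD => //.
  by apply: measurable_funM => //; exact: measurable_coord.
by apply/funext => x; rewrite !mxE.
Qed.

Lemma affineK n a (b : 'rV[R]_n) : a != 0 ->
  cancel (affine a b) (affine a^-1 (- a^-1 *: b)).
Proof.
move=> a0 x; rewrite /affine scalerDr scalerA mulVf// scale1r scaleNr.
by rewrite addrK.
Qed.

Lemma affineVK n a (b : 'rV[R]_n) : a != 0 ->
  cancel (affine a^-1 (- a^-1 *: b)) (affine a b).
Proof.
move=> a0 x; rewrite /affine scalerDr !scalerA mulfV// mulrN mulfV//.
by rewrite scale1r scaleN1r subrK.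
Qed.

(** By uniqueness of Lebesgue measure: [|a|] times the pushforward has the right value on half-open
    intervals. *)
Lemma lebesgue_measure_affine1 a (b : R) (A : set R) : a != 0 -> measurable A ->
  lebesgue_measure ((fun s : measurableTypeR R => a * s + b : measurableTypeR R) @^-1` A) =
  (`|a|^-1%:E * lebesgue_measure A)%E.
Proof.
move=> a0 mA.
have na0 : 0 <= `|a| by [].
have mT : measurable_fun [set: measurableTypeR R]
    (fun s : measurableTypeR R => a * s + b : measurableTypeR R).
  by apply: measurable_funD => //; apply: measurable_funM.
pose P : {measure set (measurableTypeR R) -> \bar R} :=
  measure_function_pushforward__canonical__measure_function_Measure
    (@lebesgue_measure R) mT.
pose m := mscale (NngNum na0) P.
have key : forall X, ocitv X -> lebesgue_measure X = m X.
  move=> _ [[c d] _ <-].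
  rewrite /m /mscale /P /= /pushforward.
  (* A negative [a] reverses the order, so the half-open interval comes back closed at the other
     end; its length is what matters. *)
  have [alt0|agt0] := ltP a 0.
    rewrite (_ : _ @^-1` _ = `[(d - b) / a, (c - b) / a[%classic); last first.
      apply/seteqP; split => s /=; rewrite !in_itv/= => /andP[h1 h2].
        by rewrite ler_ndivrMr// ltr_ndivlMr// [s * a]mulrC; apply/andP; split; lra.
      move: h1 h2; rewrite ler_ndivrMr// ltr_ndivlMr// [s * a]mulrC => h1 h2.
      by apply/andP; split; lra.
    rewrite !lebesgue_measure_itv/= !lte_fin ltr_nM2r ?invr_lt0//.
    rewrite ltrBlDr subrK; case: ifPn => _; last by rewrite mule0.
    rewrite -EFinB -EFinM; congr EFin; rewrite ltr0_norm//.
    by field.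
  have {}agt0 : 0 < a by rewrite lt_neqAle eq_sym a0.
  rewrite (_ : _ @^-1` _ = `](c - b) / a, (d - b) / a]%classic); last first.
    apply/seteqP; split => s /=; rewrite !in_itv/= => /andP[h1 h2].
      by rewrite ler_pdivlMr// ltr_pdivrMr// [s * a]mulrC; apply/andP; split; lra.
    move: h1 h2; rewrite ler_pdivlMr// ltr_pdivrMr// [s * a]mulrC => h1 h2.
    by apply/andP; split; lra.
  rewrite !lebesgue_measure_itv/= !lte_fin ltr_pM2r ?invr_gt0//.
  rewrite ltrBlDr subrK; case: ifPn => _; last by rewrite mule0.
  rewrite -EFinB -EFinM; congr EFin; rewrite gtr0_norm//.
  by field.
rewrite (lebesgue_measure_unique key mA) /m /mscale /P /= /pushforward muleA -EFinM mulVf ?mul1e//.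
by rewrite normr_eq0.
Qed.


Lemma ge0_integral_affine1 a (b : R) (g : R -> \bar R) : a != 0 ->
  measurable_fun [set: R] g -> (forall s, 0 <= g s)%E ->
  (\int[lebesgue_measure]_s g (a * s + b)%R =
   `|a|^-1%:E * \int[lebesgue_measure]_s g s)%E.
Proof.
move=> a0 mg g0.
have mT : measurable_fun [set: measurableTypeR R]
    (fun s : measurableTypeR R => a * s + b : measurableTypeR R).
  by apply: measurable_funD => //; apply: measurable_funM.
have na0 : 0 <= `|a|^-1 by rewrite invr_ge0.
transitivity (\int[mscale (NngNum na0) (@lebesgue_measure R)]_s g s)%E.
  rewrite -(ge0_integral_pushforward mT (@lebesgue_measure R) measurableT)//.
  by apply: eq_measure_integral => A mA _; exact: lebesgue_measure_affine1.
by rewrite ge0_integral_mscale.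
Qed.

Lemma affine_rVcons n a (b : 'rV[R]_n.+1) z :
  affine a b (rVcons z) =
  rVcons (a * z.1 + b 0 0, affine a (rsubmx (b : 'rV[R]_(1 + n))) z.2).
Proof.
rewrite /affine /rVcons; have := @hsubmxK R 1 1 n b => {1}<-.
apply: etrans (congr1 (fun u => u + row_mx _ _) (@scale_row_mx R 1 1 n a _ _)) _.
apply: etrans (@add_row_mx R 1 1 n _ _ _ _) _.
congr row_mx; apply/matrixP => i j.
rewrite !mxE; have -> : i = 0 by apply: val_inj; case: i => -[].
by congr (_ * _ + b _ _); apply: val_inj; case: j => -[].
Qed.

(** Induction on the dimension: the section at [s] of the preimage is the affine preimage of the
    section at [a * s + b 0 0], and the outer integral is rescaled in one variable. *)
Lemma borel_lebesgue_affine n a (b : 'rV[R]_n) (A : set 'rV[R]_n) : a != 0 ->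
  measurable A ->
  borel_lebesgue_rV R n (affine a b @^-1` A) =
  ((`|a|^-1 ^+ n)%:E * borel_lebesgue_rV R n A)%E.
Proof.
elim: n => [|n IH] in b A * => a0 mA.
  rewrite expr0 mul1e (_ : affine a b = id)//.
  by apply/funext => x; apply/matrixP => i [].
pose b' := rsubmx (b : 'rV[R]_(1 + n)).
have mB : measurable (@rVcons R n @^-1` A).
  by rewrite -[X in measurable X]setTI; exact: measurable_rVcons.
transitivity (\int[@lebesgue_measure R]_s
  ((`|a|^-1 ^+ n)%:E * borel_lebesgue_rV R n
     (xsection (@rVcons R n @^-1` A) (a * s + b 0 0)%R)))%E.
  apply: eq_integral => s _ /=; rewrite -(IH b')//.
    congr (borel_lebesgue_rV R n _); apply/seteqP.
    split => v; rewrite /xsection/= !inE/= affine_rVcons//.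
  exact: measurable_xsection.
have mX : measurable_fun [set: R] (fun s => borel_lebesgue_rV R n
     (xsection (@rVcons R n @^-1` A) s)).
  exact: measurable_fun_xsection.
rewrite ge0_integralZl//=; last first.
  apply: (measurableT_comp mX).
  by apply: measurable_funD => //; apply: measurable_funM.
rewrite (ge0_integral_affine1 (b 0 0) a0 mX)//.
by rewrite muleA -EFinM exprSr.
Qed.

(** The preimages of a countable Borel cover form a cover whose total measure is rescaled. The set
    [A] is arbitrary because the Caratheodory criterion tests against arbitrary sets; the inverse
    map gives the opposite inequality. *)
Lemma mu_ext_affine_le n a (b : 'rV[R]_n) (A : set 'rV[R]_n) : a != 0 ->
  (lebesgue_rV R n (affine a b @^-1` A) <=
   (`|a|^-1 ^+ n)%:E * lebesgue_rV R n A)%E.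
Proof.
move=> a0.
have c0 : 0 < `|a|^-1 ^+ n by rewrite exprn_gt0// invr_gt0 normr_gt0.
rewrite -lee_pdivrMl//; apply: le_ereal_inf_tmp => _ [F [mF AF] <-].
rewrite lee_pdivrMl// -nneseriesZl; last by move=> k _; exact: measure_ge0.
apply: ereal_inf_lbound => /=; exists (fun k => affine a b @^-1` F k).
  split => [k|x /= /AF [k _ Fk]]; last by exists k.
  rewrite -[X in measurable X]setTI; exact: measurable_affine.
by apply: eq_eseriesr => k _; exact: borel_lebesgue_affine.
Qed.

Lemma mu_ext_affine n a (b : 'rV[R]_n) (A : set 'rV[R]_n) : a != 0 ->
  lebesgue_rV R n (affine a b @^-1` A) =
   ((`|a|^-1 ^+ n)%:E * lebesgue_rV R n A)%E.
Proof.
move=> a0; apply/eqP; rewrite eq_le mu_ext_affine_le//=.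
have c0 : 0 < `|a|^-1 ^+ n by rewrite exprn_gt0// invr_gt0 normr_gt0.
have ai0 : a^-1 != 0 by rewrite invr_neq0.
have := mu_ext_affine_le (- a^-1 *: b) (affine a b @^-1` A) ai0.
rewrite -comp_preimage (_ : _ \o _ = id) ?preimage_id; last first.
  by apply/funext => x /=; rewrite affineVK.
rewrite normfV invrK => h; rewrite -lee_pdivlMl//.
by rewrite -exprVn invrK.
Qed.

(** A set of the completion need not be Borel, so the Caratheodory criterion itself is transported:
    every test set is a preimage, and all three outer measures scale by the same factor. *)
Lemma measurable_affine_lebesgueT n a (b : 'rV[R]_n) : a != 0 ->
  measurable_fun [set: lebesgueT R n] (affine a b : lebesgueT R n -> lebesgueT R n).
Proof.
move=> a0 _ A mA; rewrite setTI.
have cA : caratheodory_measurable (lebesgue_rV R n) A by [].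
suff : caratheodory_measurable (lebesgue_rV R n) (affine a b @^-1` A) by [].
move=> X; pose S := affine a^-1 (- a^-1 *: b).
have XE : X = affine a b @^-1` (S @^-1` X).
  rewrite -comp_preimage (_ : _ \o _ = id) ?preimage_id//.
  by apply/funext => x /=; rewrite /S affineK.
rewrite {}XE; move: (S @^-1` X) => Y.
apply: etrans (mu_ext_affine b Y a0) _.
apply: etrans (congr1 _ (cA Y)) _.
apply: etrans (ge0_muleDr _ (mu_ext_ge0 _ _) (mu_ext_ge0 _ _)) _;
  [exact: measure_ge0|exact: measure_ge0|].
by congr (_ + _)%E; apply/esym; exact: mu_ext_affine.
Qed.

Lemma ge0_integral_affine n a (b : 'rV[R]_n) (f : 'rV[R]_n -> \bar R) : a != 0 ->
  measurable_fun [set: lebesgueT R n] f -> (forall x, 0 <= f x)%E ->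
  (\int[lebesgue_rV R n]_x f (a *: x + b)%R =
   (`|a|^-1 ^+ n)%:E * \int[lebesgue_rV R n]_x f x)%E.
Proof.
move=> a0 mf f0.
have c0 : 0 <= `|a|^-1 ^+ n by rewrite exprn_ge0// invr_ge0.
have mT := measurable_affine_lebesgueT b a0.
transitivity (\int[mscale (NngNum c0) (lebesgue_rV R n)]_x f x)%E.
  rewrite -(ge0_integral_pushforward mT (lebesgue_rV R n) measurableT)//.
  by apply: eq_measure_integral => A mA _; exact: mu_ext_affine.
by rewrite ge0_integral_mscale.
Qed.

Lemma integrable_affine n a (b : 'rV[R]_n) (f : 'rV[R]_n -> \bar R) : a != 0 ->
  (lebesgue_rV R n).-integrable [set: lebesgueT R n] f ->
  (lebesgue_rV R n).-integrable [set: lebesgueT R n] (fun x => f (a *: x + b)).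
Proof.
move=> a0 /integrableP[mf fi].
have mT := measurable_affine_lebesgueT b a0.
apply/integrableP; split; first exact: (measurableT_comp mf mT).
have maf : measurable_fun [set: lebesgueT R n] (fun x => `|f x|)%E.
  exact: measurableT_comp.
have E := ge0_integral_affine b a0 maf (fun=> abse_ge0 _).
apply: (eq_ind_r (fun z => z < +oo)%E _ E).
by rewrite lte_mul_pinfty ?lee_fin ?exprn_ge0// ?invr_ge0.
Qed.

Lemma integral_affine n a (b : 'rV[R]_n) (f : 'rV[R]_n -> \bar R) : a != 0 ->
  (lebesgue_rV R n).-integrable [set: lebesgueT R n] f ->
  (\int[lebesgue_rV R n]_x f (a *: x + b)%R =
   (`|a|^-1 ^+ n)%:E * \int[lebesgue_rV R n]_x f x)%E.
Proof.
move=> a0 fi; have mf := measurable_int _ fi.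
rewrite integralE [in RHS]integralE.
have c0 : 0 <= `|a|^-1 ^+ n by rewrite exprn_ge0// invr_ge0.
rewrite muleBr//; last exact: integrable_add_def.
have mp : measurable_fun [set: lebesgueT R n] f^\+%E by exact: measurable_funepos.
have mn : measurable_fun [set: lebesgueT R n] f^\-%E by exact: measurable_funeneg.
have Ep := ge0_integral_affine b a0 mp (funepos_ge0 _).
have En := ge0_integral_affine b a0 mn (funeneg_ge0 _).
rewrite -Ep -En; congr (_ - _)%E; apply: eq_integral => x _.
  exact: (congr1 (@^~ x) (funepos_comp f (affine a b))).
exact: (congr1 (@^~ x) (funeneg_comp f (affine a b))).
Qed.

Lemma Rintegral_affine n a (b : 'rV[R]_n) (f : 'rV[R]_n -> R) : a != 0 ->
  (lebesgue_rV R n).-integrable [set: lebesgueT R n] (EFin \o f) ->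
  \int[lebesgue_rV R n]_x f (a *: x + b) =
   `|a|^-1 ^+ n * \int[lebesgue_rV R n]_x f x.
Proof.
move=> a0 fi; rewrite /Rintegral (integral_affine b a0 fi) fineM//.
exact: integrable_fin_num.
Qed.

Lemma negligible_affine n a (b : 'rV[R]_n) (P : set 'rV[R]_n) : a != 0 ->
  {ae lebesgue_rV R n, forall x : lebesgueT R n, P x} ->
  {ae lebesgue_rV R n, forall x : lebesgueT R n, P (a *: x + b)}.
Proof.
move=> a0 [N [mN N0 PN]].
exists (affine a b @^-1` N); split.
- by have mT := measurable_affine_lebesgueT b a0; rewrite -[X in measurable X]setTI; exact: mT.
- by apply: etrans (mu_ext_affine b N a0) _; rewrite N0 mule0.
- by move=> x /= /PN.
Qed.

End affine_maps.

(** * An integrable weight *)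

Section weight.
Variable R : realType.

(* Integrable majorant used for all decay estimates; its reciprocal is
   submultiplicative up to the constant 2^n. *)
Definition weight n (x : 'rV[R]_n) : R := \prod_(i < n) (1 + x 0 i ^+ 2)^-1.

Lemma oneDsq_gt0 (t : R) : 0 < 1 + t ^+ 2.
Proof. by rewrite ltr_wpDr// sqr_ge0. Qed.

Lemma weight_gt0 n (x : 'rV[R]_n) : 0 < weight x.
Proof. by apply: prodr_gt0 => i _; rewrite invr_gt0 oneDsq_gt0. Qed.

Lemma weight_ge0 n (x : 'rV[R]_n) : 0 <= weight x.
Proof. exact/ltW/weight_gt0. Qed.

Lemma weight_le1 n (x : 'rV[R]_n) : weight x <= 1.
Proof.
suff /andP[] : 0 <= weight x <= 1 by [].
apply: (big_ind (fun y => 0 <= y <= 1)).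
- by rewrite ler01 lexx.
- by move=> a b /andP[a0 a1] /andP[b0 b1]; rewrite mulr_ge0// mulr_ile1.
- by move=> i _; rewrite invr_ge0 ltW ?oneDsq_gt0//= invf_le1 ?oneDsq_gt0// lerDl sqr_ge0.
Qed.

Lemma weight_mul_le n (x z : 'rV[R]_n) :
  weight (x + z) * weight z <= 2 ^+ n * weight x.
Proof.
rewrite /weight -big_split/= -[in 2 ^+ n](card_ord n) -prodr_const -big_split/=.
apply: ler_prod => i _; rewrite -invfM mxE; apply/andP; split.
  by rewrite invr_ge0 ltW// mulr_gt0// oneDsq_gt0.
have := oneDsq_gt0 (x 0 i); have := oneDsq_gt0 (x 0 i + z 0 i).
have := oneDsq_gt0 (z 0 i); move: (x 0 i) (z 0 i) => a b h1 h2 h3.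
rewrite ler_pdivlMr// mulrC ler_pdivrMr ?mulr_gt0//.
(* After clearing denominators, the difference of the two sides is
   [1 + (a + 2b)^2 + 2 (a + b)^2 b^2]. *)
have : 0 <= (a + b *+ 2) ^+ 2 by rewrite sqr_ge0.
have : 0 <= (a + b) ^+ 2 * b ^+ 2 by rewrite mulr_ge0 ?sqr_ge0.
by move=> *; nra.
Qed.

Lemma weightN n (x : 'rV[R]_n) : weight (- x) = weight x.
Proof. by apply: eq_bigr => i _; rewrite mxE sqrrN. Qed.

Lemma weight_scale n (a : R) (x : 'rV[R]_n) : `|a| <= 1 ->
  weight x <= weight (a *: x).
Proof.
move=> a1; apply: ler_prod => i _; apply/andP; split.
  by rewrite invr_ge0 ltW// oneDsq_gt0.
rewrite lef_pV2 ?posrE ?oneDsq_gt0// lerD2l mxE exprMn -[leRHS]mul1r.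
by rewrite ler_wpM2r ?sqr_ge0// -[a ^+ 2]real_normK ?num_real// expr_le1.
Qed.

Lemma measurable_weight n : measurable_fun [set: 'rV[R]_n] (@weight n).
Proof.
apply: measurable_prod => i _.
apply: (@measurableT_comp _ _ _ _ _ _ (fun t : R => (1 + t ^+ 2)^-1)).
  by apply: continuous_measurable_fun; exact: continuous_oneDsqrV.
exact: measurable_coord.
Qed.

Lemma integral_oneDsqr :
  (\int[lebesgue_measure]_s ((1 + s ^+ 2)^-1 : R)%:E = (pi : R)%:E)%E.
Proof.
pose f (s : R) := ((1 + s ^+ 2)^-1)%:E.
have f0 s : (0 <= f s)%E by rewrite lee_fin invr_ge0 ltW// oneDsq_gt0.
have mf : measurable_fun [set: R] f.
  apply/measurable_EFinP; apply: continuous_measurable_fun; exact: continuous_oneDsqrV.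
have E0 : (\int[lebesgue_measure]_(s in `[0%R, +oo[) f s = (pi / 2)%:E)%E.
  exact: integral0y_oneDsqr.
have E1 : (\int[lebesgue_measure]_(s in `]-oo, 0%R]) f s = (pi / 2)%:E)%E.
  rewrite -E0 ge0_integration_by_substitution0//.
  by apply: eq_integral => s _; rewrite /f sqrrN.
rewrite (_ : [set: R] = `]-oo, 0%R] `|` `]0%R, +oo[); last first.
  apply/seteqP; split => // s _ /=; rewrite !in_itv/= andbT.
  by case: (leP s 0); [left|right].
rewrite ge0_integral_setU//=; last 3 first.
- exact: measurable_funS mf.
- by move=> s _; exact: f0.
- apply/disj_setPS => s [/=]; rewrite !in_itv/= andbT => h1 h2.
  by move: (le_lt_trans h1 h2); rewrite ltxx.
rewrite [X in (X + _)%E]E1 [X in (_ + X)%E](_ : _ = (pi / 2)%:E)%E.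
  by rewrite -EFinD; congr EFin; field.
rewrite -E0; apply: integral_itv_obnd_cbnd.
by apply/measurable_funTS.
Qed.

Lemma weight_rVcons n z : weight (@rVcons R n z) = (1 + z.1 ^+ 2)^-1 * weight z.2.
Proof.
rewrite /weight big_ord_recl /=; congr (_ * _).
  by rewrite -[rVcons z 0 ord0]/((rVuncons (rVcons z)).1) rVconsK.
apply: eq_bigr => i _; rewrite (_ : lift ord0 i = rshift 1 i); last exact: val_inj.
by rewrite /rVcons (@row_mxEr R 1 1 n).
Qed.

Lemma integral_weight n :
  (\int[lebesgue_rV R n]_x (weight x)%:E = ((pi : R) ^+ n)%:E)%E.
Proof.
have mw m : measurable_fun [set: 'rV[R]_m] (fun x => (weight x)%:E).
  by apply/measurable_EFinP; exact: measurable_weight.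
rewrite integral_lebesgue_rV_borel//; last by move=> x; rewrite lee_fin weight_ge0.
elim: n => [|n IH].
  rewrite /= integral_dirac//; last exact: mw.
  transitivity ((\1_[set: 'rV[R]_0] (0 : 'rV[R]_0))%:E * (weight (0 : 'rV[R]_0))%:E)%E; first by [].
  by rewrite indicE in_setT mul1e /weight big_ord0.
have -> : (\int[borel_lebesgue_rV R n.+1]_x (weight x)%:E =
  \int[@lebesgue_measure R]_s \int[borel_lebesgue_rV R n]_v
    (weight (rVcons (s, v)))%:E)%E.
  transitivity (\int[pushforward (@lebesgue_measure R \x borel_lebesgue_rV R n)
     (@rVcons R n)]_x (weight x)%:E)%E; first by [].
  apply: etrans (ge0_integral_pushforward (@measurable_rVcons R n) _
    measurableT (mw n.+1) _) _; first by move=> x _; rewrite lee_fin weight_ge0.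
  apply: (@fubini_tonelli1 _ _ _ _ _ _ _ (fun z => (weight (rVcons z))%:E)).
    exact: (measurableT_comp (mw n.+1) (@measurable_rVcons R n)).
  by move=> x; rewrite lee_fin weight_ge0.
have E s : (\int[borel_lebesgue_rV R n]_v (weight (rVcons (s, v)))%:E =
    ((1 + s ^+ 2)^-1)%:E * \int[borel_lebesgue_rV R n]_v (weight v)%:E)%E.
  under eq_integral => v _ do rewrite weight_rVcons EFinM /=.
  apply: ge0_integralZl_EFin => //.
  - by move=> x _; rewrite lee_fin weight_ge0.
  - exact: mw.
  - by rewrite invr_ge0 ltW// oneDsq_gt0.
under eq_integral => s _ do rewrite E.
rewrite IH ge0_integralZr//=.
- by rewrite [X in (X * _)%E]integral_oneDsqr -EFinM exprS.
- by apply/measurable_EFinP; apply: continuous_measurable_fun; exact: continuous_oneDsqrV.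
- by move=> s _; rewrite lee_fin invr_ge0 ltW// oneDsq_gt0.
- by rewrite lee_fin exprn_ge0// pi_ge0.
Qed.

Lemma integrable_weight n :
  (lebesgue_rV R n).-integrable [set: lebesgueT R n] (fun x => (weight x)%:E).
Proof.
apply/integrableP; split.
  apply: measurable_fun_lebesgueT; apply/measurable_EFinP; exact: measurable_weight.
under eq_integral => x _ do rewrite /= ger0_norm ?weight_ge0//.
by rewrite integral_weight ltry.
Qed.

End weight.

(** * Vanishing tested against continuous functions *)

Section borel_tests.
Variables (R : realType) (n : nat).
Local Notation lam := (lebesgue_rV R n).

(** Intersect the unions of Borel covers with excess [1 / (k + 1)]. The hull lets sets of the
    completion, such as level sets, be replaced by Borel sets up to a null set. *)
Lemma borel_hull (E : set 'rV[R]_n) : (lam E < +oo)%E ->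
  exists B : set 'rV[R]_n, [/\ measurable B, E `<=` B & lam B = lam E].
Proof.
pose m := (borel_lebesgue_rV R n)^*%mu.
suff : (m E < +oo)%E -> exists B, [/\ measurable B, E `<=` B & m B = m E] by [].
move=> Eoo.
have Ef : m E \is a fin_num by rewrite ge0_fin_numE// outer_measure_ge0.
have cov (k : nat) : exists F : (set 'rV[R]_n)^nat, measurable_cover E F /\
    (\sum_(0 <= i <oo) borel_lebesgue_rV R n (F i) < m E + k.+1%:R^-1%:E)%E.
  have k0 : 0 < k.+1%:R^-1 :> R by rewrite invr_gt0.
  by have [_ [F EF <-] h] := lb_ereal_inf_adherent k0 Ef; exists F.
have [F HF] := choice cov.
pose U k := \bigcup_i F k i.
have mU k : measurable (U k).
  by apply: bigcupT_measurable => i; have [[]] := HF k.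
have lU k : (m (U k) <= m E + k.+1%:R^-1%:E)%E.
  have [[mF _] h] := HF k; apply: le_trans (ltW h).
  apply: le_trans (outer_measure_sigma_subadditive _ _) _.
  apply: lee_nneseries => i _; first by move=> _; exact: outer_measure_ge0.
  rewrite le_eqVlt; apply/orP; left; apply/eqP; exact: measurable_mu_extE.
exists (\bigcap_k U k); split.
- exact: bigcapT_measurable.
- by apply: sub_bigcap => k _; have [[_ +] _] := HF k.
apply/eqP; rewrite eq_le; apply/andP; split; last first.
  by apply: le_outer_measure; apply: sub_bigcap => k _; have [[_ +] _] := HF k.
apply/lee_addgt0Pr => e e0.
pose k := Num.truncn e^-1.
apply: le_trans (_ : m (U k) <= _)%E.
  by apply: le_outer_measure; exact: bigcap_inf.
apply: le_trans (lU k) _; rewrite leeD2l// lee_fin invf_ple ?posrE//.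
exact/ltW/truncnS_gt.
Qed.

Definition borel_test (g : 'rV[R]_n -> R) := [/\ continuous g,
  measurable_fun [set: 'rV[R]_n] g & forall x, 0 <= g x <= 1].

Lemma borel_testM g1 g2 : borel_test g1 -> borel_test g2 ->
  borel_test (fun x => g1 x * g2 x).
Proof.
move=> [c1 m1 b1] [c2 m2 b2]; split.
- by move=> x; apply: continuousM; [exact: c1|exact: c2].
- exact: measurable_funM.
- move=> x; have /andP[h1 h2] := b1 x; have /andP[h3 h4] := b2 x.
  by rewrite mulr_ge0//= mulr_ile1.
Qed.

Lemma borel_test_min (c : R) (g : 'rV[R]_n -> R) : 0 <= c -> continuous g ->
  measurable_fun [set: 'rV[R]_n] g -> (forall x, 0 <= g x) ->
  borel_test (fun x => Num.min 1 (c * g x)).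
Proof.
move=> c0 cg mg g0; split.
- move=> x; apply: (@continuous_min R _ (fun=> 1) (fun x => c * g x) x); first exact: cst_continuous.
  by apply: continuousM; [exact: cst_continuous|exact: cg].
- by apply: (@measurable_minr _ _ R _ (fun=> 1) (fun x => c * g x)) => //; exact: measurable_funM.
- move=> x; rewrite le_min ler01/= ge_min lexx/= andbT.
  by rewrite mulr_ge0.
Qed.

(** A pi-system, since products of tests are tests, that generates the Borel sets: the generator for
    Dynkin's theorem. *)
Definition test_sets := [set [set x | 0 < g x] | g in borel_test].

Lemma test_sets_setI_closed : setI_closed test_sets.
Proof.
move=> _ _ [g1 t1 <-] [g2 t2 <-]; exists (fun x => g1 x * g2 x).
  exact: borel_testM.
case: t1 t2 => [_ _ b1] [_ _ b2].
apply/seteqP; split => x /=; last by move=> [? ?]; exact: mulr_gt0.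
have /andP[g10 _] := b1 x; have /andP[g20 _] := b2 x.
move: g10 g20; rewrite !le_eqVlt => /predU1P[<-|->]; first by rewrite mul0r ltxx.
by move=> /predU1P[<-|->//]; rewrite mulr0 ltxx.
Qed.

Lemma measurable_test_sets (A : set 'rV[R]_n) : measurable A -> <<s test_sets >> A.
Proof.
move: A; apply: smallest_sub; first exact: smallest_sigma_algebra.
move=> A; rewrite -bigcup_seq => -[i _ [B mB <-]]; rewrite setTI.
have mB' : (@ocitv R).-sigma.-measurable B by exact: mB.
rewrite RGenOInfty.measurableE in mB'; move: B mB' {mB}.
apply: smallest_sub.
  have [S0 SC SU] := @smallest_sigma_algebra _ setT test_sets.
  split => /=; first by rewrite preimage_set0.
  - by move=> B hB; rewrite setTD preimage_setC -setTD; exact: SC.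
  - by move=> F hF; rewrite preimage_bigcup; exact: SU.
move=> _ [a ->] /=; apply: sub_sigma_algebra.
(* The half-space [x 0 i > a] is where this truncated coordinate is positive; half-lines generate
   the Borel sets of the line. *)
exists (fun x : 'rV[R]_n => Num.min 1 (1 * (Num.max 0 (x 0 i - a)))).
  have cc : continuous (fun x : 'rV[R]_n => x 0 i - a).
    move=> x; apply: continuousB; [exact: coord_continuous|exact: cst_continuous].
  have mc : measurable_fun [set: 'rV[R]_n] (fun x : 'rV[R]_n => x 0 i - a).
    by apply: measurable_funB => //; exact: measurable_coord.
  apply: borel_test_min => //.
  - move=> x; apply: (@continuous_max R _ (fun=> 0) (fun x : 'rV[R]_n => x 0 i - a) x).
      exact: cst_continuous.
    exact: cc.
  - by apply: (@measurable_maxr _ _ R _ (fun=> 0) (fun x : 'rV[R]_n => x 0 i - a)).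
  - by move=> x; rewrite le_max lexx.
apply/seteqP; split => x /=; rewrite in_itv/= andbT mul1r lt_min ltr01 lt_max ltxx/= subr_gt0//.
Qed.


(** The tests [min 1 (j g)] tend to the indicator of [0 < g], and [|u|] dominates. *)
Let integral_test_set (u : 'rV[R]_n -> R) :
  lam.-integrable [set: lebesgueT R n] (EFin \o u) ->
  (forall g, borel_test g -> \int[lam]_x (u x * g x)%:E = 0)%E ->
  forall A, test_sets A -> (\int[lam]_(x in (A : set (lebesgueT R n))) (u x)%:E = 0)%E.
Proof.
move=> iu ug0 _ [g tg <-]; have [cg mg g01] := tg.
have g0 x : 0 <= g x by have /andP[] := g01 x.
set A := [set x | 0 < g x].
have mA : measurable (A : set (lebesgueT R n)).
  apply: measurable_lebesgueT; rewrite /A -[X in measurable X]setTI.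
  rewrite (_ : [set x | 0 < g x] = g @^-1` `]0, +oo[%classic).
    exact: mg.
  by apply/seteqP; split => x /=; rewrite in_itv/= andbT.
pose h (j : nat) x := Num.min 1 (j%:R * g x).
have th j : borel_test (h j) by apply: borel_test_min.
have mu' := measurable_int _ iu.
rewrite integral_mkcond.
have H1 j : measurable_fun [set: lebesgueT R n] (fun x => (u x * h j x)%:E).
  apply/measurable_EFinP; apply: measurable_funM; first exact/measurable_EFinP.
  by apply: measurable_fun_lebesgueT; case: (th j).
have H2 : measurable_fun [set: lebesgueT R n] ((EFin \o u) \_ A).
  by apply/(measurable_restrictT _ mA); exact: measurable_funTS.
have H3 : {ae lam, forall x : lebesgueT R n, [set: lebesgueT R n] x ->
    (u x * h j x)%:E @[j --> \oo] --> ((EFin \o u) \_ A) x}.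
  apply: aeW => x _; rewrite patchE; case: ifPn; rewrite ?inE/= => gx.
    apply: cvg_near_cst; near=> j; congr (_%:E); rewrite /h min_l ?mulr1//.
    rewrite -ler_pdivrMr// div1r; near: j; exact: nbhs_infty_ger.
  have -> : (fun j => (u x * h j x)%:E) = (fun=> 0%E); last exact: cvg_cst.
  apply/funext => j; rewrite /h.
  have -> : g x = 0.
    apply/eqP; rewrite eq_le g0 andbT leNgt; apply/negP => ?.
    by move/negP: gx; apply; rewrite inE.
  by rewrite mulr0 min_r ?mulr0.
have H5 : {ae lam, forall (x : lebesgueT R n) j, [set: lebesgueT R n] x ->
    (`|(u x * h j x)%:E| <= (abse \o (EFin \o u)) x)%E}.
  apply: aeW => x j _ /=; rewrite lee_fin normrM ler_piMr// ger0_norm.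
    by have [_ _ /(_ x)/andP[]] := th j.
  by have [_ _ /(_ x)/andP[]] := th j.
have [_ _] := dominated_convergence measurableT H1 H2 H3 (integrable_abse iu) H5.
rewrite [X in X @ _ --> _](_ : _ = fun=> 0%E); last first.
  by apply/funext => j; exact/ug0/th.
by move=> /cvg_lim <-//; exact: lim_cst.
Unshelve. all: by end_near. Qed.

(** Dynkin's pi-lambda theorem: the Borel sets on which [u] has integral 0 form a lambda-system. *)
Let integral_borel_set (u : 'rV[R]_n -> R) :
  lam.-integrable [set: lebesgueT R n] (EFin \o u) ->
  (forall g, borel_test g -> \int[lam]_x (u x * g x)%:E = 0)%E ->
  forall A : set 'rV[R]_n, measurable A ->
  (\int[lam]_(x in (A : set (lebesgueT R n))) (u x)%:E = 0)%E.
Proof.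
move=> iu ug0.
have t1 : borel_test (fun=> 1).
  split; [exact: cst_continuous|exact: measurable_cst|by move=> x; rewrite ler01 lexx].
have uT : (\int[lam]_x (u x)%:E = 0)%E.
  by rewrite -(ug0 _ t1); apply: eq_integral => x _; rewrite mulr1.
pose H := [set A : set 'rV[R]_n | measurable A /\
   (\int[lam]_(x in (A : set (lebesgueT R n))) (u x)%:E = 0)%E].
have iuS (A : set 'rV[R]_n) : measurable A -> lam.-integrable (A : set (lebesgueT R n)) (EFin \o u).
  by move=> mA; apply: integrableS iu => //; exact: measurable_lebesgueT.
have dH : dynkin H.
  split.
  - by split => //; exact: uT.
  - move=> A [mA A0]; split; first exact: measurableC.
    have : (\int[lam]_(x in A `|` ~` A) (u x)%:E = 0)%E by rewrite setUv.
    rewrite integral_setU//.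
    + by rewrite A0 add0e.
    + exact: measurable_lebesgueT.
    + by apply: measurable_lebesgueT; exact: measurableC.
    + by rewrite setUv; exact: measurable_int iu.
    + by apply/disj_setPCl.
  - move=> F tF HF.
    have mF k : measurable (F k) by have [] := HF k.
    split; first exact: bigcupT_measurable.
    rewrite integral_bigcup//.
    + by rewrite eseries0// => k _ _; have [] := HF k.
    + by move=> k; exact: measurable_lebesgueT.
    + by apply: iuS; exact: bigcupT_measurable.
move=> A /measurable_test_sets.
rewrite -(setI_closed_g_dynkin_g_sigma_algebra test_sets_setI_closed) => sA.
suff : H A by case.
apply: sA; split => // B tB; split; last exact: integral_test_set.
case: tB => g [_ mg _] <-; rewrite -[X in measurable X]setTI.
rewrite (_ : [set x | 0 < g x] = g @^-1` `]0, +oo[%classic); first exact: mg.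
by apply/seteqP; split => x /=; rewrite in_itv/= andbT.
Qed.

(** The set where [u] is positive is only measurable for the completion. Each of its pieces of
    finite measure has a Borel hull that differs from it by a null set, so [u] has integral 0 on the
    piece too, although it is positive there. *)
Let negligible_pos (u : 'rV[R]_n -> R) :
  lam.-integrable [set: lebesgueT R n] (EFin \o u) ->
  (forall A : set 'rV[R]_n, measurable A ->
  (\int[lam]_(x in (A : set (lebesgueT R n))) (u x)%:E = 0)%E) ->
  lam.-negligible [set x : lebesgueT R n | 0 < u x].
Proof.
move=> iu uA.
have mu' : measurable_fun [set: lebesgueT R n] u.
  by apply/measurable_EFinP; exact: measurable_int iu.
have mP : measurable [set x : lebesgueT R n | 0 < u x].
  rewrite -[X in measurable X]setTI.
  rewrite (_ : [set x | 0 < u x] = u @^-1` `]0, +oo[%classic); first exact: mu'.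
  by apply/seteqP; split => x /=; rewrite in_itv/= andbT.
have [F TF Foo] := sigma_finiteT (borel_lebesgue_rV R n).
have -> : [set x : lebesgueT R n | 0 < u x] = \bigcup_k ([set x | 0 < u x] `&` F k).
  by rewrite -setI_bigcupr -TF setIT.
apply: negligible_bigcup => k; set E := _ `&` _.
have [mFk Fkoo] := Foo k.
have mE : measurable (E : set (lebesgueT R n)).
  by apply: measurableI => //; exact: measurable_lebesgueT.
have Eoo : (lam E < +oo)%E.
  apply: le_lt_trans (_ : lam (F k) < +oo)%E; last by rewrite lebesgue_rV_borelE.
  by apply: le_measure; rewrite ?inE//; [exact: measurable_lebesgueT|exact: subIsetr].
have [B [mB EB BE]] := borel_hull Eoo.
have mBl := measurable_lebesgueT mB.
have BE0 : lam (B `\` E) = 0.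
  rewrite measureD//=; last by rewrite BE.
  by rewrite setIidr// BE subee// ge0_fin_numE.
have E0 : (\int[lam]_(x in E) `|(u x)%:E| = 0)%E.
  rewrite -(uA B mB) (negligible_integral (measurableD mBl mE) mBl _ BE0); last first.
    exact: integrableS iu.
  rewrite setDD setIidr//; apply: eq_integral => x /[!inE] -[/= ux _].
  by rewrite ger0_norm// ltW.
have mEu : measurable_fun (E : set (lebesgueT R n)) (EFin \o u).
  by apply/measurable_EFinP; apply: measurable_funTS; exact: mu'.
have [N [mN N0 EN]] := (ae_eq_integral_abs lam mE mEu).1 E0.
exists N; split => // x [ux Fx]; apply: EN => /= h.
have /= [ux0] : (EFin \o u) x = 0%E by apply: h; split.
by move: ux => /=; rewrite ux0 ltxx.
Qed.

Lemma ae_eq0_of_tests (u : 'rV[R]_n -> R) :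
  lam.-integrable [set: lebesgueT R n] (EFin \o u) ->
  (forall g, borel_test g -> \int[lam]_x (u x * g x)%:E = 0)%E ->
  {ae lam, forall x : lebesgueT R n, u x = 0}.
Proof.
move=> iu ug0; have uA := integral_borel_set iu ug0.
have iNu : lam.-integrable [set: lebesgueT R n] (EFin \o (fun x => - u x)).
  exact: integrableN iu.
have uNA (A : set 'rV[R]_n) : measurable A ->
    (\int[lam]_(x in (A : set (lebesgueT R n))) (- u x)%:E = 0)%E.
  move=> mA; under eq_integral => x _ do rewrite EFinN -mulN1e.
  rewrite integralZl//; first by rewrite (uA _ mA) mule0.
    exact: measurable_lebesgueT.
  by apply: integrableS iu => //; exact: measurable_lebesgueT.
have := negligibleU (negligible_pos iu uA) (negligible_pos iNu uNA).
apply: negligibleS => x /= ux0; have : u x != 0 by apply/eqP.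
by rewrite neq_lt oppr_gt0 => /orP[]; [right|left].
Qed.

End borel_tests.

(** * A class of smooth functions *)

Section flat_functions.
Variable R : realType.
Implicit Types (t : R) (m : nat).

(** The function [exp(-1/t)] extended by 0, times negative powers of [t]: with these powers the
    family is stable under differentiation up to linear combinations. *)
Definition flat m t : R := if t <= 0 then 0 else t^-1 ^+ m * expR (- t^-1).

Lemma flat_le0 m t : t <= 0 -> flat m t = 0.
Proof. by rewrite /flat => ->. Qed.

Lemma flat_gt0E m t : 0 < t -> flat m t = t^-1 ^+ m * expR (- t^-1).
Proof. by rewrite /flat leNgt => ->. Qed.

Lemma flat_ge0 m t : 0 <= flat m t.
Proof.
have [t0|t0] := leP t 0; first by rewrite flat_le0.
by rewrite flat_gt0E// mulr_ge0 ?expR_ge0// exprn_ge0// invr_ge0 ltW.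
Qed.

Lemma flat_gt0 m t : 0 < t -> 0 < flat m t.
Proof. by move=> t0; rewrite flat_gt0E// mulr_gt0 ?expR_gt0// exprn_gt0// invr_gt0. Qed.

(** From [exp s >= s^(m+2) / (m+2)!] at [s = 1/t]. The quadratic bound makes the derivative at 0
    vanish. *)
Lemma flat_le_sqr m t : flat m t <= m.+2`!%:R * t ^+ 2.
Proof.
have [t0|t0] := leP t 0; first by rewrite flat_le0// mulr_ge0// sqr_ge0.
have tV0 : 0 <= t^-1 by rewrite invr_ge0 ltW.
rewrite flat_gt0E// expRN ler_pdivrMr ?expR_gt0//.
apply: le_trans (_ : m.+2`!%:R * t ^+ 2 * (t^-1 ^+ m.+2 / m.+2`!%:R) <= _).
  have F0 : m.+2`!%:R != 0 :> R by rewrite pnatr_eq0 -lt0n fact_gt0.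
  rewrite [t^-1 ^+ m.+2](_ : _ = t^-1 ^+ m * t^-1 ^+ 2); last by rewrite -exprD addn2.
  rewrite [leRHS](_ : _ = t^-1 ^+ m * ((t^-1 * t) ^+ 2 * (m.+2`!%:R / m.+2`!%:R))).
    by rewrite divff// mulVf ?gt_eqF// expr1n !mulr1.
  by ring.
apply: ler_wpM2l; first by rewrite mulr_ge0// sqr_ge0.
by apply: le_trans (expR_ge1Dxn m.+1 tV0); rewrite lerDr.
Qed.

Lemma is_derive_flat m t :
  is_derive t 1 (flat m) (- m%:R * flat m.+1 t + flat m.+2 t).
Proof.
have [t0|t0|->] := ltgtP t 0.
- rewrite !flat_le0 ?(ltW t0)// mulr0 addr0.
  apply: (@near_eq_is_derive _ _ _ (cst 0)) => //.
  near=> s; rewrite /= flat_le0// ltW//; near: s; exact: lt_nbhsl.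
- apply: (@near_eq_is_derive _ _ _ (fun s : R => s^-1 ^+ m * expR (- s^-1))).
    near=> s; rewrite /= flat_gt0E//; near: s; exact: lt_nbhsr.
  rewrite !flat_gt0E//.
  have tn0 : t != 0 by rewrite gt_eqF.
  have d1 : is_derive t 1 (fun s : R => s^-1) (- t ^- 2).
    apply: is_derive_eq; first exact: (@is_deriveV R id t 1 1).
    by rewrite /= /GRing.scale/= mulr1.
  have d2 : is_derive t 1 (fun s : R => expR (- s^-1)) (expR (- t^-1) * t ^- 2).
    apply: (@is_derive1_comp R expR (fun s => - s^-1)).
    rewrite -[t ^- 2]opprK; exact: (is_deriveN d1).
  have d3 : is_derive t 1 (fun s : R => s^-1 ^+ m) (m%:R * t^-1 ^+ m.-1 * - t ^- 2).
    rewrite (_ : (fun s : R => s^-1 ^+ m) = (fun s : R => s^-1) ^+ m).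
      exact: is_deriveX.
    by apply/funext => s; rewrite exprfctE.
  apply: (is_derive_eq (is_deriveM d3 d2)).
  rewrite /= /GRing.scale/= -exprVn.
  case: m {d3} => [|m]; first by rewrite !mul0r mulr0 !expr0 oppr0 mul0r; ring.
  by rewrite /= !exprS; ring.
- rewrite !flat_le0// mulr0 addr0.
  have c0 : 0 < m.+2`!%:R :> R by rewrite ltr0n fact_gt0.
  have key : (fun h : R => h^-1 *: (flat m (h *: 1 + 0) - flat m 0)) @ 0^' --> (0 : R).
    apply/cvgr0Pnorm_le => e e0; near=> h.
    rewrite (flat_le0 m (lexx 0)) subr0 addr0 /GRing.scale/= mulr1 normrM.
    rewrite [X in _ * X]ger0_norm ?flat_ge0// normfV.
    have h0 : h != 0 by near: h; exact: nbhs_dnbhs_neq.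
    rewrite ler_pdivrMl ?normr_gt0// (le_trans (flat_le_sqr m h))//.
    rewrite -real_normK ?num_real// expr2 mulrCA ler_wpM2l// mulrC -ler_pdivlMr//.
    near: h; apply: dnbhs0_le; exact: divr_gt0.
  apply: DeriveDef; first by apply/cvg_ex; exists 0.
  exact: cvg_lim key.
Unshelve. all: by end_near. Qed.

End flat_functions.

Section dot_product.
Variables (R : realType) (n : nat).
Implicit Types x y a : 'rV[R]_n.

Lemma dotrVC x y : dotrV x y = dotrV y x.
Proof. by apply: eq_bigr => i _; rewrite mulrC. Qed.

Lemma dotrVDr a x y : dotrV a (x + y) = dotrV a x + dotrV a y.
Proof. by rewrite /dotrV -big_split; apply: eq_bigr => i _; rewrite mxE mulrDr. Qed.

Lemma dotrVZr a (c : R) x : dotrV a (c *: x) = c * dotrV a x.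
Proof. by rewrite /dotrV mulr_sumr; apply: eq_bigr => i _; rewrite mxE mulrCA. Qed.

Lemma dotrVNr a x : dotrV a (- x) = - dotrV a x.
Proof. by rewrite -scaleN1r dotrVZr mulN1r. Qed.

Lemma dotrVBr a x y : dotrV a (x - y) = dotrV a x - dotrV a y.
Proof. by rewrite dotrVDr dotrVNr. Qed.

Lemma dotrV_delta a i : dotrV a (delta_mx 0 i) = a 0 i.
Proof.
rewrite /dotrV (bigD1 i)//= !mxE !eqxx mulr1 big1 ?addr0// => j ji.
by rewrite mxE (negbTE ji) andbF mulr0.
Qed.

Fact dotrV_is_linear a : linear (dotrV a).
Proof. by move=> c x y; rewrite dotrVDr dotrVZr. Qed.

HB.instance Definition _ a :=
  GRing.isLinear.Build R 'rV[R]_n R _ (dotrV a) (dotrV_is_linear a).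

Lemma continuous_dotrV a : continuous (dotrV a).
Proof.
have key (s : seq 'I_n) : continuous (fun y : 'rV[R]_n => \sum_(i <- s) a 0 i * y 0 i).
  elim: s => [|i s IH] x.
    rewrite (_ : (fun _ => _) = fun=> 0); first exact: cst_continuous.
    by apply/funext => y; rewrite big_nil.
  rewrite (_ : (fun _ => _) = fun y : 'rV[R]_n => a 0 i * y 0 i + \sum_(i <- s) a 0 i * y 0 i).
    exact: (cvgD (cvgM (cvg_cst _) (@coord_continuous _ _ _ 0 i x)) (IH x)).
  by apply/funext => y; rewrite big_cons.
exact: key.
Qed.

Lemma measurable_dotrV a : measurable_fun [set: 'rV[R]_n] (dotrV a).
Proof.
rewrite (_ : dotrV a = fun y : 'rV[R]_n => \sum_(i < n) a 0 i * y 0 i)//.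
apply: measurable_sum => i; apply: measurable_funM => //; exact: measurable_coord.
Qed.

Lemma differentiable_dotrV a x : differentiable (dotrV a) x.
Proof. apply: linear_differentiable; exact: continuous_dotrV. Qed.

Lemma comp_dotrV_diff (u : R -> R) a (b : R) x (du : R) :
  is_derive (dotrV a x + b) 1 u du ->
  differentiable (fun y => u (dotrV a y + b)) x /\
  forall v, 'D_v (fun y => u (dotrV a y + b)) x = dotrV a v * du.
Proof.
move=> [du1 du2].
have df : differentiable (dotrV a + cst b : 'rV[R]_n -> R) x.
  by apply: differentiableD; [exact: differentiable_dotrV|exact: differentiable_cst].
have dg : differentiable u ((dotrV a + cst b : 'rV[R]_n -> R) x) by apply/derivable1_diffP.
have dc : differentiable (u \o (dotrV a + cst b : 'rV[R]_n -> R)) x.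
  exact: differentiable_comp.
split=> // v; rewrite deriveE//.
rewrite (_ : (fun y => _) = u \o (dotrV a + cst b : 'rV[R]_n -> R))//.
rewrite diff_comp//= deriv1E// derive1E du2.
congr (_ * _); rewrite diffD//=; last exact: differentiable_dotrV.
rewrite diff_cst addr0 (@diff_lin _ _ _ (dotrV a))//; exact: continuous_dotrV.
Qed.

End dot_product.

Section smooth_class.
Variables (R : realType) (n : nat).
Implicit Types f g : 'rV[R]_n -> R.

(* A class of functions closed under partial derivatives; everything in it is
   therefore smooth. *)
Inductive elem : ('rV[R]_n -> R) -> Prop :=
| elem_cst c : elem (fun=> c)
| elem_cos a : elem (fun x => cos (dotrV a x))
| elem_sin a : elem (fun x => sin (dotrV a x))
| elem_flat m a b : elem (fun x => flat m (dotrV a x + b))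
| elem_add f g : elem f -> elem g -> elem (fun x => f x + g x)
| elem_mul f g : elem f -> elem g -> elem (fun x => f x * g x)
| elem_inv f : (forall x, 0 < f x) -> elem f -> elem (fun x => (f x)^-1).

Lemma elem_opp f : elem f -> elem (fun x => - f x).
Proof.
move=> ef; rewrite (_ : (fun _ => _) = fun x => -1 * f x); last first.
  by apply/funext => x; rewrite mulN1r.
by apply: elem_mul => //; exact: elem_cst.
Qed.

Lemma elem_sub f g : elem f -> elem g -> elem (fun x => f x - g x).
Proof. by move=> ef eg; apply: elem_add => //; exact: elem_opp. Qed.

Lemma elem_prod (I : Type) (s : seq I) (F : I -> 'rV[R]_n -> R) :
  (forall i, elem (F i)) -> elem (fun x => \prod_(i <- s) F i x).
Proof.
move=> eF; elim: s => [|i s IH].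
  by rewrite (_ : (fun _ => _) = fun=> 1); [exact: elem_cst|apply/funext => x; rewrite big_nil].
rewrite (_ : (fun _ => _) = fun x => F i x * \prod_(j <- s) F j x); last first.
  by apply/funext => x; rewrite big_cons.
exact: elem_mul.
Qed.

(** Differentiability and stability under derivatives are proved in one induction, because the rules
    for sums, products and inverses require the parts to be differentiable. *)
Lemma elem_diff f : elem f -> (forall x, differentiable f x) /\
  exists d : 'rV[R]_n -> 'rV[R]_n -> R,
    forall v, elem (d v) /\ forall x, 'D_v f x = d v x.
Proof.
elim => [c|a|a|m a b|{}f g ef [df [d hd]] eg [dg [d' hd']]
  |{}f g ef [df [d hd]] eg [dg [d' hd']]|{}f f0 ef [df [d hd]]].
- split; first by move=> x; exact: differentiable_cst.
  exists (fun _ _ => 0) => v; split; first exact: elem_cst.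
  by move=> x; exact: derive_cst.
- have key x := @comp_dotrV_diff R n cos a 0 x _ (is_derive_cos _).
  rewrite (_ : (fun x => cos _) = fun x => cos (dotrV a x + 0)); last first.
    by apply/funext => x; rewrite addr0.
  split; first by move=> x; have [] := key x.
  exists (fun v x => dotrV a v * - sin (dotrV a x)) => v; split.
    apply: elem_mul; first exact: elem_cst.
    by apply: elem_opp; exact: elem_sin.
  by move=> x; have [_ ->] := key x; rewrite addr0.
- have key x := @comp_dotrV_diff R n sin a 0 x _ (is_derive_sin _).
  rewrite (_ : (fun x => sin _) = fun x => sin (dotrV a x + 0)); last first.
    by apply/funext => x; rewrite addr0.
  split; first by move=> x; have [] := key x.
  exists (fun v x => dotrV a v * cos (dotrV a x)) => v; split.
    by apply: elem_mul; [exact: elem_cst|exact: elem_cos].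
  by move=> x; have [_ ->] := key x; rewrite addr0.
- have key x := @comp_dotrV_diff R n (flat m) a b x _ (is_derive_flat m _).
  split; first by move=> x; have [] := key x.
  exists (fun v x => dotrV a v *
     (- m%:R * flat m.+1 (dotrV a x + b) + flat m.+2 (dotrV a x + b))) => v; split.
    apply: elem_mul; first exact: elem_cst.
    apply: elem_add; last exact: elem_flat.
    by apply: elem_mul; [exact: elem_cst|exact: elem_flat].
  by move=> x; have [_ ->] := key x.
- split; first by move=> x; apply: differentiableD.
  exists (fun v x => d v x + d' v x) => v; split.
    by apply: elem_add; [case: (hd v)|case: (hd' v)].
  move=> x; have [_ <-] := hd v; have [_ <-] := hd' v.
  by apply: deriveD; exact: diff_derivable.
- split; first by move=> x; apply: differentiableM.
  exists (fun v x => f x * d' v x + g x * d v x) => v; split.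
    by apply: elem_add; apply: elem_mul => //; [case: (hd' v)|case: (hd v)].
  move=> x; have [_ <-] := hd v; have [_ <-] := hd' v.
  by apply: deriveM; exact: diff_derivable.
- split; first by move=> x; apply: differentiableV => //; rewrite gt_eqF.
  exists (fun v x => - ((f x)^-1 * (f x)^-1) * d v x) => v; split.
    apply: elem_mul; last by case: (hd v).
    by apply: elem_opp; apply: elem_mul; exact: elem_inv.
  move=> x; have [_ <-] := hd v.
  apply: etrans (deriveV _ _) _; [by rewrite gt_eqF|exact: diff_derivable|].
  by rewrite expr2 invfM.
Qed.

Lemma elem_differentiable f x : elem f -> differentiable f x.
Proof. by move=> /elem_diff[]. Qed.

Lemma elem_derive f v : elem f -> elem (fun x => 'D_v f x).
Proof.
move=> /elem_diff[_ [d /(_ v)[ed hd]]].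
by rewrite (_ : (fun x => _) = d v)//; exact/funext.
Qed.

Lemma elem_smooth f : elem f -> smooth f.
Proof.
move=> ef s; suff : elem (iter_partial s f).
  by move=> es x; exact: elem_differentiable.
by elim: s => //= i s; exact: elem_derive.
Qed.

Lemma elem_continuous f : elem f -> continuous f.
Proof. by move=> ef x; apply/differentiable_continuous/elem_differentiable. Qed.

Lemma measurable_elem f : elem f -> measurable_fun [set: 'rV[R]_n] f.
Proof.
elim => [c|a|a|m a b|{}f g ef mf eg mg|{}f g ef mf eg mg|{}f f0 ef mf].
- exact: measurable_cst.
- apply: (@measurableT_comp _ _ _ _ _ _ (@cos R)); last exact: measurable_dotrV.
  by apply: continuous_measurable_fun; exact: continuous_cos.
- apply: (@measurableT_comp _ _ _ _ _ _ (@sin R)); last exact: measurable_dotrV.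
  by apply: continuous_measurable_fun; exact: continuous_sin.
- apply: (@measurableT_comp _ _ _ _ _ _ (@flat R m)).
    apply: continuous_measurable_fun => t.
    apply/differentiable_continuous/derivable1_diffP.
    by case: (is_derive_flat m t).
  by apply: measurable_funD => //; exact: measurable_dotrV.
- exact: measurable_funD.
- exact: measurable_funM.
- rewrite (_ : (fun x => _) = expR \o (fun x => - ln (f x))).
    by apply: measurableT_comp => //; apply: measurableT_comp => //; apply: measurableT_comp.
  by apply/funext => x; rewrite /= expRN lnK// posrE.
Qed.

End smooth_class.

(** * Smooth cut-offs and compactly supported test functions *)

Section cutoff.
Variable R : realType.

(** The usual smooth transition from 0, for [t <= 0], to 1, for [1 <= t]; the denominator never
    vanishes. *)
Definition step (t : R) : R := flat 0 t / (flat 0 t + flat 0 (1 - t)).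

Lemma step_den_gt0 (t : R) : 0 < flat 0 t + flat 0 (1 - t).
Proof.
have [t0|t0] := leP t 0.
  by rewrite ltr_wpDl ?flat_ge0// flat_gt0//; lra.
by rewrite ltr_pwDl ?flat_gt0// flat_ge0.
Qed.

Lemma step_ge0 t : 0 <= step t.
Proof. by rewrite divr_ge0 ?flat_ge0// ltW// step_den_gt0. Qed.

Lemma step_le1 t : step t <= 1.
Proof. by rewrite ler_pdivrMr ?step_den_gt0// mul1r lerDl flat_ge0. Qed.

Lemma step0 t : t <= 0 -> step t = 0.
Proof. by move=> t0; rewrite /step flat_le0// mul0r. Qed.

Lemma step1 t : 1 <= t -> step t = 1.
Proof.
move=> t1; rewrite /step (@flat_le0 _ _ (1 - t)); last by lra.
by rewrite addr0 divff// gt_eqF// flat_gt0//; lra.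
Qed.

Variable n : nat.
Implicit Types x y z : 'rV[R]_n.

(** A cut-off equal to 1 on the cube [|x_i| <= 1] and to 0 as soon as some [|x_i| >= 2]. It is even,
    so its Fourier transform is real. *)
Definition chi x : R := \prod_(i < n) (step (2 - x 0 i) * step (2 + x 0 i)).

Lemma elem_step a b : elem (fun x => step (dotrV a x + b)).
Proof.
apply: elem_mul; first exact: elem_flat.
apply: elem_inv; first by move=> x; exact: step_den_gt0.
apply: elem_add; first exact: elem_flat.
rewrite (_ : (fun _ => _) = fun x => flat 0 (dotrV (- a) x + (1 - b))).
  exact: elem_flat.
by apply/funext => x; rewrite (dotrVC (- a)) dotrVNr (dotrVC x); congr flat; ring.
Qed.

Lemma elem_chi (e : R) z : elem (fun x => chi (e *: (x - z))).
Proof.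
apply: elem_prod => i; apply: elem_mul.
  rewrite (_ : (fun _ => _) = fun x => step
    (dotrV (- e *: delta_mx 0 i) x + (2 + e * z 0 i))); first exact: elem_step.
  apply/funext => x; rewrite dotrVC dotrVZr dotrV_delta !mxE.
  by congr step; ring.
rewrite (_ : (fun _ => _) = fun x => step
  (dotrV (e *: delta_mx 0 i) x + (2 - e * z 0 i))); first exact: elem_step.
apply/funext => x; rewrite dotrVC dotrVZr dotrV_delta !mxE.
by congr step; ring.
Qed.

Lemma chi_ge0 x : 0 <= chi x.
Proof. by apply: prodr_ge0 => i _; rewrite mulr_ge0// step_ge0. Qed.

Lemma chi_le1 x : chi x <= 1.
Proof.
suff /andP[] : 0 <= chi x <= 1 by [].
rewrite /chi; elim/big_ind : _.
- by rewrite ler01 lexx.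
- by move=> a b /andP[a0 a1] /andP[b0 b1]; rewrite mulr_ge0// mulr_ile1.
- by move=> i _; rewrite mulr_ge0 ?step_ge0//= mulr_ile1 ?step_ge0 ?step_le1.
Qed.

Lemma chi1 x : (forall i, `|x 0 i| <= 1) -> chi x = 1.
Proof.
move=> x1; rewrite /chi big1// => i _.
by have := x1 i; rewrite ler_norml => /andP[h1 h2]; rewrite !step1 ?mulr1//; lra.
Qed.

Lemma chi0 x i : 2 <= `|x 0 i| -> chi x = 0.
Proof.
move=> x2; rewrite /chi (bigD1 i)//= (_ : step _ * step _ = 0) ?mul0r//.
move: x2; rewrite ler_normr => /orP[h|h].
  by rewrite step0 ?mul0r// subr_le0.
by rewrite [step (2 + _)]step0 ?mulr0// -[x 0 i]opprK subr_le0.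
Qed.

Lemma chiN x : chi (- x) = chi x.
Proof. by apply: eq_bigr => i _; rewrite mxE opprK mulrC. Qed.

End cutoff.

Section test_functions.
Variables (R : realType) (n : nat).
Local Notation lam := (lebesgue_rV R n).
Implicit Types (u : 'rV[R]_n -> R) (x v : 'rV[R]_n).

Definition bsupp u := exists r : R, forall x i, r < `|x 0 i| -> u x = 0.

Definition test u := elem u /\ bsupp u.

Lemma continuous_weight : continuous (@weight R n).
Proof.
have key (s : seq 'I_n) :
    continuous (fun y : 'rV[R]_n => \prod_(i <- s) (1 + y 0 i ^+ 2)^-1).
  elim: s => [|i s IH] x.
    rewrite (_ : (fun _ => _) = fun=> 1); first exact: cst_continuous.
    by apply/funext => y; rewrite big_nil.
  rewrite (_ : (fun _ => _) = fun y : 'rV[R]_n => (1 + y 0 i ^+ 2)^-1 *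
      \prod_(i <- s) (1 + y 0 i ^+ 2)^-1).
    apply: (cvgM _ (IH x)).
    apply: (@continuous_comp _ _ _ (fun y : 'rV[R]_n => y 0 i) (fun t : R => (1 + t ^+ 2)^-1)).
      exact: coord_continuous.
    exact: continuous_oneDsqrV.
  by apply/funext => y; rewrite big_cons.
exact: key.
Qed.

(** The quotient [u / weight] is continuous, hence bounded on a compact cube outside which [u]
    vanishes. *)
Lemma bsupp_weight_bound u : continuous u -> bsupp u ->
  exists2 C : R, 0 <= C & forall x, `|u x| <= C * weight x.
Proof.
move=> cu [r ur].
pose K := [set x : 'rV[R]_n | forall i, `[-r, r]%classic (x 0 i)].
have cK : compact K by apply: (@rV_compact _ n (fun=> `[-r, r]%classic)) => i; exact: segment_compact.
pose h x := u x / weight x.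
have ch : continuous h.
  move=> x; exact: (cvgM (cu x) (cvgV (lt0r_neq0 (weight_gt0 x)) (@continuous_weight x))).
have /compact_bounded[M [Mr HM]] : compact (h @` K).
  by apply: continuous_compact => //; exact: continuous_subspaceT.
exists (Num.max 0 (M + 1)); first by rewrite le_max lexx.
move=> x; have [Kx|nKx] := pselect (K x).
  rewrite -ler_pdivrMr ?weight_gt0// le_max; apply/orP; right.
  have := HM (M + 1); rewrite ltrDl => /(_ ltr01 (h x)).
  rewrite /= {2}/h normrM normfV (ger0_norm (weight_ge0 x)); apply.
  by exists x.
suff -> : u x = 0 by rewrite normr0 mulr_ge0 ?weight_ge0// le_max lexx.
have [i hi] : exists i, ~ `[-r, r]%classic (x 0 i) by exact/existsNP.
apply: (ur x i); rewrite ltNge; apply/negP => hn; apply: hi => /=.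
by rewrite in_itv/= -ler_norml.
Qed.

Lemma integrable_weight_bound u (C : R) : measurable_fun [set: lebesgueT R n] u ->
  (forall x, `|u x| <= C * weight x) ->
  lam.-integrable [set: lebesgueT R n] (EFin \o u).
Proof.
move=> mu uC.
apply: (@le_integrable _ (lebesgueT R n) R lam _ measurableT _ (fun x => C%:E * (weight x)%:E)%E).
- exact/measurable_EFinP.
- move=> x _; rewrite /= lee_fin; apply: le_trans (uC x) _.
  exact: ler_norm.
- by apply: integrableZl => //; exact: integrable_weight.
Qed.

End test_functions.

(** * Derivatives of test functions have integral zero *)

Section test_calculus.
Variables (R : realType) (n : nat).
Local Notation lam := (lebesgue_rV R n).
Implicit Types (u g : 'rV[R]_n -> R) (x v : 'rV[R]_n).

Lemma test_mul u g : test u -> elem g -> test (fun x => u x * g x).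
Proof.
move=> [eu [r ur]] eg; split; first exact: elem_mul.
by exists r => x i /ur ->; rewrite mul0r.
Qed.

Lemma test_sub u g : test u -> test g -> test (fun x => u x - g x).
Proof.
move=> [eu [r ur]] [eg [s gs]]; split; first exact: elem_sub.
exists (Num.max r s) => x i; rewrite gt_max => /andP[/ur -> /gs ->].
by rewrite subr0.
Qed.

Lemma test_derive u v : test u -> test (fun x => 'D_v u x).
Proof.
move=> [eu [r ur]]; split; first exact: elem_derive.
exists r => x i rx; rewrite (@near_eq_derive _ _ _ u (fun=> 0)) ?derive_cst//.
have ci : (fun y : 'rV[R]_n => `|y 0 i|) @ x --> `|x 0 i|.
  exact: (cvg_norm (@coord_continuous _ _ _ 0 i x)).
by near=> y; apply: (ur y i); near: y; exact: (cvgr_gt _ ci).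
Unshelve. all: by end_near. Qed.

Lemma test_bound u : test u ->
  exists2 C : R, 0 <= C & forall x, `|u x| <= C * weight x.
Proof. by move=> [eu su]; apply: bsupp_weight_bound => //; exact: elem_continuous. Qed.

Lemma integrable_test_mul u (b : 'rV[R]_n -> R) : test u ->
  measurable_fun [set: 'rV[R]_n] b -> (forall x, `|b x| <= 1) ->
  lam.-integrable [set: lebesgueT R n] (EFin \o (fun x => u x * b x)).
Proof.
move=> tu mb b1; have [C C0 uC] := test_bound tu.
apply: (@integrable_weight_bound _ _ _ C).
  apply: measurable_fun_lebesgueT; apply: measurable_funM => //.
  by apply: measurable_elem; case: tu.
by move=> x; rewrite normrM; apply: le_trans (uC x); rewrite ler_piMr.
Qed.

Lemma integrable_test u : test u ->
  lam.-integrable [set: lebesgueT R n] (EFin \o u).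
Proof.
move=> tu; rewrite (_ : u = fun x => u x * 1); last first.
  by apply/funext => x; rewrite mulr1.
by apply: integrable_test_mul => // x; rewrite normr1.
Qed.

Lemma is_derive_line u x v (s : R) : differentiable u (s *: v + x) ->
  is_derive s 1 (fun t : R => u (t *: v + x)) ('D_v u (s *: v + x)).
Proof.
move=> /(@diff_derivable _ _ _ _ _ v) du.
have E : (fun h : R => h^-1 *: (((fun t : R => u (t *: v + x)) \o shift s) (h *: 1)
           - u (s *: v + x))) =
    (fun h : R => h^-1 *: ((u \o shift (s *: v + x)) (h *: v) - u (s *: v + x))).
  apply/funext => h; congr (_ *: (u _ - _)) => /=.
  by rewrite (_ : h *: 1 = h) ?scalerDl ?addrA//; exact: mulr1.
by apply: DeriveDef; rewrite /derivable/derive E.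
Qed.

(** Translation invariance instead of the fundamental theorem of calculus: every difference quotient
    along [v] has integral 0, and dominated convergence passes to the derivative. This is what
    integration by parts rests on below. *)
Lemma integral_derive0 u v : test u -> \int[lam]_x 'D_v u x = 0.
Proof.
move=> tu; have tD := test_derive v tu; have [C C0 DC] := test_bound tD.
have du x : differentiable u x by apply: elem_differentiable; case: tu.
pose t (k : nat) : R := k.+1%:R^-1.
have t0 k : 0 < t k by rewrite invr_gt0.
have t1 k : t k <= 1 by rewrite invf_le1// ler1n.
pose f k x := (t k)^-1 * (u (t k *: v + x) - u x).
(* By the mean value theorem a quotient is a derivative at [s v + x] with [0 <= s <= 1]. Moving the
   weight from there to [x] costs [2^n / weight(s v)], at most [2^n / weight v]. *)
pose C' := C * 2 ^+ n / weight v.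
have fC k x : `|f k x| <= C' * weight x.
  have [s s01 E] : exists2 s, s \in `[0, t k] &
      u (t k *: v + x) - u (0 *: v + x) = 'D_v u (s *: v + x) * (t k - 0).
    apply: (@MVT_segment R (fun t : R => u (t *: v + x))); first exact: ltW.
      by move=> s _; apply: is_derive_line.
    apply: continuous_subspaceT => s.
    by apply/differentiable_continuous/derivable1_diffP; have [] := @is_derive_line u x v s (du _).
  rewrite scale0r add0r subr0 in E.
  rewrite /f E mulrCA mulVf ?gt_eqF// mulr1.
  apply: le_trans (DC _) _; rewrite /C' -!mulrA; apply: ler_wpM2l => //.
  rewrite mulrCA mulrC ler_pdivlMr ?weight_gt0//.
  apply: le_trans (weight_mul_le x (s *: v)).
  rewrite addrC ler_wpM2l ?weight_ge0// weight_scale//.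
  move: s01; rewrite in_itv/= => /andP[s0 s1].
  by rewrite ger0_norm// (le_trans s1).
have mu : measurable_fun [set: 'rV[R]_n] u by apply: measurable_elem; case: tu.
have mtu k : measurable_fun [set: 'rV[R]_n] (fun x => u (t k *: v + x)).
  rewrite (_ : (fun x => _) = u \o affine 1 (t k *: v)).
    by apply: measurableT_comp => //; exact: measurable_affine.
  by apply/funext => x; rewrite /= /affine scale1r addrC.
have iu := integrable_test tu.
have itu k : lam.-integrable [set: lebesgueT R n] (EFin \o (fun x => u (t k *: v + x))).
  rewrite (_ : EFin \o _ = (fun x => (EFin \o u) (1 *: x + t k *: v))).
    exact: (integrable_affine (t k *: v) (oner_neq0 _) iu).
  by apply/funext => x; rewrite /= scale1r addrC.
have f0 k : (\int[lam]_x (f k x)%:E = 0)%E.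
  have E : \int[lam]_x u (t k *: v + x) = \int[lam]_x u x.
    have := Rintegral_affine (t k *: v) (oner_neq0 _) iu.
    rewrite normr1 invr1 expr1n mul1r => <-.
    by apply: eq_Rintegral => x _; rewrite scale1r addrC.
  have ii : lam.-integrable [set: lebesgueT R n]
      (EFin \o (fun x => u (t k *: v + x) - u x)).
    exact: (integrableB measurableT (itu k) iu).
  rewrite /f -[LHS](@fineK R); last first.
    apply: (@integrable_fin_num _ (lebesgueT R n) R lam setT) => //.
    exact: (integrableZl measurableT (t k)^-1 ii).
  rewrite -[fine _]/(\int[lam]_x ((t k)^-1 * (u (t k *: v + x) - u x))).
  rewrite RintegralZl//= RintegralB; [|by []|exact: itu|exact: iu].
  by rewrite E subrr mulr0.
have H1 k : measurable_fun [set: lebesgueT R n] (fun x => (f k x)%:E).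
  apply/measurable_EFinP; apply: measurable_fun_lebesgueT.
  by apply: measurable_funM => //; exact: measurable_funB.
have mD : measurable_fun [set: lebesgueT R n] (fun x => ('D_v u x)%:E).
  apply/measurable_EFinP; apply: measurable_fun_lebesgueT.
  by apply: measurable_elem; case: tD.
have H3 : {ae lam, forall x : lebesgueT R n, [set: lebesgueT R n] x ->
    (f k x)%:E @[k --> \oo] --> ('D_v u x)%:E}.
  apply: aeW => x _; apply: cvg_EFin; first exact: nearW.
  have dx : derivable u x v by exact: diff_derivable.
  have : (fun h : R => h^-1 *: ((u \o shift x) (h *: v) - u x)) @ 0^' --> 'D_v u x.
    exact: dx.
  (* The derivative is a limit along the punctured neighbourhoods of 0, so [t k != 0] has to be
     recorded. *)
  have : t k @[k --> \oo] --> 0^'.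
    move=> A A0.
    have : nbhs (0 : R) [set h | h != 0 -> A h] by exact: A0.
    move=> /(@cvg_harmonic R _) A1.
    have {}A1 : \forall k \near \oo, t k != 0 -> A (t k) by exact: A1.
    have : \forall k \near \oo, A (t k) by near=> k; apply: (near A1 k) => //; exact: lt0r_neq0.
    by [].
  move=> /cvg_comp; apply.
have H4 : lam.-integrable [set: lebesgueT R n] (fun x => C'%:E * (weight x)%:E)%E.
  by apply: integrableZl => //; exact: integrable_weight.
have H5 : {ae lam, forall (x : lebesgueT R n) k, [set: lebesgueT R n] x ->
    (`|(f k x)%:E| <= C'%:E * (weight x)%:E)%E}.
  by apply: aeW => x k _ /=; rewrite lee_fin; exact: fC.
have [_ _] := dominated_convergence measurableT H1 mD H3 H4 H5.
rewrite [X in X @ _ --> _](_ : _ = fun=> 0%E); last exact/funext.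
move=> /(cvg_unique _ (cvg_cst _)) h.
by rewrite /Rintegral -h.
Unshelve. all: by end_near. Qed.

End test_calculus.

(** * Decay of cosine and sine transforms *)

Section cosine_transforms.
Variables (R : realType) (n : nat).
Local Notation lam := (lebesgue_rV R n).
Implicit Types (u g : 'rV[R]_n -> R) (x v : 'rV[R]_n).

(** For real [u], [ctrans] and [- strans] are the real and imaginary parts of the Fourier transform,
    without its normalising factor. *)
Definition ctrans u x : R := \int[lam]_xi (u xi * cos (dotrV x xi)).
Definition strans u x : R := \int[lam]_xi (u xi * sin (dotrV x xi)).

Lemma normr_cos_le1 (t : R) : `|cos t| <= 1.
Proof. by rewrite ler_norml cos_geN1 cos_le1. Qed.

Lemma normr_sin_le1 (t : R) : `|sin t| <= 1.
Proof. by rewrite ler_norml sin_geN1 sin_le1. Qed.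

Lemma measurable_cos_dotrV x : measurable_fun [set: 'rV[R]_n] (fun y => cos (dotrV x y)).
Proof. by apply: measurable_elem; exact: elem_cos. Qed.

Lemma measurable_sin_dotrV x : measurable_fun [set: 'rV[R]_n] (fun y => sin (dotrV x y)).
Proof. by apply: measurable_elem; exact: elem_sin. Qed.

Lemma integrable_cos u x : test u -> lam.-integrable [set: lebesgueT R n]
  (EFin \o (fun xi => u xi * cos (dotrV x xi))).
Proof.
move=> tu; apply: integrable_test_mul => //; first exact: measurable_cos_dotrV.
by move=> y; exact: normr_cos_le1.
Qed.

Lemma integrable_sin u x : test u -> lam.-integrable [set: lebesgueT R n]
  (EFin \o (fun xi => u xi * sin (dotrV x xi))).
Proof.
move=> tu; apply: integrable_test_mul => //; first exact: measurable_sin_dotrV.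
by move=> y; exact: normr_sin_le1.
Qed.

Lemma derive_cos_dotrV x v y :
  'D_v (fun xi => cos (dotrV x xi)) y = - (dotrV x v * sin (dotrV x y)).
Proof.
have [_ /(_ v)] := @comp_dotrV_diff R n cos x 0 y _ (is_derive_cos _).
by rewrite (_ : (fun xi => cos _) = fun xi => cos (dotrV x xi)) ?addr0 ?mulrN//;
   apply/funext => z; rewrite addr0.
Qed.

Lemma derive_sin_dotrV x v y :
  'D_v (fun xi => sin (dotrV x xi)) y = dotrV x v * cos (dotrV x y).
Proof.
have [_ /(_ v)] := @comp_dotrV_diff R n sin x 0 y _ (is_derive_sin _).
by rewrite (_ : (fun xi => sin _) = fun xi => sin (dotrV x xi)) ?addr0//;
   apply/funext => z; rewrite addr0.
Qed.

Lemma ctrans_derive u v x : test u ->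
  ctrans (fun y => 'D_v u y) x = dotrV x v * strans u x.
Proof.
move=> tu; have tD := test_derive v tu.
have tuc : test (fun y => u y * cos (dotrV x y)) by apply: test_mul => //; exact: elem_cos.
have := integral_derive0 v tuc.
have E y : 'D_v (fun y => u y * cos (dotrV x y)) y =
    'D_v u y * cos (dotrV x y) - dotrV x v * (u y * sin (dotrV x y)).
  apply: etrans (deriveM _ _) _.
  - by apply/diff_derivable/elem_differentiable; case: tu.
  - by apply/diff_derivable/elem_differentiable; exact: elem_cos.
  by rewrite derive_cos_dotrV /GRing.scale/=; ring.
under eq_Rintegral => y _ do rewrite E.
rewrite RintegralB//=; last 2 first.
- exact: integrable_cos.
- exact: (integrableZl measurableT (dotrV x v) (integrable_sin x tu)).
rewrite RintegralZl//; last exact: integrable_sin.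
by move/eqP; rewrite subr_eq0 => /eqP.
Qed.

Lemma strans_derive u v x : test u ->
  strans (fun y => 'D_v u y) x = - (dotrV x v * ctrans u x).
Proof.
move=> tu; have tD := test_derive v tu.
have tuc : test (fun y => u y * sin (dotrV x y)) by apply: test_mul => //; exact: elem_sin.
have := integral_derive0 v tuc.
have E y : 'D_v (fun y => u y * sin (dotrV x y)) y =
    'D_v u y * sin (dotrV x y) + dotrV x v * (u y * cos (dotrV x y)).
  apply: etrans (deriveM _ _) _.
  - by apply/diff_derivable/elem_differentiable; case: tu.
  - by apply/diff_derivable/elem_differentiable; exact: elem_sin.
  by rewrite derive_sin_dotrV /GRing.scale/=; ring.
under eq_Rintegral => y _ do rewrite E.
rewrite RintegralD//=; last 2 first.
- exact: integrable_sin.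
- exact: (integrableZl measurableT (dotrV x v) (integrable_cos x tu)).
rewrite RintegralZl//; last exact: integrable_cos.
by move/eqP; rewrite addr_eq0 => /eqP.
Qed.

(** The witness is [u] minus its second derivative in direction [i]: two integrations by parts give
    the factor. *)
Let mul_oneDsq u i : test u -> exists w, [/\ test w,
  forall x, ctrans w x = (1 + x 0 i ^+ 2) * ctrans u x &
  forall x, strans w x = (1 + x 0 i ^+ 2) * strans u x].
Proof.
move=> tu; pose e : 'rV[R]_n := delta_mx 0 i.
have t1 := test_derive e tu; have t2 := test_derive e t1.
exists (fun y => u y - 'D_e (fun z => 'D_e u z) y); split.
- exact: test_sub.
- move=> x; rewrite /ctrans.
  under eq_Rintegral => y _ do rewrite mulrBl.
  rewrite RintegralB//=; [|exact: integrable_cos|exact: integrable_cos].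
  rewrite -[X in _ - X]/(ctrans (fun y => 'D_e (fun z => 'D_e u z) y) x).
  rewrite (ctrans_derive e x t1) (strans_derive e x tu) dotrV_delta -/(ctrans u x).
  by ring.
- move=> x; rewrite /strans.
  under eq_Rintegral => y _ do rewrite mulrBl.
  rewrite RintegralB//=; [|exact: integrable_sin|exact: integrable_sin].
  rewrite -[X in _ - X]/(strans (fun y => 'D_e (fun z => 'D_e u z) y) x).
  rewrite (strans_derive e x t1) (ctrans_derive e x tu) dotrV_delta -/(strans u x).
  by ring.
Qed.

Let mul_weightV u : test u -> exists w, [/\ test w,
  forall x, ctrans w x = (weight x)^-1 * ctrans u x &
  forall x, strans w x = (weight x)^-1 * strans u x].
Proof.
move=> tu; suff [w [tw cw sw]] : exists w, [/\ test w,
  forall x, ctrans w x = (\prod_(i < n) (1 + x 0 i ^+ 2)) * ctrans u x &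
  forall x, strans w x = (\prod_(i < n) (1 + x 0 i ^+ 2)) * strans u x].
  by exists w; split => // x; rewrite ?cw ?sw /weight -prodfV;
    congr (_ * _); apply: eq_bigr => i _; rewrite invrK.
elim: (index_enum _) => [|i s [w [tw cw sw]]].
  by exists u; split => // x; rewrite big_nil mul1r.
have [w' [tw' cw' sw']] := mul_oneDsq i tw.
by exists w'; split => // x; rewrite ?cw' ?sw' ?cw ?sw big_cons mulrA.
Qed.

Lemma trans_bound u : test u -> exists2 C : R, 0 <= C &
  forall x, `|ctrans u x| <= C /\ `|strans u x| <= C.
Proof.
move=> tu; have iu := integrable_test tu.
exists (\int[lam]_x `|u x|); first exact: Rintegral_ge0.
have iau : lam.-integrable [set: lebesgueT R n] (EFin \o (fun x => `|u x|)).
  exact: integrable_norm.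
move=> x; split.
  apply: le_trans (le_normr_Rintegral _ (integrable_cos x tu)) _ => //.
  apply: le_Rintegral => //; first exact: integrable_norm (integrable_cos x tu).
  by move=> y _; rewrite normrM ler_piMr// normr_cos_le1.
apply: le_trans (le_normr_Rintegral _ (integrable_sin x tu)) _ => //.
apply: le_Rintegral => //; first exact: integrable_norm (integrable_sin x tu).
by move=> y _; rewrite normrM ler_piMr// normr_sin_le1.
Qed.

(** Multiplying by [1 + x_i^2] in every coordinate multiplies by [1 / weight]. Doing it twice gives
    the square: later one factor is spent on a shift of the argument and the other is integrated. *)
Lemma trans_decay u : test u -> exists2 C : R, 0 <= C & forall x,
  `|ctrans u x| <= C * weight x ^+ 2 /\ `|strans u x| <= C * weight x ^+ 2.
Proof.
move=> tu; have [w [tw cw sw]] := mul_weightV tu.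
have [w' [tw' cw' sw']] := mul_weightV tw.
have [C C0 HC] := trans_bound tw'.
exists C => // x; have [hc hs] := HC x; move: hc hs.
have W0 : 0 < (weight x)^-1 by rewrite invr_gt0 weight_gt0.
rewrite cw' sw' cw sw !mulrA !normrM !(gtr0_norm W0) -invfM -expr2 => hc hs.
by split; rewrite -mulrA mulrC -expr2 -ler_pdivrMl// exprn_gt0// weight_gt0.
Qed.

End cosine_transforms.

(** * Kernels with compactly supported symbol *)

Section parameter_integrals.
Variables (R : realType) (n : nat).
Local Notation lam := (lebesgue_rV R n).
Local Notation T := (lebesgueT R n).

(** Tonelli applied to the positive and negative parts. As [fine] is total, this needs no
    integrability of [F]. *)
Lemma measurable_param_integral d (X : measurableType d) (F : X * T -> R) :
  measurable_fun [set: X * T] F -> measurable_fun [set: X] (fun t => \int[lam]_y F (t, y)).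
Proof.
move=> mF; have mF' : measurable_fun [set: X * T] (EFin \o F) by exact/measurable_EFinP.
rewrite (_ : (fun t => _) = fine \o (fun t =>
   fubini_F (lebS R n) (EFin \o F)^\+ t - fubini_F (lebS R n) (EFin \o F)^\- t)%E).
  apply: measurableT_comp => //; apply: emeasurable_funB.
    by apply: measurable_fun_fubini_tonelli_F => //; exact: measurable_funepos.
  by apply: measurable_fun_fubini_tonelli_F => //; exact: measurable_funeneg.
apply/funext => t; rewrite /Rintegral integralE /=; congr (fine (_ - _)%E).
  apply: eq_integral => y _.
  exact: (congr1 (@^~ y) (funepos_comp (EFin \o F) (fun y => (t, y)))).
apply: eq_integral => y _.
exact: (congr1 (@^~ y) (funeneg_comp (EFin \o F) (fun y => (t, y)))).
Qed.

Lemma integrableMl_bounded (b K : 'rV[R]_n -> R) (M : R) :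
  lam.-integrable [set: T] (EFin \o b) -> measurable_fun [set: T] K ->
  (forall y, `|K y| <= M) ->
  lam.-integrable [set: T] (EFin \o (fun y => b y * K y)).
Proof.
move=> ib mK KM.
apply: (@le_integrable _ T R lam _ measurableT _ (fun y => M%:E * (b y)%:E)%E).
- apply/measurable_EFinP; apply: measurable_funM => //.
  by apply/measurable_EFinP; exact: measurable_int ib.
- move=> y _; rewrite /= lee_fin !normrM mulrC.
  by apply: ler_wpM2r => //; rewrite (le_trans (KM y))// ler_norm.
- exact: integrableZl.
Qed.

(** Fubini in the one form needed: [M |a(x)| |b(y)|] is an integrable majorant on the product. It is
    applied to trigonometric kernels and to a kernel conjugated by the weight. *)
Lemma Rintegral_swap (a b : 'rV[R]_n -> R) (K : 'rV[R]_n -> 'rV[R]_n -> R) (M : R) :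
  lam.-integrable [set: T] (EFin \o a) -> lam.-integrable [set: T] (EFin \o b) ->
  measurable_fun [set: T * T] (fun z => K z.1 z.2) ->
  (forall x y, `|K x y| <= M) ->
  \int[lam]_x (a x * \int[lam]_y (b y * K x y)) =
  \int[lam]_y (b y * \int[lam]_x (a x * K x y)).
Proof.
move=> ia ib mK KM.
have ma : measurable_fun [set: T] a by apply/measurable_EFinP; exact: measurable_int ia.
have mb : measurable_fun [set: T] b by apply/measurable_EFinP; exact: measurable_int ib.
have mK1 y : measurable_fun [set: T] (fun x => K x y).
  exact: (measurableT_comp mK (@pair2_measurable _ _ T T y)).
have mK2 x : measurable_fun [set: T] (fun y => K x y).
  exact: (measurableT_comp mK (@pair1_measurable _ _ T T x)).
pose F (z : T * T) := (a z.1 * b z.2 * K z.1 z.2)%:E.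
have mF : measurable_fun [set: T * T] F.
  apply/measurable_EFinP; apply: measurable_funM => //; apply: measurable_funM.
    exact: (measurableT_comp ma measurable_fst).
  exact: (measurableT_comp mb measurable_snd).
have M0 : 0 <= M by apply: le_trans (KM 0 0).
have iF : (lebS R n \x lebS R n)%E.-integrable [set: T * T] F.
  apply/integrable12ltyP => //.
  pose B := \int[lam]_y `|b y|.
  have iab : lam.-integrable [set: T] (EFin \o (fun y => `|b y|)) by exact: integrable_norm.
  have iaa : lam.-integrable [set: T] (EFin \o (fun x => `|a x|)) by exact: integrable_norm.
  apply: (@le_lt_trans _ _ (\int[lebS R n]_x (M * B * `|a x|)%:E)%E).
    apply: ge0_le_integral; first exact: measurableT.
    - by move=> x _; exact: integral_ge0.
    - apply: (measurable_fun_fubini_tonelli_F (abse \o F)); last by move=> z; exact: abse_ge0.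
      exact: measurableT_comp.
    - apply/measurable_EFinP; apply: measurable_funM; first exact: measurable_cst.
      exact: measurableT_comp.
    - move=> x _.
      have E : (\int[lam]_y ((M * `|a x|)%:E * `|b y|%:E) = (M * B * `|a x|)%:E)%E.
        rewrite integralZl; [|exact: measurableT|exact: iab].
        rewrite [in RHS]mulrAC [in RHS]EFinM; congr (_ * _)%E.
        by rewrite /B /Rintegral fineK// (integrable_fin_num measurableT iab).
      rewrite -E; apply: ge0_le_integral; first exact: measurableT.
      + by move=> y _; exact: abse_ge0.
      + apply: measurableT_comp; first exact: abse_measurable.
        exact: (measurableT_comp mF (@pair1_measurable _ _ T T x)).
      + apply/measurable_EFinP; apply: measurable_funM; first exact: measurable_cst.
        exact: measurableT_comp.
      + move=> y _; rewrite /F /= lee_fin !normrM mulrC mulrA.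
        by rewrite ler_wpM2r// ler_wpM2r.
  have iM := integrableZl measurableT (M * B) iaa.
  have /integrableP[_] := iM.
  apply: le_lt_trans; apply: ge0_le_integral; first exact: measurableT.
  - move=> x _; rewrite lee_fin mulr_ge0// mulr_ge0//; exact: Rintegral_ge0.
  - exact: (measurable_int _ iM).
  - by apply: measurableT_comp; [exact: abse_measurable|exact: (measurable_int _ iM)].
  - by move=> x _; rewrite /= lee_fin ler_norm.
have E1 x : (\int[lebS R n]_y F (x, y) = (a x * \int[lam]_y (b y * K x y))%:E)%E.
  have ibK := integrableMl_bounded ib (mK2 x) (KM x).
  rewrite EFinM /Rintegral fineK ?(integrable_fin_num measurableT ibK)//.
  rewrite -integralZl//; apply: eq_integral => y _.
  by rewrite /F -EFinM mulrA.
have E2 y : (\int[lebS R n]_x F (x, y) = (b y * \int[lam]_x (a x * K x y))%:E)%E.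
  have iaK := integrableMl_bounded ia (mK1 y) (KM ^~ y).
  rewrite EFinM /Rintegral fineK ?(integrable_fin_num measurableT iaK)//.
  rewrite -integralZl//; apply: eq_integral => x _.
  by rewrite /F -EFinM mulrCA mulrA.
have := Fubini iF.
under eq_integral => x _ do rewrite E1.
under [in RHS]eq_integral => y _ do rewrite E2.
by move=> H; rewrite /Rintegral; congr fine; exact: H.
Qed.

End parameter_integrals.

Section kernel.
Variables (R : realType) (n : nat).
Local Notation lam := (lebesgue_rV R n).
Local Notation T := (lebesgueT R n).
Implicit Types (x y z : 'rV[R]_n) (e : R).

Lemma measurable_dotrV2 d (X : measurableType d) (a b : X -> 'rV[R]_n) :
  measurable_fun [set: X] a -> measurable_fun [set: X] b ->
  measurable_fun [set: X] (fun t => dotrV (a t) (b t)).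
Proof.
move=> ma mb; apply: measurable_sum => i; apply: measurable_funM.
  exact: (measurableT_comp (measurable_coord i) ma).
exact: (measurableT_comp (measurable_coord i) mb).
Qed.

Lemma measurable_rV_id : measurable_fun [set: T] (id : T -> 'rV[R]_n).
Proof. by apply: measurable_fun_lebesgueT; exact: measurable_id. Qed.

Lemma measurable_ctrans (u : 'rV[R]_n -> R) : measurable_fun [set: 'rV[R]_n] u ->
  measurable_fun [set: 'rV[R]_n] (ctrans u).
Proof.
move=> mu; suff mF : measurable_fun [set: 'rV[R]_n * T]
  (fun z : 'rV[R]_n * T => u z.2 * cos (dotrV z.1 z.2)).
  exact: (measurable_param_integral mF).
have m2 : measurable_fun [set: 'rV[R]_n * T] (fun z : 'rV[R]_n * T => z.2 : 'rV[R]_n).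
  exact: (measurableT_comp measurable_rV_id measurable_snd).
apply: measurable_funM; first exact: (measurableT_comp mu m2).
apply: (@measurableT_comp _ _ _ _ _ _ (@cos R)).
  by apply: continuous_measurable_fun; exact: continuous_cos.
exact: (@measurable_dotrV2 _ ('rV[R]_n * T)%type fst snd measurable_fst m2).
Qed.

Lemma measurable_strans (u : 'rV[R]_n -> R) : measurable_fun [set: 'rV[R]_n] u ->
  measurable_fun [set: 'rV[R]_n] (strans u).
Proof.
move=> mu; suff mF : measurable_fun [set: 'rV[R]_n * T]
  (fun z : 'rV[R]_n * T => u z.2 * sin (dotrV z.1 z.2)).
  exact: (measurable_param_integral mF).
have m2 : measurable_fun [set: 'rV[R]_n * T] (fun z : 'rV[R]_n * T => z.2 : 'rV[R]_n).
  exact: (measurableT_comp measurable_rV_id measurable_snd).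
apply: measurable_funM; first exact: (measurableT_comp mu m2).
apply: (@measurableT_comp _ _ _ _ _ _ (@sin R)).
  by apply: continuous_measurable_fun; exact: continuous_sin.
exact: (@measurable_dotrV2 _ ('rV[R]_n * T)%type fst snd measurable_fst m2).
Qed.

(** The cosine transform alone, since the symbol is even and its sine transform vanishes. *)
Definition kere e x : R := ctrans (fun xi : 'rV[R]_n => chi (e *: xi)) x.

Lemma test_chi e : 0 < e -> test (fun xi : 'rV[R]_n => chi (e *: xi)).
Proof.
move=> e0; split.
  rewrite (_ : (fun _ => _) = fun xi => chi (e *: (xi - 0))); first exact: elem_chi.
  by apply/funext => xi; rewrite subr0.
exists (2 / e) => x i h; apply: (@chi0 _ _ _ i).
by rewrite mxE normrM gtr0_norm// mulrC -ler_pdivrMr// ltW.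
Qed.

Lemma dotrV_scaleV e x y : e != 0 -> dotrV x y = dotrV (e^-1 *: x) (e *: y).
Proof.
by move=> e0; rewrite dotrVZr dotrVC (dotrVC _ y) dotrVZr mulrA divff// mul1r.
Qed.

Lemma kere_scale e x : 0 < e -> kere e x = e^-1 ^+ n * kere 1 (e^-1 *: x).
Proof.
move=> e0; have tc := test_chi ltr01.
have := @Rintegral_affine R n e 0 _ (lt0r_neq0 e0) (integrable_cos (e^-1 *: x) tc).
rewrite gtr0_norm// -[X in _ = _ * X]/(kere 1 (e^-1 *: x)) => <-.
apply: eq_Rintegral => y _; rewrite addr0 scale1r; congr (_ * cos _).
exact: dotrV_scaleV (lt0r_neq0 e0).
Qed.

Lemma measurable_kere e : measurable_fun [set: 'rV[R]_n] (kere e).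
Proof.
apply: measurable_ctrans; apply: measurable_elem.
rewrite (_ : (fun _ => _) = fun xi => chi (e *: (xi - 0))); first exact: elem_chi.
by apply/funext => xi; rewrite subr0.
Qed.

Lemma kere_decay e : 0 < e -> exists2 C : R, 0 <= C &
  forall x, `|kere e x| <= C * weight x ^+ 2.
Proof.
move=> e0; have [C C0 HC] := trans_decay (test_chi e0).
by exists C => // x; have [] := HC x.
Qed.

Lemma integrable_kere e : 0 < e -> lam.-integrable [set: T] (EFin \o kere e).
Proof.
move=> e0; have [C C0 HC] := kere_decay e0.
apply: (@integrable_weight_bound _ _ _ C).
  by apply: measurable_fun_lebesgueT; exact: measurable_kere.
move=> x; apply: le_trans (HC x) _; rewrite ler_wpM2l// expr2.
by rewrite ler_piMr ?weight_ge0// weight_le1.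
Qed.

(** Fourier inversion would give the value [(2 pi)^n]. *)
Definition ker_mass : R := \int[lam]_z kere 1 z.

Variables (w : 'rV[R]_n -> R) (Cw : R).
Hypotheses (cw : continuous w) (mw : measurable_fun [set: 'rV[R]_n] w)
  (wC : forall x, `|w x| <= Cw * weight x).

Definition mollify e x : R := \int[lam]_y (w y * kere e (x - y)).

Let Cw0 : 0 <= Cw.
Proof. by rewrite -(pmulr_lge0 Cw (weight_gt0 (0 : 'rV[R]_n))); exact: le_trans (wC 0). Qed.

(** Substitution [y = x - e z]. It puts [e] in the argument of the continuous [w], so that
    domination and pointwise limits become available. *)
Lemma mollifyE e x : 0 < e ->
  mollify e x = \int[lam]_z (w (- e *: z + x) * kere 1 z).
Proof.
move=> e0; have [C C0 HC] := kere_decay ltr01.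
have eN0 : - e != 0 by rewrite oppr_eq0 gt_eqF.
pose f y := w y * kere 1 (e^-1 *: (x - y)).
have iff : lam.-integrable [set: T] (EFin \o f).
  apply: (@integrable_weight_bound _ _ _ (Cw * C)).
    apply: measurable_fun_lebesgueT; apply: measurable_funM => //.
    apply: measurableT_comp; first exact: measurable_kere.
    rewrite (_ : (fun _ => _) = affine (- e^-1) (e^-1 *: x)); first exact: measurable_affine.
    by apply/funext => y; rewrite /affine scalerBr scaleNr addrC.
  move=> y; rewrite normrM mulrAC ler_pM//; apply: le_trans (HC _) _.
  by rewrite ler_piMr// exprn_ile1 ?weight_ge0// weight_le1.
have := Rintegral_affine x eN0 iff.
rewrite normrN (gtr0_norm e0) => E.
rewrite (_ : \int[lam]_z (w (- e *: z + x) * kere 1 z) =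
             \int[lam]_z f (- e *: z + x)); last first.
  apply: eq_Rintegral => z _; congr (_ * kere 1 _).
  by rewrite opprD scaleNr opprK addrCA subrr addr0 scalerA mulVf ?gt_eqF// scale1r.
rewrite E -RintegralZl//; apply: eq_Rintegral => y _.
by rewrite kere_scale// mulrCA.
Qed.

Let Ck := projT1 (cid2 (kere_decay ltr01)).
Let Ck0 : 0 <= Ck. Proof. by rewrite /Ck; case: cid2. Qed.
Let kC z : `|kere 1 z| <= Ck * weight z ^+ 2.
Proof. by rewrite /Ck; case: cid2. Qed.

(** Uniform in [e <= 1]: since [weight z <= weight (e z)], one of the two factors [weight z] moves
    the weight of [w] from [x - e z] to [x], and the other remains for the integration. *)
Let mollify_integrand_le e x z : 0 < e -> e <= 1 ->
  `|w (- e *: z + x) * kere 1 z| <= Cw * Ck * 2 ^+ n * weight x * weight z.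
Proof.
move=> e0 e1; rewrite normrM.
have h1 : weight (- e *: z + x) * weight z <= 2 ^+ n * weight x.
  apply: le_trans (weight_mul_le x (- e *: z)).
  rewrite addrC ler_wpM2l ?weight_ge0// weight_scale// normrN gtr0_norm//.
apply: (@le_trans _ _ (Cw * weight (- e *: z + x) * (Ck * weight z ^+ 2))).
  by rewrite ler_pM.
rewrite [leLHS](_ : _ = Cw * Ck * (weight (- e *: z + x) * weight z) * weight z); last by ring.
rewrite ler_wpM2r ?weight_ge0// -!mulrA ler_wpM2l// ler_wpM2l//.
Qed.

Let mollify_integrable e x : 0 < e -> e <= 1 ->
  lam.-integrable [set: T] (EFin \o (fun z => w (- e *: z + x) * kere 1 z)).
Proof.
move=> e0 e1; apply: (@integrable_weight_bound _ _ _ (Cw * Ck * 2 ^+ n * weight x)).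
  apply: measurable_fun_lebesgueT; apply: measurable_funM; last exact: measurable_kere.
  exact: (measurableT_comp mw (measurable_affine (- e) x)).
by move=> z; exact: mollify_integrand_le.
Qed.

Lemma mollify_bound : exists2 C : R, 0 <= C &
  forall e x, 0 < e -> e <= 1 -> `|mollify e x| <= C * weight x.
Proof.
exists (Cw * Ck * 2 ^+ n * \int[lam]_z (weight z)).
  rewrite mulr_ge0 ?mulr_ge0 ?exprn_ge0//.
  by apply: Rintegral_ge0 => z _; exact: weight_ge0.
move=> e x e0 e1; rewrite mollifyE//.
pose c := Cw * Ck * 2 ^+ n * weight x.
have iw : lam.-integrable [set: T] (EFin \o (fun z => c * weight z)).
  exact: (integrableZl measurableT c (integrable_weight R n)).
have iwz := mollify_integrable x e0 e1.
apply: le_trans (le_normr_Rintegral measurableT iwz) _.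
rewrite -mulrA [X in _ * X]mulrC mulrA -/c -RintegralZl//; last exact: integrable_weight.
apply: le_Rintegral => //; first exact: integrable_norm.
by move=> z _; exact: mollify_integrand_le.
Qed.

Lemma mollify_cvg (e : R^nat) x : (forall j, 0 < e j <= 1) -> e @ \oo --> 0 ->
  mollify (e j) x @[j --> \oo] --> w x * ker_mass.
Proof.
move=> e01 e0.
pose c := Cw * Ck * 2 ^+ n * weight x.
have H1 j : measurable_fun [set: T] (fun z => (w (- e j *: z + x) * kere 1 z)%:E).
  by have /andP[ej0 ej1] := e01 j; have /measurable_int := mollify_integrable x ej0 ej1.
have H2 : measurable_fun [set: T] (fun z => (w x * kere 1 z)%:E).
  exact: (measurable_int _ (integrableZl measurableT (w x) (integrable_kere ltr01))).
have H3 : {ae lam, forall z : T, [set: T] z ->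
    (w (- e j *: z + x) * kere 1 z)%:E @[j --> \oo] --> (w x * kere 1 z)%:E}.
  apply: aeW => z _; apply: cvg_EFin; first exact: nearW.
  apply: cvgM; last exact: cvg_cst.
  have h : - e j *: z + x @[j --> \oo] --> x.
    rewrite -[X in _ --> X]add0r -(scale0r z) -oppr0.
    by apply: cvgD; [apply: cvgZr_tmp; exact: cvgN|exact: cvg_cst].
  by apply: (cvg_comp _ _ h); exact: cw.
have H4 : lam.-integrable [set: T] (fun z => c%:E * (weight z)%:E)%E.
  by apply: integrableZl => //; exact: integrable_weight.
have H5 : {ae lam, forall (z : T) j, [set: T] z ->
    (`|(w (- e j *: z + x) * kere 1 z)%:E| <= c%:E * (weight z)%:E)%E}.
  apply: aeW => z j _ /=; rewrite lee_fin; have /andP[ej0 ej1] := e01 j.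
  exact: mollify_integrand_le.
have [_ _] := dominated_convergence measurableT H1 H2 H3 H4 H5.
have E : (\int[lam]_z (w x * kere 1 z)%:E = (w x * ker_mass)%:E)%E.
  rewrite /ker_mass /Rintegral EFinM fineK ?(integrable_fin_num measurableT (integrable_kere ltr01))//.
  rewrite -integralZl//; exact: integrable_kere.
rewrite E => /fine_cvg; apply: cvg_trans.
apply: near_eq_cvg; near=> j; have /andP[ej0 ej1] := e01 j.
by rewrite /= mollifyE.
Unshelve. all: by end_near. Qed.

End kernel.

(** * Weak limits of mollified functions; positivity of the kernel mass *)

Section kernel_mass.
Variables (R : realType) (n : nat).
Local Notation lam := (lebesgue_rV R n).
Local Notation T := (lebesgueT R n).
Implicit Types (x y xi : 'rV[R]_n) (e : R).

Definition chi_mass e : R := \int[lam]_xi chi (e *: xi).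

Lemma chi_mass_scale e : 0 < e -> chi_mass e = e^-1 ^+ n * chi_mass 1.
Proof.
move=> e0; have := @Rintegral_affine R n e 0 _ (lt0r_neq0 e0) (integrable_test (test_chi n ltr01)).
rewrite (gtr0_norm e0) -[X in _ = _ * X]/(chi_mass 1) => <-.
by apply: eq_Rintegral => y _; rewrite addr0 scale1r.
Qed.

Lemma cvg_harmonic_le1 : (forall j, 0 < (@harmonic R) j <= 1) /\ (@harmonic R) @ \oo --> 0.
Proof.
split; last exact: cvg_harmonic.
by move=> j; rewrite harmonic_gt0/= /harmonic/= invf_le1// ler1n.
Qed.

(** If one mass vanished, all would by scaling. Then [weight] times [chi(x / (j + 1))] would have
    integral 0 for all [j], and in the limit so would [weight], whose integral is [pi^n]. *)
Lemma chi_mass_gt0 e : 0 < e -> 0 < chi_mass e.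
Proof.
move=> e0; rewrite chi_mass_scale// mulr_gt0// ?exprn_gt0 ?invr_gt0//.
have m0 : 0 <= chi_mass 1 by apply: Rintegral_ge0 => x _; exact: chi_ge0.
rewrite lt_neqAle m0 andbT; apply/eqP => m1.
have Z k : 0 < k -> chi_mass k = 0 by move=> k0; rewrite chi_mass_scale// -m1 mulr0.
have [h01 h0] := cvg_harmonic_le1.
pose h := @harmonic R.
have itc j : lam.-integrable [set: T] (EFin \o (fun x => chi (h j *: x))).
  by apply/integrable_test/test_chi; have /andP[] := h01 j.
have mc j : measurable_fun [set: T] (fun x => chi (h j *: x)).
  by apply/measurable_EFinP; exact: measurable_int (itc j).
have mW : measurable_fun [set: T] (@weight R n).
  by apply: measurable_fun_lebesgueT; exact: measurable_weight.
have H1 j : measurable_fun [set: T] (fun x => (weight x * chi (h j *: x))%:E).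
  by apply/measurable_EFinP; exact: measurable_funM.
have H2 : measurable_fun [set: T] (fun x => (weight x)%:E) by exact/measurable_EFinP.
have H3 : {ae lam, forall x : T, [set: T] x ->
    (weight x * chi (h j *: x))%:E @[j --> \oo] --> (weight x)%:E}.
  apply: aeW => x _; apply: cvg_EFin; first exact: nearW.
  rewrite -[X in _ --> X]mulr1; apply: cvgM; first exact: cvg_cst.
  have -> : (1 : R) = chi (1 *: (0 - 0) : 'rV[R]_n).
    by rewrite subr0 scaler0 chi1// => i; rewrite mxE normr0.
  have hx : h j *: x @[j --> \oo] --> (0 : 'rV[R]_n).
    by rewrite -[X in _ --> X](scale0r x); exact: cvgZr_tmp.
  have cc : continuous (fun x : 'rV[R]_n => chi (1 *: (x - 0))).
    by apply: elem_continuous; exact: elem_chi.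
  have := cvg_comp _ _ hx (cc 0).
  by apply: cvg_trans; apply: near_eq_cvg; apply: nearW => j; rewrite /= subr0 scale1r.
have H4 := integrable_weight R n.
have H5 : {ae lam, forall (x : T) j, [set: T] x ->
    (`|(weight x * chi (h j *: x))%:E| <= (weight x)%:E)%E}.
  apply: aeW => x j _ /=; rewrite lee_fin normrM !ger0_norm ?weight_ge0 ?chi_ge0//.
  by rewrite ler_piMr ?weight_ge0// chi_le1.
have [_ _] := dominated_convergence measurableT H1 H2 H3 H4 H5.
rewrite [X in X @ _ --> _](_ : _ = fun=> 0%E); last first.
  apply/funext => j; apply/eqP; rewrite eq_le; apply/andP; split; last first.
    by apply: integral_ge0 => x _; rewrite lee_fin mulr_ge0 ?weight_ge0 ?chi_ge0.
  have : (\int[lam]_x (chi (h j *: x))%:E = 0)%E.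
    rewrite -[LHS](@fineK R) ?(integrable_fin_num measurableT (itc j))//.
    by congr EFin; apply: Z; have /andP[] := h01 j.
  move=> <-; apply: ge0_le_integral => //.
  - by move=> x _; rewrite lee_fin mulr_ge0 ?weight_ge0 ?chi_ge0.
  - exact/measurable_EFinP.
  - by move=> x _; rewrite lee_fin ler_piMl ?chi_ge0// weight_le1.
move=> /(cvg_unique (@ereal_hausdorff R) (cvg_cst _)) hW.
have := integral_weight R n; rewrite -hW => /eqP.
by rewrite eqe eq_sym expf_eq0 gt_eqF ?andbF// pi_gt0.
Qed.

Lemma measurable_rVB d (X : measurableType d) (a b : X -> 'rV[R]_n) :
  measurable_fun [set: X] a -> measurable_fun [set: X] b ->
  measurable_fun [set: X] (fun t => a t - b t).
Proof.
move=> ma mb; apply: measurable_fun_rVP => i.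
rewrite (_ : (fun _ => _) = fun t => a t 0 i - b t 0 i).
  apply: measurable_funB.
    exact: (measurableT_comp (measurable_coord i) ma).
  exact: (measurableT_comp (measurable_coord i) mb).
by apply/funext => t; rewrite !mxE.
Qed.

(** The weak convergence of the convolutions, with the kernel on the side of the test function [w],
    so that [a] only has to be integrable against the weight. *)
Lemma pairing_cvg (a w : 'rV[R]_n -> R) (Cw : R) (e : R^nat) :
  continuous w -> measurable_fun [set: 'rV[R]_n] w ->
  (forall x, `|w x| <= Cw * weight x) ->
  measurable_fun [set: T] a ->
  lam.-integrable [set: T] (EFin \o (fun x => a x * weight x)) ->
  (forall j, 0 < e j <= 1) -> e @ \oo --> 0 ->
  (\int[lam]_x (a x * mollify w (e j) x)) @[j --> \oo] -->
  ker_mass R n * \int[lam]_x (a x * w x).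
Proof.
move=> cw mw wC ma iaW e01 e0.
have [C C0 HC] := mollify_bound mw wC.
have C0W x : 0 <= weight x := weight_ge0 x.
have iaw : lam.-integrable [set: T] (EFin \o (fun x => a x * w x)).
  apply: (@le_integrable _ T R lam _ measurableT _ (fun x => Cw%:E * (a x * weight x)%:E)%E).
  - apply/measurable_EFinP; apply: measurable_funM => //; exact: measurable_fun_lebesgueT.
  - move=> x _; rewrite /= lee_fin !normrM [leRHS]mulrCA ler_wpM2l//.
    by rewrite (ger0_norm (C0W x)) (le_trans (wC x))// ler_wpM2r// ler_norm.
  - exact: integrableZl.
have mm j : measurable_fun [set: T] (fun x => mollify w (e j) x).
  apply: (@measurable_param_integral R n _ T (fun z => w z.2 * kere (e j) (z.1 - z.2))).
  have m1 : measurable_fun [set: T * T] (fun z : T * T => z.1 : 'rV[R]_n).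
    exact: (measurableT_comp (@measurable_rV_id R n) measurable_fst).
  have m2 : measurable_fun [set: T * T] (fun z : T * T => z.2 : 'rV[R]_n).
    exact: (measurableT_comp (@measurable_rV_id R n) measurable_snd).
  apply: measurable_funM; first exact: (measurableT_comp mw m2).
  apply: (measurableT_comp (measurable_kere (e j))).
  exact: measurable_rVB.
have H1 j : measurable_fun [set: T] (fun x => (a x * mollify w (e j) x)%:E).
  by apply/measurable_EFinP; exact: measurable_funM.
have H2 : measurable_fun [set: T] (fun x => (a x * (w x * ker_mass R n))%:E).
  apply/measurable_EFinP; apply: (measurable_funM ma).
  apply: measurable_funM; last exact: measurable_cst.
  exact: measurable_fun_lebesgueT.
have H3 : {ae lam, forall x : T, [set: T] x ->
    (a x * mollify w (e j) x)%:E @[j --> \oo] --> (a x * (w x * ker_mass R n))%:E}.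
  apply: aeW => x _; apply: cvg_EFin; first exact: nearW.
  have hm := @mollify_cvg R n w Cw cw mw wC e x e01 e0.
  exact: (cvgM (cvg_cst _) hm).
have H4 : lam.-integrable [set: T] (fun x => C%:E * `|(a x * weight x)%:E|)%E.
  by apply: integrableZl => //; exact: integrable_abse.
have H5 : {ae lam, forall (x : T) j, [set: T] x ->
    (`|(a x * mollify w (e j) x)%:E| <= C%:E * `|(a x * weight x)%:E|)%E}.
  apply: aeW => x j _ /=; rewrite lee_fin !normrM [leRHS]mulrCA ler_wpM2l//.
  by rewrite (ger0_norm (C0W x)); have /andP[? ?] := e01 j; exact: HC.
have [_ _] := dominated_convergence measurableT H1 H2 H3 H4 H5.
have E : (\int[lam]_x (a x * (w x * ker_mass R n))%:E =
   (ker_mass R n * \int[lam]_x (a x * w x))%:E)%E.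
  rewrite -RintegralZl// /Rintegral fineK.
    by apply: eq_integral => x _; rewrite mulrA mulrC.
  exact: (integrable_fin_num measurableT (integrableZl measurableT _ iaw)).
by rewrite E => /fine_cvg.
Qed.

Variable u : 'rV[R]_n -> R.
Hypothesis tu : test u.

(** A regularised Plancherel identity. Two exchanges of integrals and the addition formula for the
    cosine prove it; the cut-off keeps all integrals absolutely convergent. *)
Lemma pairing_mollify e : 0 < e ->
  \int[lam]_x (u x * mollify u e x) =
  \int[lam]_xi (chi (e *: xi) * (ctrans u xi ^+ 2 + strans u xi ^+ 2)).
Proof.
move=> e0; have tc := test_chi n e0.
have iu := integrable_test tu; have ic := integrable_test tc.
have m1 : measurable_fun [set: T * T] (fun z : T * T => z.1 : 'rV[R]_n).
  exact: (measurableT_comp (@measurable_rV_id R n) measurable_fst).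
have m2 : measurable_fun [set: T * T] (fun z : T * T => z.2 : 'rV[R]_n).
  exact: (measurableT_comp (@measurable_rV_id R n) measurable_snd).
have mcos : measurable_fun [set: R] (@cos R).
  by apply: continuous_measurable_fun; exact: continuous_cos.
have msin : measurable_fun [set: R] (@sin R).
  by apply: continuous_measurable_fun; exact: continuous_sin.
have mu : measurable_fun [set: 'rV[R]_n] u by apply: measurable_elem; case: tu.
pose K x xi := cos (dotrV x xi) * ctrans u xi + sin (dotrV x xi) * strans u xi.
have E1 x : mollify u e x = \int[lam]_xi (chi (e *: xi) * K x xi).
  transitivity (\int[lam]_y (u y * \int[lam]_xi (chi (e *: xi) * cos (dotrV (x - y) xi)))).
    by [].
  rewrite (@Rintegral_swap R n u _ (fun y xi => cos (dotrV (x - y) xi)) 1 iu ic).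
  - apply: eq_Rintegral => xi _; congr (_ * _).
    rewrite /K /ctrans /strans -!RintegralZl//; [|exact: integrable_sin|exact: integrable_cos].
    rewrite -RintegralD//; last 2 first.
      exact: (integrableZl measurableT _ (integrable_cos xi tu)).
      exact: (integrableZl measurableT _ (integrable_sin xi tu)).
    apply: eq_Rintegral => y _; rewrite dotrVC dotrVBr cosB (dotrVC xi x).
    by ring.
  - apply: (measurableT_comp mcos); apply: measurable_dotrV2 => //.
    by apply: measurable_rVB => //; exact: measurable_cst.
  - by move=> y xi; exact: normr_cos_le1.
under eq_Rintegral => x _ do rewrite E1.
have [C C0 HC] := trans_bound tu.
rewrite (@Rintegral_swap R n u _ K (C + C) iu ic).
- apply: eq_Rintegral => xi _; congr (_ * _).
  transitivity (\int[lam]_x (ctrans u xi * (u x * cos (dotrV xi x)) +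
                               strans u xi * (u x * sin (dotrV xi x)))).
    by apply: eq_Rintegral => x _; rewrite /K (dotrVC x); ring.
  rewrite RintegralD//; last 2 first.
    exact: (integrableZl measurableT _ (integrable_cos xi tu)).
    exact: (integrableZl measurableT _ (integrable_sin xi tu)).
  by rewrite !RintegralZl//; [exact: integrable_sin|exact: integrable_cos].
- have md : measurable_fun [set: T * T] (fun z : T * T => dotrV (z.1 : 'rV[R]_n) (z.2 : 'rV[R]_n)).
    exact: measurable_dotrV2.
  apply: measurable_funD; apply: measurable_funM.
  + exact: (measurableT_comp mcos md).
  + exact: (measurableT_comp (measurable_ctrans mu) m2).
  + exact: (measurableT_comp msin md).
  + exact: (measurableT_comp (measurable_strans mu) m2).
- move=> x xi; rewrite /K; have [hc hs] := HC xi.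
  rewrite (le_trans (ler_normD _ _))// lerD// normrM.
    by rewrite (le_trans _ hc)// ler_piMl// normr_cos_le1.
  by rewrite (le_trans _ hs)// ler_piMl// normr_sin_le1.
Qed.


End kernel_mass.

Section kernel_mass_positive.
Variables (R : realType) (n : nat).
Local Notation lam := (lebesgue_rV R n).
Local Notation T := (lebesgueT R n).
Implicit Types (x y xi : 'rV[R]_n) (e : R).

(** Chosen so that [|x_i| < 1 / (n + 1)] where [phi] does not vanish. For [|xi_i| <= 1] the dot
    product of [xi] and [x] is then at most 1 in absolute value, and its cosine at least
    [cos 1 > 0]. *)
Let N : R := 2 * n.+1%:R.
Let phi x : R := chi (N *: x).

Let N_gt0 : 0 < N. Proof. by rewrite mulr_gt0. Qed.
Let tphi : test phi. Proof. exact: test_chi. Qed.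

Let ctrans_phi xi : (forall i, `|xi 0 i| <= 1) -> cos 1 * chi_mass n N <= ctrans phi xi.
Proof.
move=> xi1; rewrite /ctrans /chi_mass -RintegralZl//; last exact: integrable_test.
apply: le_Rintegral => //.
- exact: (integrableZl measurableT _ (integrable_test tphi)).
- exact: integrable_cos.
move=> x _; rewrite mulrC; have [[i hi]|hx] := pselect (exists i, 2 <= `|(N *: x) 0 i|).
  by rewrite /phi (chi0 hi) !mul0r.
rewrite ler_wpM2l ?chi_ge0//.
have d1 : `|dotrV xi x| <= 1.
  apply: le_trans (ler_norm_sum _ _ _) _.
  apply: (@le_trans _ _ (\sum_(i < n) n.+1%:R^-1)).
    apply: ler_sum => i _; rewrite normrM -[leRHS]mul1r ler_pM//.
    have : ~~ (2 <= `|(N *: x) 0 i|) by apply/negP => h; apply: hx; exists i.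
    rewrite -ltNge mxE normrM gtr0_norm// /N -mulrA -[ltRHS]mulr1 ltr_pM2l//.
    by move=> /ltW; rewrite -ler_pdivlMl// mulr1.
  by rewrite sumr_const card_ord -[leLHS]mulr_natl ler_pdivrMr// mul1r ler_nat.
rewrite -(cos_norm (dotrV xi x)).
have pi1 : 1 <= pi :> R by apply: le_trans (pi_ge2 R); rewrite ler1n.
by rewrite leNgt ltr_cos ?in_itv/= ?normr_ge0 ?ler01 ?(le_trans d1)// -leNgt.
Qed.

Lemma ker_mass_gt0 : 0 < ker_mass R n.
Proof.
have [mu mu0 Mu] := test_bound tphi.
have [ephi _] := tphi.
have cphi : continuous phi := elem_continuous ephi.
have mphi := measurable_elem ephi.
have [h01 h0] := cvg_harmonic_le1 R.
have iphi := integrable_test tphi.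
have iW : lam.-integrable [set: T] (EFin \o (fun x => phi x * weight x)).
  apply: integrable_test_mul => //; first exact: measurable_weight.
  by move=> x; rewrite ger0_norm ?weight_le1// weight_ge0.
have mTphi : measurable_fun [set: T] phi by exact: measurable_fun_lebesgueT.
have hc := pairing_cvg cphi mphi Mu mTphi iW h01 h0.
(* A lower bound for all pairings with [e <= 1]: where [chi(2 xi)] does not vanish, [|xi_i| < 1], so
   [chi(e xi) = 1] and the transform of [phi] is at least [cos 1 * chi_mass n N]. *)
pose m := (cos 1 * chi_mass n N) ^+ 2 * chi_mass n 2.
have m0 : 0 < m.
  by rewrite mulr_gt0 ?chi_mass_gt0// exprn_gt0// mulr_gt0 ?cos1_gt0// chi_mass_gt0.
have lb e : 0 < e -> e <= 1 -> m <= \int[lam]_x (phi x * mollify phi e x).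
  move=> e0 e1; rewrite pairing_mollify// /m /chi_mass -RintegralZl//; last first.
    exact/integrable_test/test_chi.
  have [C C0 HC] := trans_bound tphi.
  have te := test_chi n e0; have t2 : test (fun xi : 'rV[R]_n => chi (2 *: xi)) by exact: test_chi.
  have i2 := integrable_test t2; have ie := integrable_test te.
  apply: le_Rintegral => //.
  - exact: (integrableZl measurableT _ i2).
  - apply: (@integrableMl_bounded R n _ _ (C ^+ 2 + C ^+ 2) ie).
      apply: measurable_fun_lebesgueT; apply: measurable_funD; apply: measurable_funX.
        exact: measurable_ctrans.
      exact: measurable_strans.
    move=> xi; have [hC hS] := HC xi.
    rewrite (le_trans (ler_normD _ _))// lerD// normrX lerXn2r// nnegrE//.
  move=> xi _; have p0 : 0 <= ctrans phi xi ^+ 2 + strans phi xi ^+ 2.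
    by rewrite addr_ge0// sqr_ge0.
  have [[i hi]|hx] := pselect (exists i, 2 <= `|(2 *: xi) 0 i|).
    by rewrite (chi0 hi) mulr0 mulr_ge0// chi_ge0.
  have xi1 i : `|xi 0 i| <= 1.
    have : ~~ (2 <= `|(2 *: xi) 0 i|) by apply/negP => h; apply: hx; exists i.
    rewrite -ltNge mxE normrM gtr0_norm// -[ltRHS]mulr1 ltr_pM2l//.
    exact: ltW.
  rewrite (@chi1 _ _ (e *: xi)); last first.
    by move=> i; rewrite mxE normrM gtr0_norm// mulr_ile1// ltW.
  rewrite mul1r; apply: (@le_trans _ _ (ctrans phi xi ^+ 2)); last first.
    by rewrite lerDl sqr_ge0.
  have c0 : 0 <= cos 1 * chi_mass n N.
    by rewrite mulr_ge0// ltW ?cos1_gt0// chi_mass_gt0.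
  apply: (@le_trans _ _ ((cos 1 * chi_mass n N) ^+ 2)).
    by rewrite ler_piMr ?sqr_ge0// chi_le1.
  by rewrite lerXn2r ?nnegrE// ?(le_trans c0)// ctrans_phi.
have hm : m <= ker_mass R n * \int[lam]_x (phi x * phi x).
  rewrite -(cvg_lim _ hc)//; apply: limr_ge; first by apply/cvg_ex; eexists; exact: hc.
  by near=> j; have /andP[j0 j1] := h01 j; exact: lb.
have pp0 : 0 <= \int[lam]_x (phi x * phi x).
  by apply: Rintegral_ge0 => x _; rewrite mulr_ge0// chi_ge0.
have := lt_le_trans m0 hm; rewrite pmulr_lgt0//.
rewrite lt_neqAle pp0 andbT eq_sym; apply/eqP => Z.
by move: (lt_le_trans m0 hm); rewrite Z mulr0 ltxx.
Unshelve. all: by end_near. Qed.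

End kernel_mass_positive.

(** * The reproducing formula *)

Section reproducing_formula.
Variables (R : realType) (n : nat).
Local Notation lam := (lebesgue_rV R n).
Local Notation T := (lebesgueT R n).
Implicit Types (x y z : 'rV[R]_n) (e : R).

Variables (a : 'rV[R]_n -> R) (d : R).
Hypotheses (ma : measurable_fun [set: T] a)
  (iaW : lam.-integrable [set: T] (EFin \o (fun x => a x * weight x)))
  (d0 : 0 < d) (d1 : d <= 1).

(** The convolution of [a] with [kere e] at [y], as the kernel is even. *)
Definition kconv e y : R := \int[lam]_x (a x * kere e (x - y)).

Let W : 'rV[R]_n -> R := @weight R n.
Let W0 x : 0 < W x. Proof. exact: weight_gt0. Qed.

(** Conjugation by the weight makes the kernel bounded, so that exchanges of integrals apply to
    [a W], which is integrable, although [a] need not be. *)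
Let ratio e x y : R := kere e (x - y) * W y / W x.

Let ratio_bound e : 0 < e -> exists2 C : R, 0 <= C & forall x y, `|ratio e x y| <= C.
Proof.
move=> e0; have [C C0 HC] := kere_decay n e0.
exists (C * 2 ^+ n); first by rewrite mulr_ge0 ?exprn_ge0.
move=> x y; rewrite /ratio !normrM normfV !(gtr0_norm (W0 _)) ler_pdivrMr//.
have h := weight_mul_le x (- y); rewrite weightN in h.
rewrite -mulrA; apply: le_trans (_ : C * (W (x - y) * W y) <= _); last by rewrite ler_wpM2l.
rewrite mulrA; apply: ler_wpM2r; first exact: ltW.
apply: le_trans (HC _) _; rewrite ler_wpM2l// expr2.
by apply: ler_piMr; [exact: ltW|exact: weight_le1].
Qed.

Let m1 : measurable_fun [set: T * T] (fun z : T * T => z.1 : 'rV[R]_n).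
Proof. exact: (measurableT_comp (@measurable_rV_id R n) measurable_fst). Qed.

Let m2 : measurable_fun [set: T * T] (fun z : T * T => z.2 : 'rV[R]_n).
Proof. exact: (measurableT_comp (@measurable_rV_id R n) measurable_snd). Qed.

Let mkB e : measurable_fun [set: T * T] (fun z : T * T => kere e (z.1 - z.2 : 'rV[R]_n)).
Proof. exact: (measurableT_comp (measurable_kere e) (measurable_rVB m1 m2)). Qed.

Let mW : measurable_fun [set: T] W.
Proof. by apply: measurable_fun_lebesgueT; exact: measurable_weight. Qed.

Let mratio e : measurable_fun [set: T * T] (fun z : T * T => ratio e z.1 z.2).
Proof.
have mi : measurable_fun [set: T * T] (fun z : T * T => (W z.1)^-1).
  have -> : (fun z : T * T => (W z.1)^-1) = expR \o (fun z : T * T => - ln (W z.1)).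
    by apply/funext => z; rewrite /= expRN lnK// posrE.
  apply: measurableT_comp => //; apply: measurableT_comp => //.
  by apply: measurableT_comp => //; exact: (measurableT_comp (@measurable_weight R n) m1).
have mw2 : measurable_fun [set: T * T] (fun z : T * T => W z.2).
  exact: (measurableT_comp (@measurable_weight R n) m2).
exact: (measurable_funM (measurable_funM (mkB e) mw2) mi).
Qed.

Lemma measurable_kconv e : measurable_fun [set: T] (kconv e).
Proof.
have m : measurable_fun [set: T * T]
    (fun z : T * T => a z.2 * kere e (z.2 - z.1 : 'rV[R]_n)).
  apply: measurable_funM; first exact: (measurableT_comp ma measurable_snd).
  exact: (measurableT_comp (measurable_kere e) (measurable_rVB m2 m1)).
exact: (measurable_param_integral m).
Qed.

Let mratio1 e y : measurable_fun [set: T] (fun x => ratio e x y).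
Proof. exact: (measurableT_comp (mratio e) (@pair2_measurable _ _ T T y)). Qed.

Let iratio e y : 0 < e ->
  lam.-integrable [set: T] (EFin \o (fun x => a x * W x * ratio e x y)).
Proof.
move=> e0; have [C C0 HC] := ratio_bound e0.
by apply: (integrableMl_bounded iaW (mratio1 e y)) => x; exact: HC.
Qed.

Let ratioE e x y : a x * W x * ratio e x y = W y * (a x * kere e (x - y)).
Proof. by rewrite /ratio; have := W0 x => Wx; field; rewrite gt_eqF. Qed.

Lemma integrable_kconv e y : 0 < e ->
  lam.-integrable [set: T] (EFin \o (fun x => a x * kere e (x - y))).
Proof.
move=> e0; have := integrableZl measurableT (W y)^-1 (iratio y e0).
apply: eq_integrable => // x _; rewrite /= ratioE -EFinM.
by rewrite mulKf// gt_eqF.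
Qed.

Let kconv_ratio e y : 0 < e ->
  W y * kconv e y = \int[lam]_x (a x * W x * ratio e x y).
Proof.
move=> e0; rewrite /kconv -RintegralZl//; last exact: integrable_kconv.
by apply: eq_Rintegral => x _; rewrite ratioE.
Qed.

Let kconv_bound e : 0 < e -> exists2 C : R, 0 <= C & forall y, `|kconv e y * W y| <= C.
Proof.
move=> e0; have [C C0 HC] := ratio_bound e0.
have iN := integrable_norm iaW.
exists (C * \int[lam]_x `|a x * W x|); first by rewrite mulr_ge0// Rintegral_ge0.
move=> y; rewrite mulrC kconv_ratio//.
apply: le_trans (le_normr_Rintegral measurableT (iratio y e0)) _.
rewrite -RintegralZl//; apply: le_Rintegral => //.
- exact: (integrable_norm (iratio y e0)).
- exact: (integrableZl measurableT C iN).
- by move=> x _; rewrite normrM mulrC ler_wpM2r.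
Qed.

(** Tests carry the factor [W^2]: one [W] makes [W g] integrable, the other is the one inside
    [ratio]. *)
Let pairing_kconv e g : 0 < e -> borel_test g ->
  \int[lam]_x (a x * mollify (fun x => W x ^+ 2 * g x) e x) =
  \int[lam]_y (W y ^+ 2 * g y * kconv e y).
Proof.
move=> e0 [cg mg g01]; have [C C0 HC] := ratio_bound e0.
have ib : lam.-integrable [set: T] (EFin \o (fun y => W y * g y)).
  apply: (integrableMl_bounded (M := 1) (integrable_weight R n)).
    exact: measurable_fun_lebesgueT.
  by move=> y; have /andP[? ?] := g01 y; rewrite ger0_norm.
have ikr x : lam.-integrable [set: T] (EFin \o (fun y => W y * g y * ratio e x y)).
  exact: (integrableMl_bounded ib (measurableT_comp (mratio e) (@pair1_measurable _ _ T T x)) (HC x)).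
apply: etrans (etrans _ (Rintegral_swap iaW ib (mratio e) HC)) _.
  apply: eq_Rintegral => x _; rewrite -mulrA; congr (_ * _).
  apply: etrans _ (RintegralZl (W x) measurableT (ikr x)).
  apply: eq_Rintegral => y _; rewrite /ratio.
  by have := W0 x => Wx; field; rewrite gt_eqF.
apply: eq_Rintegral => y _.
apply: etrans (congr1 (fun t => W y * g y * t) (esym (kconv_ratio y e0))) _.
by ring.
Qed.

Lemma reproducing_formula :
  (forall e y, 0 < e -> e <= d -> kconv e y = kconv d y) ->
  {ae lam, forall x : T, ker_mass R n * a x = kconv d x}.
Proof.
move=> ke; have [C C0 HC] := kconv_bound d0.
have iA : lam.-integrable [set: T] (EFin \o (fun x => W x ^+ 2 * a x)).
  have := integrableMl_bounded (M := 1) iaW mW.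
  have h y : `|W y| <= 1 by rewrite ger0_norm ?weight_le1// ltW.
  move=> /(_ h); apply: eq_integrable => // x _ /=; congr EFin.
  by rewrite -/(W x); ring.
have iG : lam.-integrable [set: T] (EFin \o (fun x => W x ^+ 2 * kconv d x)).
  apply: (@integrable_weight_bound _ _ _ C).
    by apply: measurable_funM; [exact: measurable_funX|exact: measurable_kconv].
  move=> x; rewrite expr2 -mulrA normrM mulrC (mulrC (W x)) (gtr0_norm (W0 x)).
  by rewrite ler_wpM2r// ltW.
(* The factor [W x ^+ 2] makes [u] integrable and never vanishes, so it can be cancelled at the
   end. *)
pose u x := ker_mass R n * (W x ^+ 2 * a x) - W x ^+ 2 * kconv d x.
have iu : lam.-integrable [set: T] (EFin \o u).
  exact: (integrableB measurableT (integrableZl measurableT (ker_mass R n) iA) iG).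
have ug0 g : borel_test g -> (\int[lam]_x (u x * g x)%:E = 0)%E.
  move=> tg; have [cg mg g01] := tg.
  have gb y : `|g y| <= 1 by have /andP[? ?] := g01 y; rewrite ger0_norm.
  have mTg : measurable_fun [set: T] g by exact: measurable_fun_lebesgueT.
  pose w x := W x ^+ 2 * g x.
  have cw : continuous w.
    move=> x; have -> : w = fun x => W x * W x * g x by apply/funext => z; rewrite /w expr2.
    have cW := @continuous_weight R n.
    exact: (cvgM (cvgM (cW x) (cW x)) (cg x)).
  have wW x : `|w x| <= 1 * weight x.
    rewrite normrM mul1r ger0_norm ?exprn_ge0 ?weight_ge0//.
    apply: (@le_trans _ _ (W x ^+ 2)); first by rewrite ler_piMr// exprn_ge0// weight_ge0.
    by rewrite expr2 ler_piMr ?weight_le1// weight_ge0.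
  have mw : measurable_fun [set: 'rV[R]_n] w.
    by apply: measurable_funM => //; apply: measurable_funX; exact: measurable_weight.
  have [h01 h0] := cvg_harmonic_le1 R.
  pose e j : R := d * harmonic j.
  have e01 j : 0 < e j <= 1.
    by have /andP[h1 h2] := h01 j; rewrite mulr_gt0//= mulr_ile1// ltW.
  have ed j : e j <= d by have /andP[h1 h2] := h01 j; rewrite ler_piMr// ltW.
  have e0 : e @ \oo --> 0.
    by rewrite -[X in _ --> X](mulr0 d); apply: cvgM => //; exact: cvg_cst.
  have := pairing_cvg cw mw wW ma iaW e01 e0.
  (* By hypothesis the convolution is the same for every [e j <= d], so the sequence is constant and
     equals its weak limit. *)
  rewrite (_ : (fun j => _) = fun=> \int[lam]_y (W y ^+ 2 * g y * kconv d y)); last first.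
    apply/funext => j; have /andP[h1 _] := e01 j; apply: etrans (pairing_kconv h1 tg) _.
    by apply: eq_Rintegral => y _; rewrite (ke _ y h1 (ed j)).
  move=> /(cvg_unique (@norm_hausdorff _ R) (cvg_cst _)) E.
  have iug : lam.-integrable [set: T] (EFin \o (fun x => u x * g x)).
    exact: (integrableMl_bounded iu mTg gb).
  rewrite -[LHS](@fineK R) ?(integrable_fin_num measurableT iug)//; congr EFin.
  rewrite -[LHS]/(\int[lam]_x (u x * g x)).
  transitivity (\int[lam]_x (ker_mass R n * (W x ^+ 2 * a x * g x) - W x ^+ 2 * kconv d x * g x)).
    by apply: eq_Rintegral => x _; rewrite /u mulrBl !mulrA.
  have iAg := integrableMl_bounded iA mTg gb.
  apply: etrans (RintegralB measurableT (integrableZl measurableT (ker_mass R n) iAg)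
    (integrableMl_bounded iG mTg gb)) _.
  apply/eqP; rewrite subr_eq0; apply/eqP.
  apply: etrans (RintegralZl (ker_mass R n) measurableT iAg) _.
  apply: etrans (_ : ker_mass R n * \int[lam]_x (a x * w x) = _).
    congr (_ * _); apply: eq_Rintegral => x _; rewrite /w mulrA; congr (_ * _).
    exact: mulrC.
  apply: etrans (_ : \int[lam]_y (W y ^+ 2 * g y * kconv d y) = _); last first.
    by apply: eq_Rintegral => x _; rewrite -!mulrA (mulrC (g x)).
  by rewrite E mulrC.
have := ae_eq0_of_tests iu ug0.
apply: filterS => x /= /eqP; rewrite /u mulrCA -mulrBr mulf_eq0 expf_eq0/= gt_eqF//=.
by rewrite subr_eq0 => /eqP.
Qed.

End reproducing_formula.

(** * Localisation of the spectrum *)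

Section sup_norm.
Variables (R : realType) (n : nat).
Implicit Types (x : 'rV[R]_n).

Lemma coord_le_norm x i : `|x 0 i| <= `|x|.
Proof.
rewrite [leRHS]/Num.Def.normr /= mx_normrE; apply/bigmax_geP; right => /=.
by exists (0, i).
Qed.

Lemma norm_rV_le x (c : R) : 0 <= c -> (forall i, `|x 0 i| <= c) -> `|x| <= c.
Proof.
move=> c0 xc; rewrite [leLHS]/Num.Def.normr /= mx_normrE; apply/bigmax_leP; split => //.
by move=> [i j] _ /=; rewrite ord1.
Qed.

Lemma norm_rV_le_enorm x : `|x| <= enorm x.
Proof.
apply: norm_rV_le; first exact: sqrtr_ge0.
move=> i; rewrite -sqrtr_sqr; apply: ler_wsqrtr.
rewrite /dotrV (bigD1 i)//= -expr2 lerDl.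
by apply: sumr_ge0 => j _; rewrite -expr2 sqr_ge0.
Qed.

End sup_norm.

Section partition.
Variables (R : realType) (n : nat).
Implicit Types (u w : 'rV[R]_n -> R) (x xi : 'rV[R]_n).

(** The rescaled [chi] is 1 within distance [e] of [x] and 0 beyond [2 e]. The ball of radius [3 e]
    contains the closed ball of radius [2 e], hence the closed support. *)
Lemma bump x (e : R) (U : set 'rV[R]_n) : 0 < e -> ball x (3 * e) `<=` U ->
  [/\ elem (fun y => chi (e^-1 *: (y - x))),
    forall y, `|y - x| < e -> chi (e^-1 *: (y - x)) = 1 &
    forall u y, closure [set z | u z * chi (e^-1 *: (z - x)) != 0] y -> U y].
Proof.
move=> e0 xU; have eV : 0 < e^-1 by rewrite invr_gt0.
split; first exact: elem_chi.
  move=> y yx; apply: chi1 => i; rewrite mxE normrM gtr0_norm// mulrC ler_pdivrMr// mul1r.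
  exact: le_trans (coord_le_norm _ _) (ltW yx).
move=> u y cy; apply: xU; have e2 : 0 < 2 * e by rewrite mulr_gt0.
have : closed_ball x (2 * e) y.
  rewrite (_ : closed_ball _ _ = closure (closed_ball x (2 * e))); last first.
    by apply/closure_id; exact: closed_ball_closed.
  move: y cy; apply: closure_subset => z /= /eqP uz.
  rewrite closed_ballE// /closed_ball_ /= distrC; apply: norm_rV_le; first exact: ltW.
  move=> i; rewrite leNgt; apply/negP => hi; apply: uz.
  rewrite (@chi0 _ _ _ i) ?mulr0// mxE normrM gtr0_norm// mulrC ler_pdivlMr//.
  exact: ltW.
rewrite closed_ballE// /closed_ball_ /= -ball_normE /= => h.
by apply: le_lt_trans h _; lra.
Qed.

(* A smooth partition of unity, unrolled: the pieces u * b_1,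
   u * (1 - b_1) * b_2, ... are peeled off one bump at a time. *)
Lemma test_local_global (V : ('rV[R]_n -> R) -> Prop) (s : R) : V (fun=> 0) ->
  (forall u w, test u -> test w -> V u -> V w -> V (fun x => u x + w x)) ->
  (forall xi, s <= `|xi| -> exists U, [/\ open U, U xi &
    forall u, test u -> (forall x, closure [set z | u z != 0] x -> U x) -> V u]) ->
  forall u, test u -> (forall x, u x != 0 -> s <= `|x|) -> V u.
Proof.
move=> V0 VD VU u tu us.
have [eu [M0 uM0]] := tu.
pose M := Num.max 0 M0.
have uM x : u x != 0 -> `|x| <= M.
  move=> ux; apply: norm_rV_le; first by rewrite le_max lexx.
  move=> i; rewrite leNgt; apply/negP => h; move/eqP: ux; apply; apply: (uM0 x i).
  by apply: le_lt_trans h; rewrite le_max lexx orbT.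
pose K := [set x : 'rV[R]_n | s <= `|x| /\ `|x| <= M].
have cK : compact K.
  apply: bounded_closed_compact.
    by exists M; split; [exact: num_real|move=> r Mr x [_ xM]; exact: le_trans xM (ltW Mr)].
  rewrite (_ : K = (fun x : 'rV[R]_n => `|x|) @^-1` [set r | s <= r] `&`
    (fun x : 'rV[R]_n => `|x|) @^-1` [set r | r <= M])//.
  apply: closedI; (apply: closed_comp; [move=> ? _; exact: norm_continuous|]).
    exact: closed_ge.
  exact: closed_le.
(* The radius has the dummy value 1 where [s <= |xi|] fails, so that it can be chosen as a function
   on the whole space. *)
have bumps xi : exists e, 0 < e /\ (s <= `|xi| -> forall w, test w ->
    V (fun x => w x * chi (e^-1 *: (x - xi)))).
  have [sxi|nsxi] := pselect (s <= `|xi|); last by exists 1.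
  have [U [oU Ux hU]] := VU xi sxi.
  have /nbhs_ballP[r /= r0 rU] : nbhs xi U by exact: open_nbhs_nbhs.
  have r3 : 0 < r / 3 by rewrite divr_gt0.
  have rU' : ball xi (3 * (r / 3)) `<=` U by rewrite mulrC divfK.
  exists (r / 3); split=> // _ w tw; have [h1 _ h3] := bump r3 rU'.
  by apply: hU; [exact: test_mul|exact: h3].
pose e xi := projT1 (cid (bumps xi)).
have e0 xi : 0 < e xi by rewrite /e; case: cid => ? [].
have eV xi : s <= `|xi| -> forall w, test w ->
    V (fun x => w x * chi ((e xi)^-1 *: (x - xi))).
  by rewrite /e; case: cid => ? [].
have [D DK KD] : finite_subset_cover K (fun xi => ball xi (e xi)) K.
  have := cK; rewrite compact_cover; apply.
    by move=> i _; exact: ball_open.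
  by move=> x Kx; exists x => //; exact: ballxx.
have {}KD x : u x != 0 -> exists2 xi, xi \in (finmap.enum_fset D) & `|x - xi| < e xi.
  move=> ux; have [|xi /= xiD] := KD x; first by split; [exact: us|exact: uM].
  by rewrite -ball_normE /= distrC => h; exists xi.
have {}DK xi : xi \in (finmap.enum_fset D) -> s <= `|xi|.
  by move=> h; have := DK xi h; rewrite inE => -[].
move: (finmap.enum_fset D) DK KD => {cK K uM us eu M M0 uM0 D} => r.
elim: r u tu => [|xi r IH] u tu rK cov.
  suff -> : u = fun=> 0 by [].
  apply/funext => x; apply/eqP; apply: contraT => /cov[y].
  by rewrite in_nil.
pose b x := chi ((e xi)^-1 *: (x - xi)).
have bT : ball xi (3 * e xi) `<=` [set: 'rV[R]_n] by [].
have [eb b1 _] := bump (e0 xi) bT.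
have tub : test (fun x => u x * b x) by exact: test_mul.
rewrite (_ : u = fun x => u x * b x + (u x - u x * b x)); last first.
  by apply/funext => x; rewrite addrC subrK.
apply: (VD (fun x => u x * b x) (fun x => u x - u x * b x)) => //; first exact: test_sub.
- by apply: eV => //; apply: rK; rewrite mem_head.
- apply: IH; first exact: test_sub.
  + by move=> y yr; apply: rK; rewrite in_cons yr orbT.
  + move=> x hx; have ux : u x != 0.
      by apply: contra hx => /eqP ->; rewrite mul0r subr0.
    have [y] := cov x ux; rewrite in_cons => /orP[/eqP ->|yr] yx; last by exists y.
    by move: hx; rewrite /b b1// mulr1 subrr eqxx.
Qed.

End partition.

Section spectrum.
Variables (R : realType) (n : nat).
Local Notation lam := (lebesgue_rV R n).
Local Notation T := (lebesgueT R n).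
Implicit Types (u w : 'rV[R]_n -> R) (x xi : 'rV[R]_n).

Definition cembed u : 'rV[R]_n -> R[i] := fun x => (u x)%:C%C.

Let c0 : R := (2 * pi) `^ (- (n%:R / 2)).

Let c0_gt0 : 0 < c0.
Proof. by apply: powR_gt0; rewrite mulr_gt0// pi_gt0. Qed.

Lemma fourier_cembed u xi : test u ->
  fourier (cembed u) xi = (c0 * ctrans u xi +i* (- (c0 * strans u xi)))%C.
Proof.
move=> tu; have E x : expi (- dotrV x xi) * cembed u x =
    (u x * cos (dotrV xi x) +i* - (u x * sin (dotrV xi x)))%C.
  rewrite /expi /cembed dotrVC cosN sinN; simpc.
  by rewrite mulrC (mulrC (u x) (sin _)).
rewrite /fourier; under eq_fun do rewrite E.
have -> : cintegral (fun x => (u x * cos (dotrV xi x) +i* - (u x * sin (dotrV xi x)))%C) =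
    (ctrans u xi +i* - strans u xi)%C.
  rewrite /cintegral/=; congr (_ +i* _)%C.
  apply: etrans (_ : \int[lam]_x (-1 * (u x * sin (dotrV xi x))) = _).
    by apply: eq_Rintegral => x _; rewrite mulN1r.
  by rewrite (RintegralZl _ measurableT (integrable_sin xi tu)) mulN1r.
by simpc; rewrite ?mulrN.
Qed.

Lemma integrableMl_decay (a g : 'rV[R]_n -> R) (C : R) :
  lam.-integrable [set: T] (EFin \o (fun x => a x * weight x)) ->
  measurable_fun [set: T] a -> measurable_fun [set: T] g ->
  (forall x, `|g x| <= C * weight x) ->
  lam.-integrable [set: T] (EFin \o (fun x => a x * g x)).
Proof.
move=> ia ma mg gC.
have iC := integrableZl measurableT C (integrable_norm ia).
apply: (le_integrable measurableT _ _ iC).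
  by apply/measurable_EFinP; exact: measurable_funM.
move=> x _; rewrite /= lee_fin !normrM !normr_id.
apply: le_trans (ler_wpM2l (normr_ge0 _) (gC x)) _.
rewrite mulrCA (ger0_norm (weight_ge0 x)); apply: ler_wpM2r; last exact: ler_norm.
by rewrite mulr_ge0// weight_ge0.
Qed.

Lemma ctransD u w x : test u -> test w ->
  ctrans (fun y => u y + w y) x = ctrans u x + ctrans w x.
Proof.
move=> tu tw; apply: etrans _ (RintegralD measurableT (integrable_cos x tu) (integrable_cos x tw)).
by apply: eq_Rintegral => y _; rewrite mulrDl.
Qed.

Lemma stransD u w x : test u -> test w ->
  strans (fun y => u y + w y) x = strans u x + strans w x.
Proof.
move=> tu tw; apply: etrans _ (RintegralD measurableT (integrable_sin x tu) (integrable_sin x tw)).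
by apply: eq_Rintegral => y _; rewrite mulrDl.
Qed.

Lemma trans_even u x : (forall y, u (- y) = u y) -> test u -> strans u x = 0.
Proof.
move=> uN tu; have := @Rintegral_affine R n (-1) 0 _ _ (integrable_sin x tu).
rewrite oppr_eq0 oner_eq0 => /(_ isT); rewrite normrN1 invr1 expr1n mul1r.
have -> : \int[lam]_y (u (-1 *: y + 0) * sin (dotrV x (-1 *: y + 0))) = - strans u x.
  apply: etrans (_ : \int[lam]_y (-1 * (u y * sin (dotrV x y))) = _).
    by apply: eq_Rintegral => y _; rewrite addr0 scaleN1r uN dotrVNr sinN mulrN mulN1r.
  by rewrite (RintegralZl _ measurableT (integrable_sin x tu)) mulN1r.
by rewrite -/(strans u x) => h; lra.
Qed.

Lemma trans_odd u x : (forall y, u (- y) = - u y) -> test u -> ctrans u x = 0.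
Proof.
move=> uN tu; have := @Rintegral_affine R n (-1) 0 _ _ (integrable_cos x tu).
rewrite oppr_eq0 oner_eq0 => /(_ isT); rewrite normrN1 invr1 expr1n mul1r.
have -> : \int[lam]_y (u (-1 *: y + 0) * cos (dotrV x (-1 *: y + 0))) = - ctrans u x.
  apply: etrans (_ : \int[lam]_y (-1 * (u y * cos (dotrV x y))) = _).
    by apply: eq_Rintegral => y _; rewrite addr0 scaleN1r uN dotrVNr cosN mulN1r mulNr.
  by rewrite (RintegralZl _ measurableT (integrable_cos x tu)) mulN1r.
by rewrite -/(ctrans u x) => h; lra.
Qed.

Variable f : 'rV[R]_n -> R[i].
Let a x := complex.Re (f x).
Let b x := complex.Im (f x).
Hypotheses (ma : measurable_fun [set: T] a) (mb : measurable_fun [set: T] b)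
  (iaW : lam.-integrable [set: T] (EFin \o (fun x => a x * weight x)))
  (ibW : lam.-integrable [set: T] (EFin \o (fun x => b x * weight x))).

Let trans_weight u : test u -> exists C : R, forall x,
  `|ctrans u x| <= C * weight x /\ `|strans u x| <= C * weight x.
Proof.
move=> tu; have [C C0 HC] := trans_decay tu; exists C => x.
have hW : C * weight x ^+ 2 <= C * weight x.
  by rewrite ler_wpM2l// expr2 ler_piMr ?weight_ge0// weight_le1.
by have [h1 h2] := HC x; split; apply: le_trans hW.
Qed.

Let mT (g : 'rV[R]_n -> R) : measurable_fun [set: 'rV[R]_n] g -> measurable_fun [set: T] g.
Proof. exact: measurable_fun_lebesgueT. Qed.

Let mtest u : test u -> measurable_fun [set: 'rV[R]_n] u.
Proof. by case=> eu _; exact: measurable_elem. Qed.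

Lemma integrable_pairing_ctrans (g : 'rV[R]_n -> R) u :
  measurable_fun [set: T] g ->
  lam.-integrable [set: T] (EFin \o (fun x => g x * weight x)) -> test u ->
  lam.-integrable [set: T] (EFin \o (fun x => g x * ctrans u x)).
Proof.
move=> mg ig tu; have [C HC] := trans_weight tu.
apply: (integrableMl_decay ig mg (mT (measurable_ctrans (mtest tu))) (C := C)).
by move=> x; have [] := HC x.
Qed.

Lemma integrable_pairing_strans (g : 'rV[R]_n -> R) u :
  measurable_fun [set: T] g ->
  lam.-integrable [set: T] (EFin \o (fun x => g x * weight x)) -> test u ->
  lam.-integrable [set: T] (EFin \o (fun x => g x * strans u x)).
Proof.
move=> mg ig tu; have [C HC] := trans_weight tu.
apply: (integrableMl_decay ig mg (mT (measurable_strans (mtest tu))) (C := C)).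
by move=> x; have [] := HC x.
Qed.

Let iac := fun u => @integrable_pairing_ctrans a u ma iaW.
Let ias := fun u => @integrable_pairing_strans a u ma iaW.
Let ibc := fun u => @integrable_pairing_ctrans b u mb ibW.
Let ibs := fun u => @integrable_pairing_strans b u mb ibW.

Let ac u : R := \int[lam]_x (a x * ctrans u x).
Let as_ u : R := \int[lam]_x (a x * strans u x).
Let bc u : R := \int[lam]_x (b x * ctrans u x).
Let bs u : R := \int[lam]_x (b x * strans u x).

(** The Fourier transform of [f] annihilates the real test [u]: real and imaginary part of the
    pairing, without the factor [c0]. *)
Let pair0 u := ac u + bs u = 0 /\ bc u - as_ u = 0.

Let fourier_dist_cembed u : test u ->
  fourier_dist f (cembed u) = ((c0 * (ac u + bs u)) +i* (c0 * (bc u - as_ u)))%C.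
Proof.
move=> tu; rewrite /fourier_dist /cintegral; congr (_ +i* _)%C.
  rewrite /ac /bs -(RintegralD measurableT (iac tu) (ibs tu)).
  have i1 := integrableD measurableT (iac tu) (ibs tu).
  rewrite -(RintegralZl _ measurableT i1); apply: eq_Rintegral => x _.
  rewrite fourier_cembed// /a /b; case: (f x) => s t /=; ring.
rewrite /bc /as_ -(RintegralB measurableT (ibc tu) (ias tu)).
have i1 := integrableB measurableT (ibc tu) (ias tu).
rewrite -(RintegralZl _ measurableT i1); apply: eq_Rintegral => x _.
rewrite fourier_cembed// /a /b; case: (f x) => s t /=; ring.
Qed.

Let pair0D u w : test u -> test w -> pair0 u -> pair0 w ->
  pair0 (fun x => u x + w x).
Proof.
move=> tu tw [h1 h2] [h3 h4].
have Eac : ac (fun x => u x + w x) = ac u + ac w.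
  apply: etrans _ (RintegralD measurableT (iac tu) (iac tw)).
  by apply: eq_Rintegral => x _; rewrite ctransD// mulrDr.
have Ebc : bc (fun x => u x + w x) = bc u + bc w.
  apply: etrans _ (RintegralD measurableT (ibc tu) (ibc tw)).
  by apply: eq_Rintegral => x _; rewrite ctransD// mulrDr.
have Eas : as_ (fun x => u x + w x) = as_ u + as_ w.
  apply: etrans _ (RintegralD measurableT (ias tu) (ias tw)).
  by apply: eq_Rintegral => x _; rewrite stransD// mulrDr.
have Ebs : bs (fun x => u x + w x) = bs u + bs w.
  apply: etrans _ (RintegralD measurableT (ibs tu) (ibs tw)).
  by apply: eq_Rintegral => x _; rewrite stransD// mulrDr.
split; first by rewrite Eac Ebs addrACA h1 h3 addr0.
by rewrite Ebc Eas opprD addrACA h2 h4 addr0.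
Qed.

Let pair00 : pair0 (fun=> 0).
Proof.
have Ec x : @ctrans R n (fun=> 0) x = 0.
  apply: etrans (_ : \int[lam]_x (0 : R) = _); first by apply: eq_Rintegral => y _; rewrite mul0r.
  by rewrite Rintegral_cst// mul0r.
have Es x : @strans R n (fun=> 0) x = 0.
  apply: etrans (_ : \int[lam]_x (0 : R) = _); first by apply: eq_Rintegral => y _; rewrite mul0r.
  by rewrite Rintegral_cst// mul0r.
have I0 (g h : 'rV[R]_n -> R) : (forall x, h x = 0) -> \int[lam]_x (g x * h x) = 0.
  move=> h0; apply: etrans (_ : \int[lam]_x (0 : R) = _).
    by apply: eq_Rintegral => y _; rewrite h0 mulr0.
  by rewrite Rintegral_cst// mul0r.
by split; rewrite /ac /bs /bc /as_ !I0// ?addr0 ?subr0.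
Qed.

Let test_function_cembed u (U : set 'rV[R]_n) : test u ->
  (forall x, closure [set z | u z != 0] x -> U x) -> test_function U (cembed u).
Proof.
move=> [eu [r ur]] uU.
have E : [set x | cembed u x != 0] = [set z | u z != 0].
  by apply/funext => x /=; rewrite /cembed eq_complex /= eqxx andbT.
split.
- split; first exact: elem_smooth eu.
  exact: (elem_smooth (elem_cst n (0 : R))).
- rewrite /fsupp E; apply: bounded_closed_compact; last exact: closed_closure.
  exists (Num.max 0 r); split; first exact: num_real.
  move=> M; rewrite gt_max => /andP[M0 rM] x.
  have : closed [set x : 'rV[R]_n | `|x| <= M].
    by apply: (@closed_comp _ _ (fun x : 'rV[R]_n => `|x|) [set t | t <= M]);
      [move=> ? _; exact: norm_continuous|exact: closed_le].
  move=> /closure_id E2 hx; suff : closure [set x : 'rV[R]_n | `|x| <= M] x by rewrite -E2.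
  move: x hx; apply: closure_subset => y /= uy.
  apply: norm_rV_le; first exact: ltW.
  move=> i; rewrite leNgt; apply/negP => h; move: uy; rewrite (ur y i) ?eqxx//.
  exact: lt_trans h.
- by rewrite /fsupp E.
Qed.

Variable s : R.
Hypothesis fs : dsupp (fourier_dist f) `<=` [set xi | enorm xi < s].

(** Since the sup norm is at most the Euclidean one, every point with [s <= |xi|] lies outside the
    spectrum and has a neighbourhood on which the distribution vanishes; these local statements are
    patched by the partition of unity. *)
Let pair0_far w : test w -> (forall x, w x != 0 -> s <= `|x|) -> pair0 w.
Proof.
apply: (test_local_global pair00 pair0D) => xi sxi.
have : ~ dsupp (fourier_dist f) xi.
  move=> /fs /=; rewrite ltNge => /negP; apply.
  exact: le_trans sxi (norm_rV_le_enorm _).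
move=> /existsNP[U] /not_implyP[oU] /not_implyP[Ux] h.
exists U; split; [exact: oU|exact: Ux|move=> u tu uU].
have : fourier_dist f (cembed u) = 0.
  apply/eqP; apply: contraT => hu; case: h; exists (cembed u); split; last exact: hu.
  exact: test_function_cembed.
rewrite (fourier_dist_cembed tu) => -[/eqP h1 /eqP h2].
move: h1 h2; rewrite !mulf_eq0 (gt_eqF c0_gt0) => /eqP h1 /eqP h2.
exact: (conj h1 h2).
Qed.

(** The difference of the two kernels, centred at [y], is the transform of [D] times a character. A
    real test only annihilates the combinations [ac + bs] and [bc - as_], which mix real and
    imaginary part of [f]; parity separates them, because [D cos] is even and [D sin] is odd. *)
Lemma spectrum_kconv (e d : R) (y : 'rV[R]_n) : 0 < e -> e <= d -> s * d <= 1 ->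
  kconv a e y = kconv a d y /\ kconv b e y = kconv b d y.
Proof.
move=> e0 ed sd; have d0 : 0 < d by exact: lt_le_trans ed.
(* As [e <= d] and [s * d <= 1], both cut-offs are 1 where [|xi| < s], so [D] lives off the
   spectrum. *)
pose D xi : R := chi (e *: xi) - chi (d *: xi).
have tD : test D := test_sub (test_chi n e0) (test_chi n d0).
have DN xi : D (- xi) = D xi by rewrite /D !scalerN !chiN.
have Ds xi : D xi != 0 -> s <= `|xi|.
  move=> Dx; rewrite leNgt; apply/negP => xs; move/eqP: Dx; apply.
  have h i : `|d * xi 0 i| <= 1.
    rewrite normrM gtr0_norm//; apply: le_trans sd; rewrite mulrC ler_wpM2r ?(ltW d0)//.
    by apply: le_trans (coord_le_norm _ _) (ltW xs).
  have he i : `|e * xi 0 i| <= 1.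
    apply: le_trans (h i); rewrite !normrM (gtr0_norm e0) (gtr0_norm d0).
    by apply: ler_wpM2r; first exact: normr_ge0.
  by rewrite /D !chi1 ?subrr// => i; rewrite mxE; [exact: h|exact: he].
pose u1 xi := D xi * cos (dotrV y xi).
pose u2 xi := D xi * sin (dotrV y xi).
have t1 : test u1 by apply: (test_mul tD); exact: elem_cos.
have t2 : test u2 by apply: (test_mul tD); exact: elem_sin.
have [p1 q1] : pair0 u1.
  apply: (pair0_far t1) => x h; apply: Ds; apply: contra h => /eqP h.
  by rewrite /u1 h mul0r.
have [p2 q2] : pair0 u2.
  apply: (pair0_far t2) => x h; apply: Ds; apply: contra h => /eqP h.
  by rewrite /u2 h mul0r eqxx.
have s1 x : strans u1 x = 0.
  by apply: (trans_even _ _ t1) => z; rewrite /u1 DN dotrVNr cosN.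
have c2 x : ctrans u2 x = 0.
  by apply: (trans_odd _ _ t2) => z; rewrite /u2 DN dotrVNr sinN mulrN.
have I0 (g h : 'rV[R]_n -> R) : (forall x, h x = 0) -> \int[lam]_x (g x * h x) = 0.
  move=> h0; apply: etrans (_ : \int[lam]_x (0 : R) = _).
    by apply: eq_Rintegral => z _; rewrite h0 mulr0.
  by rewrite Rintegral_cst// mul0r.
have bs1 : bs u1 = 0 by exact: I0.
have as1 : as_ u1 = 0 by exact: I0.
have ac2 : ac u2 = 0 by exact: I0.
have bc2 : bc u2 = 0 by exact: I0.
(* The addition formula for [cos(x xi - y xi)] recombines the two modulated tests into the
   difference of the kernels. *)
have KE x : ctrans u1 x + strans u2 x = kere e (x - y) - kere d (x - y).
  apply: etrans (esym (RintegralD measurableT (integrable_cos x t1) (integrable_sin x t2))) _.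
  have ice := integrable_cos (x - y) (test_chi n e0).
  have icd := integrable_cos (x - y) (test_chi n d0).
  apply: etrans _ (RintegralB measurableT ice icd).
  apply: eq_Rintegral => z _; rewrite -mulrBl -/(D z) /u1 /u2.
  rewrite (dotrVC (x - y)) dotrVBr cosB (dotrVC z x) (dotrVC z y); ring.
have key (g : 'rV[R]_n -> R) (mg : measurable_fun [set: T] g)
    (ig : lam.-integrable [set: T] (EFin \o (fun x => g x * weight x))) :
    \int[lam]_x (g x * ctrans u1 x) = 0 -> \int[lam]_x (g x * strans u2 x) = 0 ->
    kconv g e y = kconv g d y.
  move=> g1 g2; apply/eqP; rewrite -subr_eq0; apply/eqP.
  have i1 := integrable_kconv ig y e0.
  have i2 := integrable_kconv ig y d0.
  rewrite /kconv -(RintegralB measurableT i1 i2) -[RHS](addr0 0) -[X in _ = X + _]g1 -[X in _ = _ + X]g2.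
  rewrite -(RintegralD measurableT (integrable_pairing_ctrans mg ig t1)
    (integrable_pairing_strans mg ig t2)).
  by apply: eq_Rintegral => x _; rewrite -mulrBr -KE mulrDr.
have ac1 : ac u1 = 0 by have := p1; rewrite bs1 addr0.
have bc1 : bc u1 = 0 by have := q1; rewrite as1 subr0.
have bs2 : bs u2 = 0 by have := p2; rewrite ac2 add0r.
have as2 : as_ u2 = 0 by have := q2; rewrite bc2 sub0r => /eqP; rewrite oppr_eq0 => /eqP.
split; [exact: (key a ma iaW ac1 as2)|exact: (key b mb ibW bc1 bs2)].
Qed.

End spectrum.

(** * Pointwise bound from the modular *)

Lemma measurable_powR2 (R : realType) d (X : measurableType d) (t p : X -> R) :
  measurable_fun [set: X] t -> measurable_fun [set: X] p ->
  measurable_fun [set: X] (fun x => t x `^ p x).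
Proof.
move=> mt mp; apply: measurable_fun_ifT.
- by apply: measurable_fun_eqr => //; exact: measurable_cst.
- have m0 : measurable_fun [set: X] (fun x => p x == 0).
    by apply: measurable_fun_eqr => //; exact: measurable_cst.
  rewrite (_ : (fun x => _) = (fun x => if p x == 0 then 1 : R else 0)).
    by apply: measurable_fun_ifT => //; exact: measurable_cst.
  by apply/funext => x; case: ifP.
- apply: measurableT_comp => //; apply: measurable_funM => //.
  exact: (measurableT_comp (@measurable_ln R) mt).
Qed.

Lemma ge0_integrable_of_le (R : realType) d (X : measurableType d)
    (mu : {measure set X -> \bar R}) (g : X -> R) (c : R) :
  measurable_fun [set: X] g -> (forall x, 0 <= g x) ->
  (\int[mu]_x (g x)%:E <= c%:E)%E ->
  mu.-integrable [set: X] (EFin \o g) /\ \int[mu]_x g x <= c.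
Proof.
move=> mg g0 gc; have ig : mu.-integrable [set: X] (EFin \o g).
  apply/integrableP; split; first exact/measurable_EFinP.
  rewrite (eq_integral (fun x => (g x)%:E)); first exact: le_lt_trans gc (ltry _).
  by move=> x _; rewrite /= ger0_norm.
by split => //; rewrite -lee_fin fineK// integrable_fin_num.
Qed.

Section complex_modulus.
Variable R : realType.
Implicit Types (z : R[i]) (m : R).

Lemma normc_ge0 z : 0 <= Normc.normc z.
Proof. by case: z => a b; rewrite /Normc.normc sqrtr_ge0. Qed.

Lemma normc_scaleV m z : 0 < m -> Normc.normc ((m^-1)%:C%C * z) = m^-1 * Normc.normc z.
Proof.
move=> m0; rewrite Normc.normcM; congr (_ * _).
by rewrite /Normc.normc /= expr0n /= addr0 sqrtr_sqr ger0_norm// invr_ge0 ltW.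
Qed.

Lemma normr_Re_le z : `|complex.Re z| <= Normc.normc z.
Proof.
by case: z => a b; rewrite /Normc.normc /= -sqrtr_sqr ler_wsqrtr// lerDl sqr_ge0.
Qed.

Lemma normr_Im_le z : `|complex.Im z| <= Normc.normc z.
Proof.
by case: z => a b; rewrite /Normc.normc /= -sqrtr_sqr ler_wsqrtr// lerDr sqr_ge0.
Qed.

Lemma normc_le_ReIm z : Normc.normc z <= `|complex.Re z| + `|complex.Im z|.
Proof.
case: z => a b; rewrite /Normc.normc /=.
have h0 : 0 <= `|a| + `|b| by rewrite addr_ge0.
rewrite -[leRHS]ger0_norm// -sqrtr_sqr ler_wsqrtr// sqrrD !real_normK ?num_real//.
rewrite [leRHS]addrAC lerDl; by rewrite mulrn_wge0// mulr_ge0.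
Qed.

(** Dominates [|f| / m] by a bounded function plus one of integral at most 1, uniformly in the
    exponent. *)
Lemma powR_ge_pred (t p : R) : 0 <= t -> 1 <= p -> t <= 1 + t `^ p.
Proof.
move=> t0 p1; have [t1|t1] := leP t 1; first by rewrite ler_wpDr// powR_ge0.
by rewrite ler_wpDl// le1r_powR// ltW.
Qed.

End complex_modulus.

Section nikolskii.
Variables (R : realType) (n : nat).
Local Notation lam := (lebesgue_rV R n).
Local Notation T := (lebesgueT R n).
Implicit Types (x y z : 'rV[R]_n).

(** Under scaling the sup norm grows like [d^(-n)] while the integral of the modulus is invariant;
    as [d <= 1], the constant [C * d^-1 ^+ n] covers both. *)
Lemma kere_bound : exists2 C : R, 0 <= C & forall d, 0 < d -> d <= 1 ->
  (forall x, `|@kere R n d x| <= C * d^-1 ^+ n) /\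
  forall y, \int[lam]_x `|kere d (x - y)| <= C * d^-1 ^+ n.
Proof.
have [C C0 HC] := @kere_decay R n 1 ltr01.
pose I1 : R := \int[lam]_x `|@kere R n 1 x|.
have I10 : 0 <= I1 by exact: Rintegral_ge0.
exists (C + I1); first by rewrite addr_ge0.
move=> d d0 d1; have dV : 0 <= d^-1 ^+ n by rewrite exprn_ge0// invr_ge0 ltW.
have dV1 : 1 <= d^-1 ^+ n by rewrite exprn_ege1// invf_ge1.
split.
  move=> x; rewrite kere_scale// normrM (ger0_norm dV) mulrC ler_wpM2r//.
  apply: (@le_trans _ _ C); last by rewrite lerDl.
  apply: le_trans (HC _) _; rewrite -[leRHS]mulr1 ler_wpM2l//.
  by rewrite expr_le1 ?weight_ge0 ?weight_le1.
move=> y; have ik := integrable_norm (integrable_kere n (@ltr01 R)).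
have dn : d^-1 != 0 by rewrite invr_eq0 gt_eqF.
have := @Rintegral_affine R n d^-1 (- d^-1 *: y) _ dn ik.
rewrite normfV invrK (gtr0_norm d0) -/I1 => E.
have -> : \int[lam]_x `|kere d (x - y)| =
    \int[lam]_x (d^-1 ^+ n * `|kere 1 (d^-1 *: x + - d^-1 *: y)|).
  apply: eq_Rintegral => x _.
  rewrite (kere_scale _ d0) normrM (ger0_norm dV); congr (_ * `|kere 1 _|).
  by rewrite scaleNr scalerBr.
have ia : lam.-integrable [set: T] (EFin \o (fun x => `|kere 1 (d^-1 *: x + - d^-1 *: y)|)).
  exact: (@integrable_affine R n d^-1 (- d^-1 *: y) _ dn ik).
rewrite (RintegralZl _ measurableT ia) E mulrA -exprMn mulVf ?gt_eqF// expr1n mul1r.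
apply: (@le_trans _ _ (C + I1)); first by rewrite lerDr.
by rewrite ler_peMr// addr_ge0.
Qed.

(* Here g plays the part of |f/m|^p, which dominates |f/m| up to adding 1. *)
Lemma kconv_bound : exists2 C : R, 0 <= C & forall (d m : R) (a g : 'rV[R]_n -> R),
  0 < d -> d <= 1 -> 0 <= m ->
  measurable_fun [set: T] a -> lam.-integrable [set: T] (EFin \o g) ->
  \int[lam]_x g x <= 1 -> (forall x, 0 <= g x) ->
  (forall x, `|a x| <= m * (1 + g x)) ->
  lam.-integrable [set: T] (EFin \o (fun x => a x * weight x)) /\
  forall y, `|kconv a d y| <= C * d^-1 ^+ n * m.
Proof.
have [C C0 HC] := kere_bound.
exists (2 * C); first by rewrite mulr_ge0.
move=> d m a g d0 d1 m0 ma ig g1 g0 ag; have [h1 h2] := HC d d0 d1.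
have mW : measurable_fun [set: T] (@weight R n).
  by apply: measurable_fun_lebesgueT; exact: measurable_weight.
have iaW : lam.-integrable [set: T] (EFin \o (fun x => a x * weight x)).
  have iG : lam.-integrable [set: T] (EFin \o (fun x => m * (weight x + g x))).
    exact: (integrableZl measurableT m (integrableD measurableT (integrable_weight R n) ig)).
  apply: (le_integrable measurableT _ _ iG).
    by apply/measurable_EFinP; exact: measurable_funM.
  move=> x _; rewrite /= lee_fin.
  rewrite [leRHS]ger0_norm; last by rewrite mulr_ge0// addr_ge0// weight_ge0.
  rewrite normrM (ger0_norm (weight_ge0 x)).
  apply: le_trans (ler_wpM2r (weight_ge0 x) (ag x)) _.
  rewrite -mulrA ler_wpM2l// mulrDl mul1r lerD2l.
  by rewrite ler_piMr// weight_le1.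
split => // y.
have mk : measurable_fun [set: T] (fun x : T => kere d (x - y : 'rV[R]_n)).
  apply: (measurableT_comp (measurable_kere d)).
  by apply: measurable_rVB; [exact: measurable_rV_id|exact: measurable_cst].
have ik := integrable_kconv iaW y d0.
have iks : lam.-integrable [set: T] (EFin \o (fun x => `|kere d (x - y)|)).
  have := @integrable_affine R n 1 (- y) _ (oner_neq0 _) (integrable_norm (integrable_kere n d0)).
  by apply: eq_integrable => // x _; rewrite /= scale1r.
have igC := integrableZl measurableT (C * d^-1 ^+ n) ig.
have iS := integrableZl measurableT m (integrableD measurableT igC iks).
apply: le_trans (le_normr_Rintegral measurableT ik) _.
apply: le_trans (le_Rintegral measurableT (integrable_norm ik) iS _) _.
  move=> x _; rewrite -[leRHS]/(m * (C * d^-1 ^+ n * g x + `|kere d (x - y)|)).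
  rewrite -[leLHS]/(`|a x * kere d (x - y)|) normrM.
  apply: le_trans (ler_wpM2r (normr_ge0 _) (ag x)) _.
  rewrite -[leLHS]mulrA; apply: (ler_wpM2l m0); rewrite mulrDl mul1r addrC lerD2r mulrC.
  by rewrite ler_wpM2r.
rewrite -[leLHS]/(\int[lam]_x (m * (C * d^-1 ^+ n * g x + `|kere d (x - y)|))).
rewrite (RintegralZl _ measurableT (integrableD measurableT igC iks)).
rewrite (RintegralD measurableT igC iks) (RintegralZl _ measurableT ig).
have -> : 2 * C * d^-1 ^+ n * m = m * (C * d^-1 ^+ n + C * d^-1 ^+ n) by ring.
apply: (ler_wpM2l m0); apply: lerD; last exact: h2.
by rewrite ler_piMr// mulr_ge0// exprn_ge0// invr_ge0 ltW.
Qed.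

Lemma measurable_normc (f : 'rV[R]_n -> R[i]) : cmeasurable f ->
  measurable_fun [set: T] (fun x => Normc.normc (f x)).
Proof.
move=> [m1 m2].
rewrite (_ : (fun x => _) =
  fun x => Num.sqrt (complex.Re (f x) ^+ 2 + complex.Im (f x) ^+ 2)); last first.
  by apply/funext => x; case: (f x).
apply: (measurableT_comp (continuous_measurable_fun (@sqrt_continuous R))).
by apply: measurable_funD; exact: measurable_funX.
Qed.

Lemma nikolskii : exists2 B : R, 0 < B & forall (p : 'rV[R]_n -> R) (f : 'rV[R]_n -> R[i])
    (m : R) (v : nat), is_exponent p -> cmeasurable f -> 0 < m ->
  (modular p (fun x => (m^-1)%:C%C * f x)%R <= 1)%E ->
  dsupp (fourier_dist f) `<=` [set xi | enorm xi <= 2 ^+ v.+1] ->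
  {ae lam, forall x : T, Normc.normc (f x) <= B * 2 ^+ (v * n) * m}.
Proof.
have [C C0 HC] := kconv_bound.
have km := ker_mass_gt0 R n.
(* The 2 counts real and imaginary part, [4^n] is the part of [d^(-n)] beyond [2^(vn)], and the
   final 1 makes [B] positive even if [C] is 0. *)
pose B : R := 2 * (C * 4 ^+ n / ker_mass R n) + 1.
have B0 : 0 < B.
  apply: ltr_wpDl => //; apply: mulr_ge0 => //; apply: divr_ge0; last exact: ltW.
  by apply: mulr_ge0 => //; exact: exprn_ge0.
exists B => // p f m v [mp p1] [ma mb] m0 mod1 fs.
pose g x := Normc.normc ((m^-1)%:C%C * f x) `^ p x.
have gE x : g x = (m^-1 * Normc.normc (f x)) `^ p x by rewrite /g normc_scaleV.
have g0 x : 0 <= g x by exact: powR_ge0.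
have mg : measurable_fun [set: T] g.
  rewrite (_ : g = fun x => (m^-1 * Normc.normc (f x)) `^ p x); last exact/funext.
  apply: (@measurable_powR2 R _ T (fun x => m^-1 * Normc.normc (f x)) p _ mp).
  apply: measurable_funM; first exact: measurable_cst.
  exact: (measurable_normc (conj ma mb)).
have [ig g1] := ge0_integrable_of_le mg g0 mod1.
have fg x : Normc.normc (f x) <= m * (1 + g x).
  have nf := normc_ge0 (f x).
  rewrite gE -ler_pdivrMl// powR_ge_pred//.
  by rewrite mulr_ge0// invr_ge0 ltW.
have ag x : `|complex.Re (f x)| <= m * (1 + g x) by exact: le_trans (normr_Re_le _) (fg x).
have bg x : `|complex.Im (f x)| <= m * (1 + g x) by exact: le_trans (normr_Im_le _) (fg x).
(* Exponent [v + 2], not [v + 1]: the spectrum lies in a closed ball, while the localisation needs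
   the strict bound [enorm xi < s], with [s * d <= 1]. *)
pose d : R := (2 ^+ v.+2)^-1.
have s0 : 0 < 2 ^+ v.+2 :> R by rewrite exprn_gt0.
have d0 : 0 < d by rewrite invr_gt0.
have d1 : d <= 1 by rewrite invf_le1// exprn_ege1// ler1n.
have [iaW ha] := HC d m _ g d0 d1 (ltW m0) ma ig g1 g0 ag.
have [ibW hb] := HC d m _ g d0 d1 (ltW m0) mb ig g1 g0 bg.
have fs' : dsupp (fourier_dist f) `<=` [set xi | enorm xi < 2 ^+ v.+2].
  move=> xi /fs /= h; apply: le_lt_trans h _.
  by rewrite [ltRHS]exprS ltr_pMl ?exprn_gt0// ltr1n.
have sd : 2 ^+ v.+2 * d <= 1 by rewrite /d divff// gt_eqF.
have ke e y (e0 : 0 < e) (ed : e <= d) := spectrum_kconv ma mb iaW ibW fs' y e0 ed sd.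
have ra := reproducing_formula ma iaW d0 d1 (fun e y e0 ed => (ke e y e0 ed).1).
have rb := reproducing_formula mb ibW d0 d1 (fun e y e0 ed => (ke e y e0 ed).2).
have dE : d^-1 ^+ n = 4 ^+ n * 2 ^+ (v * n).
  by rewrite /d invrK exprM -exprMn; congr (_ ^+ _); rewrite !exprS mulrA -natrM.
apply: filterS2 ra rb => x /= Ea Eb.
have ka : `|complex.Re (f x)| <= C * d^-1 ^+ n * m / ker_mass R n.
  rewrite ler_pdivlMr// mulrC; apply: le_trans (ha x).
  by rewrite -Ea normrM (gtr0_norm km).
have kb : `|complex.Im (f x)| <= C * d^-1 ^+ n * m / ker_mass R n.
  rewrite ler_pdivlMr// mulrC; apply: le_trans (hb x).
  by rewrite -Eb normrM (gtr0_norm km).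
apply: le_trans (normc_le_ReIm _) _; apply: le_trans (lerD ka kb) _.
rewrite dE; set K := ker_mass R n.
have -> : C * (4 ^+ n * 2 ^+ (v * n)) * m / K + C * (4 ^+ n * 2 ^+ (v * n)) * m / K =
  2 * (C * 4 ^+ n / K) * (2 ^+ (v * n) * m) by ring.
rewrite -[leRHS]mulrA ler_wpM2r ?lerDl//.
by rewrite mulr_ge0// ?exprn_ge0// ltW.
Qed.

End nikolskii.

(** * Change of exponent *)

Section pointwise.
Variable R : realType.
Implicit Types (t p q r C M L a eta : R).

Lemma powR_exponent_large t M p q : 1 <= t -> t <= M ->
  t `^ p <= M `^ `|p - q| * t `^ q.
Proof.
move=> t1 tM; have t0 : 0 < t by exact: lt_le_trans t1.
have M0 : 0 < M by exact: lt_le_trans tM.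
rewrite -{1}(subrK q p) powRD ?(gt_eqF t0) ?implybT// ler_wpM2r ?powR_ge0//.
apply: (@le_trans _ _ (t `^ `|p - q|)); first by rewrite ler_powR// ler_norm.
by rewrite ge0_ler_powR// ?nnegrE ltW.
Qed.

(** Threshold at [r^(-J)]. Below it, [t^p <= t] is absorbed by the additive term. Above it,
    [ln(1/t) <= J ln r], so [t^(p-q) <= exp(J C)] when [p < q]; for [q <= p] nothing is lost. *)
Lemma powR_exponent_small t p q r C (J : nat) : 0 <= t -> t < 1 -> 1 <= p -> 1 <= r ->
  0 <= C -> (p < q -> (q - p) * ln r <= C) ->
  t `^ p <= expR (J%:R * C) * t `^ q + r^-1 ^+ J.
Proof.
move=> t0 t1 p1 r1 C0 HC; have r0 : 0 < r by exact: lt_le_trans r1.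
have rJ : 0 <= r^-1 ^+ J by rewrite exprn_ge0// invr_ge0 ltW.
have e1 : 1 <= expR (J%:R * C) by rewrite -expR0 ler_expR mulr_ge0.
have [t_eq0|t_neq0] := eqVneq t 0.
  rewrite t_eq0 powR0; last by rewrite gt_eqF// (lt_le_trans _ p1).
  by rewrite addr_ge0// mulr_ge0 ?expR_ge0 ?powR_ge0.
have tp : 0 < t by rewrite lt_neqAle eq_sym t_neq0.
have [qp|pq] := leP q p.
  apply: (@le_trans _ _ (t `^ q)); first by rewrite ger_powR// tp ltW.
  by rewrite ler_wpDr// ler_peMl// powR_ge0.
have [tr|rt] := leP t (r^-1 ^+ J).
  apply: le_trans (_ : t <= _); first by rewrite -[leRHS]powRr1// ger_powR// tp ltW.
  by rewrite ler_wpDl// mulr_ge0 ?expR_ge0 ?powR_ge0.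
rewrite ler_wpDr// -{1}(subrK q p) powRD ?t_neq0 ?implybT// ler_wpM2r ?powR_ge0//.
rewrite /powR (negbTE t_neq0) ler_expR.
have lt : - (J%:R * ln r) <= ln t.
  have := ltW rt; rewrite -ler_ln ?posrE ?exprn_gt0 ?invr_gt0// lnXn ?invr_gt0//.
  by rewrite lnV ?posrE// mulNrn mulr_natl.
rewrite -opprB mulNr; apply: (@le_trans _ _ (J%:R * ((q - p) * ln r))); last first.
  by rewrite ler_wpM2l// HC.
rewrite lerNl mulrCA -mulrN ler_wpM2l// ?subr_ge0 ltW//.
Qed.

(** If [2^v eta^2 <= 1], then [ln 2^v <= 2 ln(1/eta)] and the log-Hoelder bound gives [exp(2c)].
    Otherwise [2^v < (2^v eta)^2], and the crude [a <= P] suffices, with exponent [2P <= N]. *)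
Lemma powR_local_growth a c P eta (N v : nat) : 0 <= a -> a <= P -> 0 <= c ->
  2 * P <= N%:R -> 0 <= eta -> (eta = 0 -> a = 0) -> a <= c / ln (expR 1 + eta^-1) ->
  (2 ^+ v) `^ a <= expR (2 * c) * (1 + 2 ^+ v * eta) ^+ N.
Proof.
move=> a0 aP c0 PN eta0 ha ac.
have v1 : 1 <= 2 ^+ v :> R by rewrite exprn_ege1// ler1n.
have v0 : 0 < 2 ^+ v :> R by rewrite exprn_gt0.
have s0 : 0 <= 2 ^+ v * eta by rewrite mulr_ge0// ltW.
have s1 : 1 <= (1 + 2 ^+ v * eta) ^+ N by rewrite exprn_ege1// lerDl.
have e1 : 1 <= expR (2 * c) by rewrite -expR0 ler_expR mulr_ge0.
(* For [eta = 0] the convention [0^-1 = 0] reduces the log-Hoelder bound to [a <= c], which does not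
   control [(2^v)^a]; hence the separate hypothesis that [a] vanishes. *)
have [eta_eq0|eta_neq0] := eqVneq eta 0.
  by rewrite ha// powRr0 -[leLHS]mulr1 ler_pM.
have etap : 0 < eta by rewrite lt_neqAle eq_sym eta_neq0.
have [small|big] := leP (2 ^+ v * eta ^+ 2) 1.
  apply: (@le_trans _ _ (expR (2 * c))); last by rewrite ler_peMr// expR_ge0.
  rewrite /powR (gt_eqF v0) ler_expR.
  pose l := ln (expR 1 + eta^-1).
  have A0 : 0 < expR 1 + eta^-1 :> R by rewrite addr_gt0// ?expR_gt0 ?invr_gt0.
  have lv : ln (2 ^+ v) <= 2 * l.
    rewrite mulr_natl -lnXn// ler_ln ?posrE ?exprn_gt0//.
    apply: (@le_trans _ _ (eta^-1 ^+ 2)).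
      by rewrite exprVn -[leRHS]mul1r ler_pdivlMr// exprn_gt0.
    by rewrite lerXn2r ?nnegrE ?ltW ?invr_gt0// ltrDr expR_gt0.
  have l0 : 0 < l.
    rewrite ln_gt0// ltr_wpDr ?invr_ge0// -[ltLHS]expR0 ltr_expR//.
  apply: le_trans (ler_wpM2l a0 lv) _; rewrite mulrCA ler_wpM2l//.
  by rewrite -ler_pdivlMr.
apply: (@le_trans _ _ ((1 + 2 ^+ v * eta) ^+ N)); last by rewrite ler_peMl// exprn_ge0// addr_ge0.
have P0 : 0 <= P by exact: le_trans aP.
apply: (@le_trans _ _ ((2 ^+ v) `^ P)); first by rewrite ler_powR.
have S1 : 1 <= 1 + 2 ^+ v * eta by rewrite lerDl.
apply: (@le_trans _ _ (((1 + 2 ^+ v * eta) ^+ 2) `^ P)).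
  apply: ge0_ler_powR => //; rewrite ?nnegrE ?exprn_ge0 ?addr_ge0// ?ltW//.
  apply: (@lt_le_trans _ _ ((2 ^+ v * eta) ^+ 2)).
    by rewrite exprMn expr2 -mulrA ltr_pMr// -expr2.
  by rewrite lerXn2r ?nnegrE ?addr_ge0// lerDr.
rewrite -powR_mulrn ?addr_ge0// -powRrM -(@powR_mulrn _ _ N) ?addr_ge0//.
by rewrite ler_powR.
Qed.

End pointwise.

Section weight_lower_bound.
Variables (R : realType) (n : nat).
Implicit Types x : 'rV[R]_n.

Lemma enorm_ge0 x : 0 <= enorm x. Proof. exact: sqrtr_ge0. Qed.

Lemma dotrV_ge0 x : 0 <= dotrV x x.
Proof. by apply: sumr_ge0 => i _; rewrite -expr2 sqr_ge0. Qed.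

Lemma sqr_coord_le_enorm x i : x 0 i ^+ 2 <= enorm x ^+ 2.
Proof.
rewrite sqr_sqrtr ?dotrV_ge0// /dotrV (bigD1 i)//= -expr2 lerDl.
by apply: sumr_ge0 => j _; rewrite -expr2 sqr_ge0.
Qed.

Lemma enorm_eq0 x : enorm x = 0 -> x = 0.
Proof.
move=> x0; apply/rowP => i; rewrite mxE; have := sqr_coord_le_enorm x i.
by rewrite x0 expr0n/= => h; apply/eqP; rewrite -sqrf_eq0 eq_le h sqr_ge0.
Qed.

Lemma expR1_enorm_gt1 x : 1 < expR 1 + enorm x.
Proof. by rewrite ltr_wpDr ?enorm_ge0// -[ltLHS]expR0 ltr_expR. Qed.

(** Each of the [n] factors satisfies [1 + x_i^2 <= (e + |x|)^2]. This converts the threshold of the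
    decay argument into an integrable function. *)
Lemma enorm_weight_le x : (expR 1 + enorm x)^-1 ^+ (2 * n) <= weight x.
Proof.
rewrite exprM -[in X in _ ^+ X](card_ord n) -prodr_const; apply: ler_prod => i _.
have e0 := enorm_ge0 x; have r0 := expR1_enorm_gt1 x.
rewrite exprn_ge0 ?invr_ge0 ?addr_ge0 ?expR_ge0//= exprVn lef_pV2 ?posrE.
- apply: (@le_trans _ _ (1 + enorm x ^+ 2)); first by rewrite lerD2l sqr_coord_le_enorm.
  have e1 : 1 <= expR 1 :> R by rewrite -[leLHS]expR0 ler_expR.
  rewrite sqrrD -addrA lerD// ?exprn_ege1// ler_wpDl//.
  by rewrite mulrn_wge0// mulr_ge0// expR_ge0.
- by rewrite exprn_gt0// (lt_trans _ r0).
- exact: oneDsq_gt0.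
Qed.

End weight_lower_bound.

Lemma exprn_le_expR (R : realType) (x : R) N : 0 <= x -> x ^+ N <= N`!%:R * expR x.
Proof.
move=> x0; case: N => [|N]; first by rewrite expr0 mul1r -expR0 ler_expR.
rewrite mulrC -ler_pdivrMr ?ltr0n ?fact_gt0//.
by apply: le_trans (expR_ge1Dxn N x0); rewrite lerDr.
Qed.

Lemma measurable_EFinT (R : realType) d (X : measurableType d) (u : X -> R) :
  measurable_fun [set: X] u -> measurable_fun [set: X] (fun x => (u x)%:E).
Proof. by move=> mu; exact/measurable_EFinP. Qed.

Lemma ge0_integral_le_comb (R : realType) d (X : measurableType d)
    (mu : {measure set X -> \bar R}) (G g w1 w2 : X -> R) (L I : R) :
  measurable_fun [set: X] G -> measurable_fun [set: X] g ->
  measurable_fun [set: X] w1 -> measurable_fun [set: X] w2 ->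
  (forall x, 0 <= G x) -> (forall x, 0 <= g x) -> (forall x, 0 <= w1 x) ->
  (forall x, 0 <= w2 x) -> 0 <= L ->
  {ae mu, forall x, G x <= L * g x + (w1 x + w2 x)} ->
  (\int[mu]_x (g x)%:E <= 1)%E -> (\int[mu]_x (w1 x)%:E = I%:E)%E ->
  (\int[mu]_x (w2 x)%:E = I%:E)%E ->
  (\int[mu]_x (G x)%:E <= (L + 2 * I)%:E)%E.
Proof.
move=> mG mg m1 m2 G0 g0 w10 w20 L0 ae gI I1 I2.
have e := @measurable_EFinT R _ X.
apply: (@le_trans _ _ (\int[mu]_x (L%:E * (g x)%:E + ((w1 x)%:E + (w2 x)%:E)))%E).
  apply: ae_ge0_le_integral => //.
  - by move=> x _; rewrite lee_fin.
  - exact: e.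
  - by move=> x _; rewrite lee_fin addr_ge0 ?mulr_ge0 ?addr_ge0.
  - by apply: (e (fun x => L * g x + (w1 x + w2 x))); apply: measurable_funD;
      [exact: measurable_funM|exact: measurable_funD].
  - by apply: filterS ae => x Gx _; rewrite lee_fin.
rewrite ge0_integralD//.
- rewrite ge0_integralZl//; last 2 first.
  + exact: e.
  + by move=> x _; rewrite lee_fin.
  rewrite ge0_integralD//; last 4 first.
  + by move=> x _; rewrite lee_fin.
  + exact: e.
  + by move=> x _; rewrite lee_fin.
  + exact: e.
  rewrite I1 I2 mulr2n mulrDl mul1r !EFinD leeD2r//.
  by rewrite -[leRHS]mule1 lee_wpmul2l.
- by move=> x _; rewrite lee_fin mulr_ge0.
- by apply: (e (fun x => L * g x)); exact: measurable_funM.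
- by move=> x _; rewrite lee_fin addr_ge0.
- by apply: (e (fun x => w1 x + w2 x)); exact: measurable_funD.
Qed.

(** * Modular and norm of a translate *)

Section modular_norm.
Variables (R : realType) (n : nat).
Local Notation lam := (lebesgue_rV R n).
Local Notation T := (lebesgueT R n).
Implicit Types (x y h : 'rV[R]_n) (f : 'rV[R]_n -> R[i]) (p : 'rV[R]_n -> R).

Lemma measurable_translate (u : 'rV[R]_n -> R) h : measurable_fun [set: T] u ->
  measurable_fun [set: T] (fun x : T => u (x + h)).
Proof.
move=> mu; rewrite (_ : (fun x : T => _) = u \o affine 1 h).
  exact: (measurableT_comp mu (measurable_affine_lebesgueT h (oner_neq0 R))).
by apply/funext => x; rewrite /= /affine scale1r.
Qed.

Lemma cmeasurable_translate f h : cmeasurable f -> cmeasurable (translate h f).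
Proof.
move=> [mr mi]; split.
  exact: (@measurable_translate (fun x => complex.Re (f x)) h mr).
exact: (@measurable_translate (fun x => complex.Im (f x)) h mi).
Qed.

Lemma ge0_integral_translate (F : 'rV[R]_n -> \bar R) h : measurable_fun [set: T] F ->
  (forall x, 0 <= F x)%E -> (\int[lam]_x F (x + h)%R = \int[lam]_x F x)%E.
Proof.
move=> mF F0; have := ge0_integral_affine h (oner_neq0 R) mF F0.
rewrite normr1 invr1 expr1n mul1e => <-.
by apply: eq_integral => x _; rewrite scale1r.
Qed.

Lemma measurable_modular_integrand p f m : is_exponent p -> cmeasurable f -> 0 < m ->
  measurable_fun [set: T] (fun x => (m^-1 * Normc.normc (f x)) `^ p x).
Proof.
move=> [mp _] mf m0.
apply: (@measurable_powR2 R _ T (fun x => m^-1 * Normc.normc (f x)) p _ mp).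
by apply: measurable_funM; [exact: measurable_cst|exact: (measurable_normc mf)].
Qed.

Lemma modularE p f m : 0 < m -> modular p (fun x => (m^-1)%:C%C * f x)%R =
  (\int[lam]_x ((m^-1 * Normc.normc (f x)) `^ p x)%:E)%E.
Proof. by move=> m0; apply: eq_integral => x _; rewrite normc_scaleV. Qed.

(** Because [1 <= p x] and [1 <= L], dividing the function by [L] multiplies the integrand by
    [L^(-p x) <= L^-1]. *)
Lemma modular_rescale p f (m L : R) : is_exponent p -> cmeasurable f -> 0 < m -> 1 <= L ->
  (modular p (fun x => (m^-1)%:C%C * f x)%R <= L%:E)%E ->
  (modular p (fun x => ((L * m)^-1)%:C%C * f x)%R <= 1)%E.
Proof.
move=> ep mf m0 L1; have L0 : 0 < L by exact: lt_le_trans L1.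
have Lm : 0 < L * m by rewrite mulr_gt0.
rewrite (modularE p f Lm) (modularE p f m0) => hL.
have mG := measurable_modular_integrand ep mf Lm.
have mg := measurable_modular_integrand ep mf m0.
pose g (x : 'rV[R]_n) := (m^-1 * Normc.normc (f x)) `^ p x.
have LV : 0 <= L^-1 by rewrite invr_ge0 ltW.
apply: (@le_trans _ _ (\int[lam]_x (L^-1%:E * (g x)%:E))%E).
  apply: ge0_le_integral.
  - exact: measurableT.
  - by move=> x _; rewrite lee_fin powR_ge0.
  - exact: (measurable_EFinT mG).
  - exact: (measurable_EFinT (measurable_funM (measurable_cst (L^-1 : R)) mg)).
  move=> x _; rewrite -EFinM lee_fin invfM -mulrA.
  have t0 : 0 <= m^-1 * Normc.normc (f x) by rewrite mulr_ge0 ?normc_ge0// invr_ge0 ltW.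
  rewrite powRM// /g ler_wpM2r ?powR_ge0//.
  by apply: ge1r_powR; [rewrite invr_gt0 L0 invf_le1|case: ep].
rewrite ge0_integralZl; first last.
- by rewrite lee_fin.
- by move=> x _; rewrite lee_fin powR_ge0.
- exact: (measurable_EFinT mg).
- exact: measurableT.
by rewrite lee_pdivrMl// mule1.
Qed.

(** Every [m] admissible in the infimum for [f] makes [L * m] admissible for the translate. *)
Lemma pnorm_translate_le p f h (L : R) : is_exponent p -> cmeasurable f -> 1 <= L ->
  (forall m, 0 < m -> (modular p (fun x => (m^-1)%:C%C * f x)%R <= 1)%E ->
    (modular p (fun x => (m^-1)%:C%C * translate h f x)%R <= L%:E)%E) ->
  (pnorm p (translate h f) <= L%:E * pnorm p f)%E.
Proof.
move=> ep mf L1 H; have L0 : 0 < L by exact: lt_le_trans L1.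
rewrite -lee_pdivrMl//; apply: le_ereal_inf_tmp => _ [m [m0 hm] <-].
have mod1 := modular_rescale ep (cmeasurable_translate h mf) m0 L1 (H m m0 hm).
have Lm : (pnorm p (translate h f) <= (L * m)%:E)%E.
  by apply: ereal_inf_lbound; exists (L * m); first exact: (conj (mulr_gt0 L0 m0) mod1).
by move: Lm; rewrite EFinM -(lee_pdivrMl _ _ L0).
Qed.

Lemma modular_translate_cst p f h m : is_exponent p -> cmeasurable f -> 0 < m ->
  (forall x y, p x = p y) ->
  modular p (fun x => (m^-1)%:C%C * translate h f x)%R =
  modular p (fun x => (m^-1)%:C%C * f x)%R.
Proof.
move=> ep mf m0 pc; rewrite (modularE p (translate h f) m0) (modularE p f m0).
rewrite -(@ge0_integral_translate
  (fun x => ((m^-1 * Normc.normc (f x)) `^ p x)%:E) h); last 2 first.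
- exact: (measurable_EFinT (measurable_modular_integrand ep mf m0)).
- by move=> x; rewrite lee_fin powR_ge0.
by apply: eq_integral => x _; rewrite (pc x (x + h)).
Qed.

End modular_norm.

(** * Positivity of the log-Hoelder constant *)

Section log_Holder_constant.
Variables (R : realType) (n : nat).
Implicit Types (p : 'rV[R]_n -> R).

Lemma clog_inv_ge0 p : 0 <= clog_inv p.
Proof.
rewrite /clog_inv le_max; apply/orP; left.
set S := [set _ | _]; have [S0|/set0P/negP/negPn/eqP ->] := pselect (S !=set0).
  by apply: lb_le_inf => // c [c0 _]; exact: ltW.
by rewrite inf0.
Qed.

Lemma log_Holder_gt0 (r : R) : 0 <= r -> 0 < ln (expR 1 + r).
Proof. by move=> r0; rewrite ln_gt0// ltr_wpDr// -[ltLHS]expR0 ltr_expR. Qed.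

(** Every admissible local constant is at least [|1/p(x) - 1/p(y)| ln(e + 1/|x - y|)], which is
    positive. *)
Lemma clog_inv_gt0 p x y : is_exponent p -> local_log_Holder p -> p x != p y ->
  0 < clog_inv p.
Proof.
move=> [_ p1] [c1 c10 hc1] pxy; rewrite /clog_inv lt_max; apply/orP; left.
have p0 z : 0 < p z by exact: lt_le_trans (p1 z).
have l0 : 0 < ln (expR 1 + (enorm (x - y))^-1) :> R.
  by apply: log_Holder_gt0; rewrite invr_ge0 enorm_ge0.
have d0 : 0 < `|(p x)^-1 - (p y)^-1|.
  by rewrite normr_gt0 subr_eq0 (inj_eq invr_inj).
apply: (@lt_le_trans _ _ (`|(p x)^-1 - (p y)^-1| * ln (expR 1 + (enorm (x - y))^-1))).
  by rewrite mulr_gt0.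
apply: lb_le_inf; last by move=> c [_ hc]; have := hc x y; rewrite ler_pdivlMr.
(* The infimum of the empty set would be 0, so an admissible constant is exhibited: that of [p]
   works, since [|1/p(z) - 1/p(w)| <= |p(z) - p(w)|] for [1 <= p]. *)
exists c1; split=> // z w; apply: le_trans (hc1 z w).
have -> : (p z)^-1 - (p w)^-1 = (p w - p z) * ((p z)^-1 * (p w)^-1).
  by field; rewrite !gt_eqF.
rewrite normrM distrC ler_piMr// normrM mulr_ile1// gtr0_norm ?invr_gt0//.
  by rewrite invf_le1.
by rewrite invf_le1.
Qed.

End log_Holder_constant.

(** * The modular estimate for translates *)

Section main_estimate.
Variables (R : realType) (n : nat) (p : 'rV[R]_n -> R).
Local Notation lam := (lebesgue_rV R n).
Local Notation T := (lebesgueT R n).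
Implicit Types (x y h : 'rV[R]_n) (f : 'rV[R]_n -> R[i]).

Lemma powR_translate_le (B : R) : 1 <= B -> Plog p -> exists C0 (N : nat), 0 < C0 /\
  forall x h v t, 0 <= t -> t <= B * 2 ^+ (v * n) ->
  t `^ p x <= C0 * (1 + 2 ^+ v * enorm h) ^+ N * t `^ p (x + h) + (weight x + weight (x + h)).
Proof.
move=> B1 [[_ p1] [c1 c10 hc1] [pinf [c2 [c20 hc2]]]].
pose P : R := `|pinf| + c2.
(* With [ln(e + r) >= 1], the decay condition alone bounds [p] by [P]. *)
have lnge1 (r : R) : 0 <= r -> 1 <= ln (expR 1 + r).
  move=> r0; rewrite -[leLHS]expRK ler_ln ?posrE ?expR_gt0//; last by rewrite ltr_pwDl// expR_gt0.
  by rewrite lerDl.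
have pP x : p x <= P.
  have h1 := hc2 x; have h2 : c2 / ln (expR 1 + enorm x) <= c2.
    rewrite ler_pdivrMr; last exact/log_Holder_gt0/enorm_ge0.
    by rewrite ler_peMr ?(ltW c20)// lnge1// enorm_ge0.
  have := ler_norm (p x - pinf); have := ler_norm pinf; rewrite /P; lra.
pose N := Num.bound (2 * P).
have P0 : 0 <= P by rewrite addr_ge0// ltW.
have PN : 2 * P <= N%:R by apply/ltW/archi_boundP; rewrite mulr_ge0.
(* The first summand serves [1 <= t], the second [t < 1]. The power [n], here and in [N * n], comes
   from [2 ^+ (v * n)], the [n]-th power of [2 ^+ v]. *)
pose C0 := B `^ P * expR (2 * c1) ^+ n + expR ((2 * n)%:R * (2 * c2)).
exists C0, (N * n)%N; split; first by rewrite ltr_wpDl ?expR_gt0// mulr_ge0 ?powR_ge0// exprn_ge0// expR_ge0.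
move=> x h v t t0 tM.
have s0 : 0 <= 2 ^+ v * enorm h by rewrite mulr_ge0 ?exprn_ge0 ?enorm_ge0.
have s1 : 1 <= (1 + 2 ^+ v * enorm h) ^+ (N * n) by rewrite exprn_ege1// lerDl.
have W0 : 0 <= weight x + weight (x + h) by rewrite addr_ge0 ?weight_ge0.
have tq0 : 0 <= t `^ p (x + h) by exact: powR_ge0.
have e0 : 0 <= expR ((2 * n)%:R * (2 * c2)) :> R by exact: expR_ge0.
have b0 : 0 <= B `^ P * expR (2 * c1) ^+ n by rewrite mulr_ge0 ?powR_ge0 ?exprn_ge0 ?expR_ge0.
have [t1|t1] := ltP t 1; last first.
  pose a := `|p x - p (x + h)|.
  apply: (@le_trans _ _ (C0 * (1 + 2 ^+ v * enorm h) ^+ (N * n) * t `^ p (x + h))); last by rewrite lerDl.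
  apply: le_trans (powR_exponent_large _ _ t1 tM) _; apply: ler_wpM2r => //.
  have v0 : 0 <= 2 ^+ v :> R by rewrite exprn_ge0.
  have aP : a <= P.
    have := p1 x; have := p1 (x + h); have := pP x; have := pP (x + h).
    by rewrite /a ler_norml; lra.
  have ha : enorm h = 0 -> a = 0.
    by move=> /enorm_eq0 h0; rewrite /a h0 addr0 subrr normr0.
  have ac : a <= c1 / ln (expR 1 + (enorm h)^-1).
    have := hc1 (x + h) x; rewrite distrC -/a.
    by rewrite (_ : x + h - x = h)// addrAC subrr add0r.
  have G := powR_local_growth v (normr_ge0 _) aP (ltW c10) PN (enorm_ge0 h) ha ac.
  rewrite -/a powRM ?exprn_ge0//; last exact: le_trans B1.
  have -> : (2 ^+ (v * n)) `^ a = ((2 ^+ v) `^ a) ^+ n :> R.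
    by rewrite exprM -(powR_mulrn n v0) -(powR_mulrn n (powR_ge0 _ _)) powRAC.
  apply: (@le_trans _ _ (B `^ P * (expR (2 * c1) * (1 + 2 ^+ v * enorm h) ^+ N) ^+ n)).
    apply: ler_pM; rewrite ?powR_ge0 ?exprn_ge0 ?powR_ge0//; first by rewrite ler_powR.
    by apply: lerXn2r => //; rewrite nnegrE ?powR_ge0// (le_trans (powR_ge0 _ _) G).
  rewrite exprMn -exprM mulrA ler_wpM2r// ?(le_trans _ s1)//.
  by rewrite lerDl.
(* Take [r = e + min(|x|, |x + h|)]: the decay condition is then usable at both points, whence
   [2 * c2]. The minimum may be attained at either point, so the error is the sum of the two
   weights. *)
have le_max_weight : exists2 r : R, 1 <= r & r^-1 ^+ (2 * n) <= weight x + weight (x + h) /\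
    r <= expR 1 + enorm x /\ r <= expR 1 + enorm (x + h).
  have [hle|hlt] := leP (enorm x) (enorm (x + h)).
    exists (expR 1 + enorm x); first exact/ltW/expR1_enorm_gt1.
    split; last by rewrite lexx lerD2l.
    by apply: le_trans (enorm_weight_le x) _; rewrite lerDl weight_ge0.
  exists (expR 1 + enorm (x + h)); first exact/ltW/expR1_enorm_gt1.
  split; last by rewrite lexx lerD2l ltW.
  by apply: le_trans (enorm_weight_le (x + h)) _; rewrite lerDr weight_ge0.
have [r r1 [rW [rx rh]]] := le_max_weight.
have r0 : 0 < r by exact: lt_le_trans r1.
have lnr0 : 0 <= ln r by exact: ln_ge0.
have decay y : r <= expR 1 + enorm y -> `|p y - pinf| * ln r <= c2.
  move=> ry; have l0 : 0 < ln (expR 1 + enorm y) by exact/log_Holder_gt0/enorm_ge0.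
  apply: (@le_trans _ _ (`|p y - pinf| * ln (expR 1 + enorm y))).
    by rewrite ler_wpM2l// ler_ln ?posrE// (lt_le_trans r0).
  by rewrite -ler_pdivlMr.
have c22 : 0 <= 2 * c2 by rewrite mulr_ge0// ltW.
apply: le_trans (@powR_exponent_small _ t (p x) (p (x + h)) r (2 * c2) (2 * n) t0 t1 (p1 x) r1 c22 _) _.
  move=> _; have := decay _ rx; have := decay _ rh => d1 d2.
  apply: (@le_trans _ _ ((`|p (x + h) - pinf| + `|p x - pinf|) * ln r)).
    rewrite ler_wpM2r// (le_trans (ler_norm _))//.
    rewrite (_ : p (x + h) - p x = (p (x + h) - pinf) - (p x - pinf)); last by ring.
    exact: ler_normB.
  by rewrite mulrDl; lra.
apply: lerD => //; apply: ler_wpM2r => //.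
apply: (@le_trans _ _ C0); first by rewrite lerDr.
by rewrite ler_peMr// addr_ge0.
Qed.

(** Integration of the pointwise bound: the translated modular is at most 1, and each of the two
    weights contributes [pi^n]. *)
Lemma modular_translate_le : Plog p -> exists C0 (N : nat), 0 < C0 /\
  forall h v f m, cmeasurable f -> 0 < m ->
  dsupp (fourier_dist f) `<=` [set xi | enorm xi <= 2 ^+ v.+1] ->
  (modular p (fun x => (m^-1)%:C%C * f x)%R <= 1)%E ->
  (modular p (fun x => (m^-1)%:C%C * translate h f x)%R <=
    (C0 * (1 + 2 ^+ v * enorm h) ^+ N + 2 * pi ^+ n)%:E)%E.
Proof.
move=> plog; have [B B0 HB] := nikolskii R n.
have B1 : 1 <= B + 1 by rewrite lerDr ltW.
have [C0 [N [C00 H]]] := powR_translate_le B1 plog.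
have [ep _ _] := plog; exists C0, N; split => // h v f m mf m0 fs mod1.
have mft := cmeasurable_translate h mf.
rewrite (modularE p (translate h f) m0).
have mod1' := mod1; rewrite (modularE p f m0) in mod1'.
pose g x := (m^-1 * Normc.normc (f x)) `^ p x.
have mg : measurable_fun [set: T] g by exact: measurable_modular_integrand.
have mW : measurable_fun [set: T] (@weight R n).
  by apply: measurable_fun_lebesgueT; exact: measurable_weight.
have s0 : 0 <= 2 ^+ v * enorm h by rewrite mulr_ge0 ?exprn_ge0 ?enorm_ge0.
have EW := measurable_EFinT mW.
have Eg := measurable_EFinT mg.
apply: (@ge0_integral_le_comb R _ T lam
  (fun x => (m^-1 * Normc.normc (translate h f x)) `^ p x) (fun x => g (x + h))
  (@weight R n) (fun x => weight (x + h))).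
- exact: measurable_modular_integrand.
- exact: measurable_translate.
- exact: mW.
- exact: measurable_translate.
- by move=> x; exact: powR_ge0.
- by move=> x; exact: powR_ge0.
- by move=> x; exact: weight_ge0.
- by move=> x; exact: weight_ge0.
- by rewrite mulr_ge0 ?(ltW C00)// exprn_ge0// addr_ge0.
- have := negligible_affine h (oner_neq0 R) (HB p f m v ep mf m0 mod1 fs).
  apply: filterS => x; rewrite scale1r => hx.
  apply: H; first by rewrite mulr_ge0 ?normc_ge0// invr_ge0 ltW.
  rewrite mulrC ler_pdivrMr//; apply: le_trans hx _.
  by rewrite ler_wpM2r ?(ltW m0)// ler_wpM2r ?exprn_ge0// lerDl.
- rewrite (@ge0_integral_translate R n (fun x => (g x)%:E) h Eg)//.
  by move=> x; rewrite lee_fin powR_ge0.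
- exact: integral_weight.
- rewrite (@ge0_integral_translate R n (fun x => (weight x)%:E) h EW) ?integral_weight//.
  by move=> x; rewrite lee_fin weight_ge0.
Qed.

End main_estimate.

Theorem theorem1 (R : realType) (n : nat) (n_gt0 : (0 < n)%N)
    (p : 'rV[R]_n -> R) (p_log : Plog p)
    (p_bounds : [/\ (1 < pminus p)%E, (pminus p <= pplus p)%E
                  & (pplus p < +oo)%E]) :
  exists2 c : R, 0 < c &
    forall (h : 'rV[R]_n) (k : nat), (0 < k)%N ->
    forall (v : nat) (f : 'rV[R]_n -> R[i]), Lp p f ->
      dsupp (fourier_dist f) `<=` [set xi | enorm xi <= 2 ^+ v.+1] ->
      (pnorm p (translate h f) <=
        (c * expR ((2 + 2 ^+ (v * n * k) * enorm h ^+ k) * clog_inv p))%:E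
          * pnorm p f)%E.
Proof.
have [ep lp _] := p_log; set gam := clog_inv p.
have gam0 : 0 <= gam by exact: clog_inv_ge0.
have S0 v (h : 'rV[R]_n) k : 0 <= 2 ^+ (v * n * k) * enorm h ^+ k.
  by apply: mulr_ge0; apply: exprn_ge0 => //; exact: enorm_ge0.
have e1 v (h : 'rV[R]_n) k : 1 <= expR ((2 + 2 ^+ (v * n * k) * enorm h ^+ k) * gam).
  by rewrite -[leLHS]expR0 ler_expR mulr_ge0// addr_ge0.
have [pc|npc] := pselect (forall x y, p x = p y).
  exists 1 => // h k k0 v f [mf _] fs; rewrite mul1r.
  apply: pnorm_translate_le => // m m0 hm.
  rewrite (modular_translate_cst h ep mf m0 pc); apply: le_trans hm _.
  by rewrite lee_fin.
have gam_gt0 : 0 < gam.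
  have [x /existsNP[y /eqP pxy]] : exists x, ~ forall y, p x = p y by exact/existsNP.
  exact: (clog_inv_gt0 ep lp pxy).
have [C0 [N [C00 H]]] := modular_translate_le p_log.
have pin : 0 <= 2 * pi ^+ n :> R by rewrite mulr_ge0// exprn_ge0// pi_ge0.
(* The three summands pay for the polynomial through [X^N <= N! exp X], for the integrals of the
   weights, and for [1 <= c], which the rescaling of the modular requires. *)
pose c := C0 * (N`!%:R / gam ^+ N) + 2 * pi ^+ n + 1.
have cN : 0 <= C0 * (N`!%:R / gam ^+ N).
  by rewrite mulr_ge0 ?(ltW C00)// divr_ge0// exprn_ge0.
have c1 : 1 <= c by rewrite lerDr addr_ge0.
exists c; first exact: lt_le_trans c1.
move=> h k k0 v f [mf _] fs.
apply: pnorm_translate_le => //.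
  by rewrite -[leLHS]mulr1 ler_pM.
move=> m m0 hm; apply: le_trans (H h v f m mf m0 fs hm) _; rewrite lee_fin.
set S := 2 ^+ (v * n * k) * enorm h ^+ k.
(* If [2^v |h| <= 1], the constant 2 suffices. Otherwise [2^(vn) |h| > 1] because [n >= 1], and
   raising it to the power [k >= 1] does not decrease it; so no constant depends on [k]. *)
have sS : 1 + 2 ^+ v * enorm h <= 2 + S.
  have [s1|s1] := leP (2 ^+ v * enorm h) 1.
    by have := S0 v h k; rewrite -/S; lra.
  suff : 2 ^+ v * enorm h <= S by lra.
  have vn : 2 ^+ v * enorm h <= 2 ^+ (v * n) * enorm h.
    by rewrite ler_wpM2r ?enorm_ge0// ler_eXn2l ?ltr1n// leq_pmulr.
  apply: (le_trans vn); rewrite /S (exprM 2 (v * n) k) -exprMn -[leLHS]expr1.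
  by apply: ler_weXn2l => //; exact: le_trans (ltW s1) vn.
have s0 : 0 <= 2 ^+ v * enorm h by rewrite mulr_ge0 ?exprn_ge0 ?enorm_ge0.
have SN : (1 + 2 ^+ v * enorm h) ^+ N <= N`!%:R / gam ^+ N * expR ((2 + S) * gam).
  rewrite mulrAC ler_pdivlMr ?exprn_gt0// -exprMn.
  have S2 : 0 <= (2 + S) * gam by rewrite mulr_ge0// addr_ge0// S0.
  apply: le_trans (exprn_le_expR N S2).
  have S1 : 0 <= (1 + 2 ^+ v * enorm h) * gam by rewrite mulr_ge0// addr_ge0.
  by apply: lerXn2r; rewrite ?nnegrE//; apply: ler_wpM2r.
have E1 := e1 v h k; rewrite -/S in E1.
rewrite /c; move: SN E1; set X := expR _ => SN E1.
rewrite [leRHS](_ : _ =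
  C0 * (N`!%:R / gam ^+ N * X) + 2 * pi ^+ n * X + X); last by ring.
apply: ler_wpDr; first exact: le_trans ler01 E1.
apply: lerD; first by apply: ler_wpM2l SN; exact: ltW.
by rewrite ler_peMr.
Qed.
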